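(* Let $d,N\in\mathbb{N}$ (positive integers). For every $\rho\in H$, $$\lim_{\hbar\to 0^+} F^{\mathcal S}_\hbar(\rho)=C(\rho).$$
   Context: Wave functions are complex-valued functions $\psi((x_1,\alpha_1),\dots,(x_N,\alpha_N))$ on $(\mathbb{R}^d\times\mathbb{Z}_2)^N$, with $x_i\in\mathbb{R}^d$ and spin $\alpha_i\in\{0,1\}$. Write $z=(z_1,\dots,z_N)$, $z_i=(x_i,\alpha_i)$, and $\int f(z)\,dz:=\sum_{\alpha_1,\dots,\alpha_N\in\{0,1\}}\int_{\mathbb{R}^{dN}} f(x_1,\alpha_1;\dots;x_N,\alpha_N)\,dx_1\cdots dx_N$. $H^1((\mathbb{R}^d\times\mathbb{Z}_2)^N)$ is the set of such functions that are $H^1$ in $(x_1,\dots,x_N)$ for each choice of spins; $\nabla$ is the gradient in the space variables. $\mathcal S$ (bosonic wave functions) is the set of $\psi\in H^1((\mathbb{R}^d\times\mathbb{Z}_2)^N)$ with $\int|\psi|^2dz=1$ and $\psi(z_{\sigma(1)},\dots,z_{\sigma(N)})=\psi(z_1,\dots,z_N)$ for all permutations $\sigma$ of $\{1,\dots,N\}$. For a wave function $\psi$, its density is $\rho_\psi(x)=\sum_{\alpha_1,\dots,\alpha_N\in\{0,1\}}\int_{\mathbb{R}^{d(N-1)}}|\psi|^2(x,\alpha_1;x_2,\alpha_2;\dots;x_N,\alpha_N)\,dx_2\cdots dx_N$; write $\psi\downarrow\rho$ if $\rho_\psi=\rho$. $T_\hbar(\psi)=\frac{\hbar^2}{2m}\int|\nabla\psi|^2(z)\,dz$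 with $m>0$ a fixed constant, and $V_{ee}(\psi)=\int\sum_{1\le i<j\le N}\frac{|\psi|^2(z)}{|x_i-x_j|}\,dz\in[0,+\infty]$. $H=\{\rho:\mathbb{R}^d\to\mathbb{R}\ :\ \rho\ge 0,\ \int\rho=1,\ \sqrt\rho\in H^1(\mathbb{R}^d)\}$. For $\rho\in H$ and $\hbar>0$: $F^{\mathcal S}_\hbar(\rho)=\inf\{T_\hbar(\psi)+V_{ee}(\psi):\psi\in\mathcal S,\ \psi\downarrow\rho\}$. $\Pi(\rho)$ is the set of Borel probability measures $P$ on $\mathbb{R}^{dN}$ all of whose $N$ marginals on $\mathbb{R}^d$ equal $\rho$ (that is, $\rho\,dx$), and $C(\rho)=\min_{P\in\Pi(\rho)}\int\sum_{1\le i<j\le N}\frac{1}{|x_i-x_j|}\,dP$, where $1/0=+\infty$. *)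

(* Defs.v *)
From HB Require Import structures.
From mathcomp Require Import all_boot all_order all_algebra perm.
From mathcomp Require Import all_classical all_reals all_analysis.
From mathcomp.real_closed Require Import complex.

Set Implicit Arguments.
Unset Strict Implicit.
Unset Printing Implicit Defensive.
Import Order.TTheory GRing.Theory Num.Theory.
Import numFieldNormedType.Exports.
Local Open Scope classical_set_scope.
Local Open Scope ring_scope.

Definition borel_mx_display : measure_display.
Proof. exact: default_measure_display. Qed.

Section borel_mx.
Context (R : realType) (m n : nat).

Definition borel_mx : set (set 'M[R]_(m, n)) := <<s @open 'M[R]_(m, n) >>.

Let borel_mx0 : borel_mx set0. Proof. exact: sigma_algebra0. Qed.

Let borel_mxC A : borel_mx A -> borel_mx (~` A).
Proof. exact: sigma_algebraC. Qed.

Let borel_mx_bigcup (F : (set 'M[R]_(m, n))^nat) :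
  (forall i, borel_mx (F i)) -> borel_mx (\bigcup_i F i).
Proof. exact: sigma_algebra_bigcup. Qed.

HB.instance Definition _ := @isMeasurable.Build borel_mx_display
  'M[R]_(m, n) borel_mx borel_mx0 borel_mxC borel_mx_bigcup.

Lemma open_measurable_mx (A : set 'M[R]_(m, n)) : open A -> measurable A.
Proof. exact: sub_sigma_algebra. Qed.

End borel_mx.

Section sigma_finite.
Local Open Scope ereal_scope.
Context d1 d2 (T1 : measurableType d1) (T2 : measurableType d2) (R : realType).

Lemma sigma_finite_pushforward (mu : {measure set T1 -> \bar R})
    (f : T1 -> T2) (g : T2 -> T1) :
  sigma_finite setT mu -> measurable_fun setT g -> cancel f g ->
  sigma_finite setT (pushforward mu f).
Proof.
move=> [F TF Foo] mg fK; exists (fun k => g @^-1` F k).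
  by rewrite -preimage_bigcup -TF preimage_setT.
move=> k; have [mFk Fkoo] := Foo k; split.
  by rewrite -[X in measurable X]setTI; exact: mg.
rewrite /pushforward -comp_preimage (_ : g \o f = id) ?preimage_id//.
exact/funext/fK.
Qed.

Lemma sigma_finite_product_measure
    (m1 : {sigma_finite_measure set T1 -> \bar R})
    (m2 : {sigma_finite_measure set T2 -> \bar R}) :
  sigma_finite setT (m1 \x m2).
Proof.
have /sigma_finiteP[F [TF ndF Foo]] := sigma_finiteT m1.
have /sigma_finiteP[G [TG ndG Goo]] := sigma_finiteT m2.
exists (fun n => F n `*` G n).
  rewrite -setXTT TF TG predeqE => -[x y]; split.
    move=> [/= [n _ Fnx] [k _ Gky]]; exists (maxn n k) => //; split.
    - by move: x Fnx; exact/subsetPset/ndF/leq_maxl.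
    - by move: y Gky; exact/subsetPset/ndG/leq_maxr.
  by move=> [n _ []/= ? ?]; split; exists n.
move=> k; have [? ?] := Foo k; have [? ?] := Goo k.
split; first exact: measurableX.
by rewrite product_measure1E// lte_mul_pinfty// ge0_fin_numE.
Qed.

End sigma_finite.

Section lebesgue_tuple.
Context (R : realType).
Let RT : measurableType _ := measurableTypeR R.

Definition uncons n (t : n.+1.-tuple RT) : RT * n.-tuple RT :=
  (thead t, [tuple of behead t]).

Definition tcons n (p : RT * n.-tuple RT) : n.+1.-tuple RT :=
  [tuple of p.1 :: p.2].

Lemma tconsK n : cancel (@tcons n) (@uncons n).
Proof. by move=> [x t]; congr pair; apply: val_inj. Qed.

Lemma measurable_tcons n : measurable_fun setT (@tcons n).
Proof. exact: measurable_cons. Qed.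

Lemma measurable_uncons n : measurable_fun setT (@uncons n).
Proof.
apply: measurable_fun_pair; last exact: measurable_behead.
exact: measurable_tnth.
Qed.

Section prepend.
Context (n : nat) (mu : {sigma_finite_measure set (n.-tuple RT) -> \bar R}).

(* The product of the Lebesgue measure on R with mu, seen on n.+1.-tuple R. *)
Definition lebesgue_cons : set (n.+1.-tuple RT) -> \bar R :=
  pushforward ((@lebesgue_measure R) \x mu)%E (@tcons n).

Let mtcons := @measurable_tcons n.

Let lebesgue_cons0 : lebesgue_cons set0 = 0.
Proof. exact: measure0. Qed.

Let lebesgue_cons_ge0 A : (0 <= lebesgue_cons A)%E.
Proof. exact: measure_ge0. Qed.

Let lebesgue_cons_sigma_additive : semi_sigma_additive lebesgue_cons.
Proof. exact: measure_semi_sigma_additive. Qed.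

HB.instance Definition _ := isMeasure.Build _ _ _ lebesgue_cons
  lebesgue_cons0 lebesgue_cons_ge0 lebesgue_cons_sigma_additive.

Let lebesgue_cons_sigma_finite : sigma_finite setT lebesgue_cons.
Proof.
by apply: sigma_finite_pushforward (@measurable_uncons n) (@tconsK n);
  exact: sigma_finite_product_measure.
Qed.

HB.instance Definition _ := Measure_isSigmaFinite.Build _ _ _ lebesgue_cons
  lebesgue_cons_sigma_finite.

End prepend.

Fixpoint lebesgue_tuple (n : nat) :
    {sigma_finite_measure set (n.-tuple RT) -> \bar R} :=
  match n with
  | 0 => \d_[tuple]
  | n'.+1 => lebesgue_cons (lebesgue_tuple n')
  end.

End lebesgue_tuple.

Section lebesgue_mx.
Context (R : realType) (m n : nat).
Let RT : measurableType _ := measurableTypeR R.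

Definition tuple_mx (t : (m * n).-tuple RT) : 'M[R]_(m, n) :=
  \matrix_(i, j) tnth t (mxvec_index i j).

Let rat_cube (p : 'M[rat]_(m, n) * nat) : set 'M[R]_(m, n) :=
  [set x | forall i j, `|ratr (p.1 i j) - x i j| < p.2.+1%:R^-1].

Let open_rat_cubes (A : set 'M[R]_(m, n)) : open A ->
  A = \bigcup_p (if `[< rat_cube p `<=` A >] then rat_cube p else set0).
Proof.
move=> oA; apply/seteqP; split=> [x Ax|x [p _]]; last first.
  by case: asboolP => // + px; apply.
have /nbhs_ballP[e /= e0 xeA] : nbhs x A by exact: open_nbhs_nbhs.
have e20 : 0 < e / 2 by rewrite divr_gt0.
have [k _ /(_ k (leqnn k)) ke] := near_infty_natSinv_lt (PosNum e20).
have k0 : 0 < k.+1%:R^-1 :> R by rewrite invr_gt0.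
have rat_near i j : exists q : rat, `|ratr q - x i j| < k.+1%:R^-1.
  have [|q] := @rat_in_itvoo R (x i j - k.+1%:R^-1) (x i j + k.+1%:R^-1).
    by rewrite ltrBlDr -addrA ltrDl addr_gt0.
  by rewrite in_itv/= => qx; exists q; rewrite ltr_distl.
pose q := \matrix_(i < m, j < n) sval (cid (rat_near i j)).
have xq : rat_cube (q, k) x by move=> i j; rewrite /= mxE; case: cid.
exists (q, k) => //; case: asboolP => // -[] y yq; apply: xeA; split=> // i j.
rewrite /ball/= -(subrK (ratr (q i j)) (x i j)) -addrA.
rewrite (le_lt_trans (ler_normD _ _))// [e]splitr ltrD//.
  by rewrite distrC (lt_trans (xq i j)).
by rewrite (lt_trans (yq i j)).
Qed.

Lemma measurable_tuple_mx : measurable_fun setT tuple_mx.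
Proof.
apply: (measurability (@open 'M[R]_(m, n))) => // _ [A oA <-]; rewrite setTI.
rewrite (open_rat_cubes oA) preimage_bigcup.
apply: countable_bigcupT_measurable => // p.
case: asboolP => _; last by rewrite preimage_set0.
rewrite (_ : _ @^-1` _ = \bigcap_(ij in [set: 'I_m * 'I_n])
  (fun t => tnth t (mxvec_index ij.1 ij.2) : RT) @^-1`
    `](ratr (p.1 ij.1 ij.2) - p.2.+1%:R^-1),
      (ratr (p.1 ij.1 ij.2) + p.2.+1%:R^-1)[%classic).
  apply: fin_bigcap_measurable; first exact: finite_finset.
  move=> ij _; rewrite -[X in measurable X]setTI.
  by apply: measurable_tnth => //; exact: measurable_itv.
apply/seteqP; split=> t /= tp => [ij _|i j].
  by have := tp ij.1 ij.2; rewrite mxE distrC ltr_distl/= ?in_itv.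
by have := tp (i, j) I; rewrite mxE distrC ltr_distl/= ?in_itv.
Qed.

Definition lebesgue_mx : set 'M[R]_(m, n) -> \bar R :=
  pushforward (lebesgue_tuple R (m * n)) tuple_mx.

Let mtuple_mx := measurable_tuple_mx.

Let lebesgue_mx0 : lebesgue_mx set0 = 0.
Proof. exact: measure0. Qed.

Let lebesgue_mx_ge0 A : (0 <= lebesgue_mx A)%E.
Proof. exact: measure_ge0. Qed.

Let lebesgue_mx_sigma_additive : semi_sigma_additive lebesgue_mx.
Proof. exact: measure_semi_sigma_additive. Qed.

HB.instance Definition _ := isMeasure.Build _ _ _ lebesgue_mx
  lebesgue_mx0 lebesgue_mx_ge0 lebesgue_mx_sigma_additive.

End lebesgue_mx.
Arguments lebesgue_mx {R m n}.

(* R^(m * n) is 'M[R]_(m, n); R^d is 'rV[R]_d and R^(d * N) is 'M[R]_(N, d). *)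

Section sobolev.
Context (R : realType) (m n : nat).
Implicit Types (u g phi : 'M[R]_(m, n) -> R).

Definition partial (ij : 'I_m * 'I_n) u : 'M[R]_(m, n) -> R :=
  'D_(delta_mx ij.1 ij.2) u.

(* Every iterated partial derivative is differentiable everywhere: this is
   equivalent to phi being of class C^oo. *)
Definition smooth phi : Prop :=
  forall (s : seq ('I_m * 'I_n)) (x : 'M[R]_(m, n)),
    differentiable (foldr partial phi s) x.

Definition test_function phi : Prop :=
  smooth phi /\ compact (closure [set x | phi x != 0]).

Definition locally_integrable_mx u : Prop :=
  forall K, compact K -> (@lebesgue_mx R m n).-integrable K (EFin \o u).

Definition is_weak_partial (ij : 'I_m * 'I_n) u g : Prop :=
  locally_integrable_mx g /\
  forall phi, test_function phi ->
    \int[lebesgue_mx]_x (u x * partial ij phi x) =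
    - \int[lebesgue_mx]_x (g x * phi x).

Definition in_H1 u : Prop :=
  u \in Lfun (@lebesgue_mx R m n) 2%:E /\
  forall ij, exists2 g, is_weak_partial ij u g &
    g \in Lfun (@lebesgue_mx R m n) 2%:E.

(* A weak partial derivative of u if there is one, the zero function otherwise;
   weak derivatives are unique only up to null sets. *)
Definition weak_partial (ij : 'I_m * 'I_n) u : 'M[R]_(m, n) -> R :=
  xget (fun=> 0) [set g | is_weak_partial ij u g].

End sobolev.

(* Functions stand for their classes modulo null sets: permutation symmetry and
   the equality of densities are required almost everywhere. *)

Section wave_functions.
Context (R : realType) (d N : nat).

(* z = (z_1, ..., z_N) with z_i = (x_i, alpha_i); Z_2 is 'I_2 = {0, 1}. *)
Definition configuration : Type := 'I_N -> 'rV[R]_d * 'I_2.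
Definition wave_function : Type := configuration -> R[i].

(* The positions x_1, ..., x_N are the rows of x. *)
Definition config (x : 'M[R]_(N, d)) (alpha : {ffun 'I_N -> 'I_2}) :
  configuration := fun i => (row i x, alpha i).

Definition int_config (f : configuration -> \bar R) : \bar R :=
  (\sum_(alpha : {ffun 'I_N -> 'I_2})
     \int[lebesgue_mx]_x f (config x alpha))%E.

Definition normsq (z : R[i]) : R := (complex.Re z) ^+ 2 + (complex.Im z) ^+ 2.

Implicit Types (psi : wave_function) (alpha : {ffun 'I_N -> 'I_2}).

Definition re_part psi alpha (x : 'M[R]_(N, d)) : R :=
  complex.Re (psi (config x alpha)).
Definition im_part psi alpha (x : 'M[R]_(N, d)) : R :=
  complex.Im (psi (config x alpha)).

(* A complex function is in H^1 iff its real and imaginary parts are, and its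
   weak gradient is then obtained componentwise. *)
Definition in_H1_wave psi : Prop :=
  forall alpha, in_H1 (re_part psi alpha) /\ in_H1 (im_part psi alpha).

(* |grad psi|^2, the gradient being in the space variables only *)
Definition grad_normsq psi alpha (x : 'M[R]_(N, d)) : R :=
  \sum_(ij : 'I_N * 'I_d) (weak_partial ij (re_part psi alpha) x ^+ 2 +
                           weak_partial ij (im_part psi alpha) x ^+ 2).

Definition symmetric_wave psi : Prop :=
  forall (sigma : 'S_N) alpha, {ae lebesgue_mx, forall x : 'M[R]_(N, d),
    psi (config x alpha \o sigma) = psi (config x alpha)}.

Definition bosonic psi : Prop :=
  [/\ in_H1_wave psi,
      int_config (fun z => (normsq (psi z))%:E) = 1%E &
      symmetric_wave psi].

Definition kinetic (mass hbar : R) psi : \bar R :=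
  ((hbar ^+ 2 / (2 * mass))%:E *
   \sum_(alpha : {ffun 'I_N -> 'I_2})
     \int[lebesgue_mx]_x (grad_normsq psi alpha x)%:E)%E.

Definition euclid (v : 'rV[R]_d) : R := Num.sqrt (\sum_j v 0 j ^+ 2).

Definition coulomb (x y : 'rV[R]_d) : \bar R :=
  if x == y then +oo%E else ((euclid (x - y))^-1)%:E.

Definition V_ee psi : \bar R :=
  int_config (fun z => \sum_(i < N) \sum_(j < N | (i < j)%N)
    ((normsq (psi z))%:E * coulomb (z i).1 (z j).1))%E.

(* mu = rho dx *)
Definition has_density (rho : 'rV[R]_d -> R)
    (mu : set 'rV[R]_d -> \bar R) : Prop :=
  forall A, measurable A -> mu A = (\int[lebesgue_mx]_(x in A) (rho x)%:E)%E.

Definition couplings (rho : 'rV[R]_d -> R) : set (probability 'M[R]_(N, d) R) :=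
  [set P | forall i : 'I_N, has_density rho (pushforward P (row i))].

Definition coulomb_cost (P : probability 'M[R]_(N, d) R) : \bar R :=
  (\int[P]_x \sum_(i < N) \sum_(j < N | (i < j)%N)
     coulomb (row i x) (row j x))%E.

(* The minimum C(rho), written as the infimum over the couplings. *)
Definition C_opt (rho : 'rV[R]_d -> R) : \bar R :=
  ereal_inf [set coulomb_cost P | P in couplings rho].

End wave_functions.

Section density.
Context (R : realType) (d n : nat).

(* There are N = n.+1 particles, so that (x_2, ..., x_N) is an n x d matrix. *)
Definition density (psi : wave_function R d n.+1) (x : 'rV[R]_d) : \bar R :=
  (\sum_(alpha : {ffun 'I_n.+1 -> 'I_2})
     \int[lebesgue_mx]_(y in [set: 'M[R]_(n, d)])
       (normsq (psi (config (col_mx x y) alpha)))%:E)%E.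

Definition has_wave_density psi (rho : 'rV[R]_d -> R) : Prop :=
  {ae lebesgue_mx, forall x : 'rV[R]_d, density psi x = (rho x)%:E}.

Definition in_H (rho : 'rV[R]_d -> R) : Prop :=
  [/\ forall x, 0 <= rho x,
      (\int[lebesgue_mx]_x (rho x)%:E = 1)%E &
      in_H1 (fun x => Num.sqrt (rho x))].

Definition F_S (mass hbar : R) (rho : 'rV[R]_d -> R) : \bar R :=
  ereal_inf [set (kinetic mass hbar psi + V_ee psi)%E | psi in
    [set psi | bosonic psi /\ has_wave_density psi rho]].

End density.

(* Main.v *)
From HB Require Import structures.
Require Import Defs.
From mathcomp Require Import all_boot all_order all_algebra perm.
From mathcomp Require Import all_classical all_reals all_analysis.
From mathcomp Require Import measurable_realfun borel_hierarchy.
From mathcomp.real_closed Require Import complex.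
From mathcomp Require Import ring lra.

Set Implicit Arguments.
Unset Strict Implicit.
Unset Printing Implicit Defensive.
Import Order.TTheory GRing.Theory Num.Theory.
Import numFieldNormedType.Exports.
Local Open Scope classical_set_scope.
Local Open Scope ring_scope.

(** Write N for [n.+1]. The lower bound holds for every hbar: the kinetic energy is nonnegative, and
    the spin-summed density |psi|^2 of an admissible psi is, by symmetry, a coupling of rho whose
    Coulomb cost is [V_ee psi] ([coupling_of_wave], [C_opt_le_F_S]). If the optimal cost is
    infinite, this already settles the limit.

    For the upper bound it suffices to find, for each coupling P of finite cost and each e > 0, one
    admissible psi with [V_ee psi <= coulomb_cost P + e] ([near_optimal_wave]). Its gradient energy
    is finite and does not depend on hbar, so the factor hbar^2 makes the kinetic term disappear
    ([near_F_S_le]).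

    A coupling P may be singular, so it is smeared without changing its marginals. Let the squares
    of smooth functions theta_b form a partition of unity of R^d. Put m_b for the integral of
    theta_b^2 rho, and p_l for the P-integral of the product of the theta_{l_i}(x_i)^2. The density
    sum_l p_l prod_i theta_{l_i}(x_i)^2 rho(x_i) / m_{l_i} has all marginals equal to rho. It has
    the form g(x) prod_i rho(x_i), and psi = sqrt(g) prod_i sqrt(rho(x_i)) lies in H^1: since g is a
    finite sum of squares of functions with bounded derivatives, its gradient is at most a constant
    times sqrt(g) ([is_weak_partial_sqrt], [is_weak_partial_tensor], [plan_wave_bosonic]).

    Smearing is harmless on a product of small cells that contains a bounded configuration with well
    separated points: there the energy varies at most by a factor 1 + e ([energy_cell_perturb]). The
    other products of cells are bad: their total weight is at most a small eta, but smearing may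
    bring particles together and make their energy infinite. They are removed by an exchange. Fix
    beforehand 2N configurations in the support of P, the reservoirs, all of whose rows are distinct
    ([reservoirs]). A bad index has N cells and each cell comes near at most one reservoir, so N
    reservoirs stay free ([unblocked_assignment]). Taking mass from the bad index and from N - 1
    free reservoirs and recombining the coordinates along the N cyclic shifts gives configurations
    with one coordinate from the bad index and the others from reservoirs. This preserves the
    marginals ([swap_plan]), and all points are at distance at least beta
    ([swapped_rows_separated]). The added cost is at most N^2 / beta times N eta, which is small
    because beta is fixed before eta ([swapped_wave]). Averaging over permutations restores the
    bosonic symmetry at no cost ([symmetrized_wave]). *)

Lemma ler_mx_coord (R : realType) m n (x : 'M[R]_(m, n)) i j : `|x i j| <= `|x|.
Proof.
rewrite [leRHS]/Num.norm/= mx_normrE.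
by apply/bigmax_geP; right; exists (i, j).
Qed.

Lemma mx_norm_lt (R : realType) m n (x : 'M[R]_(m, n)) e : 0 < e ->
  (forall i j, `|x i j| < e) -> `|x| < e.
Proof.
by move=> e0 xe; rewrite [ltLHS]/Num.norm/= mx_normrE; apply/bigmax_ltP; split.
Qed.

(** * Boxes: generators of the Borel sets of a matrix space, and uniqueness of measures *)

Section boxes.
Context (R : realType).
Local Open Scope ereal_scope.

Lemma lebesgue_tuple_box n (A : 'I_n -> set R) (r : 'I_n -> R) :
  (forall i, measurable (A i : set (measurableTypeR R))) ->
  (forall i, lebesgue_measure (A i) = (r i)%:E) ->
  lebesgue_tuple R n [set t | forall i, A i (tnth t i)] = (\prod_i r i)%R%:E.
Proof.
elim: n A r => [|n IH] A r mA rA.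
  by rewrite big_ord0 /= diracE mem_set// => -[].
rewrite big_ord_recl /= /lebesgue_cons /pushforward.
rewrite (_ : _ @^-1` _ = A ord0 `*`
    [set t : n.-tuple (measurableTypeR R) | forall i, A (lift ord0 i) (tnth t i)]).
  rewrite product_measure1E//; last first.
    rewrite (_ : mkset _ = \bigcap_(i in setT)
        ((fun t : n.-tuple (measurableTypeR R) => tnth t i) @^-1` A (lift ord0 i))).
      apply: fin_bigcap_measurable => [|i _]; first exact: finite_finset.
      by rewrite -[X in measurable X]setTI; exact: measurable_tnth.
    by apply/seteqP; split=> t /= tA i; [move=> _|]; exact: tA.
  rewrite [X in X * _](rA ord0) EFinM; congr (_ * _).
  exact: (IH (fun i => A (lift ord0 i))).
apply/seteqP; split=> -[x t] /= xA.
  split; first exact: (xA ord0).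
  by move=> i; have := xA (lift ord0 i); rewrite tnthS.
by move=> i; case: (unliftP ord0 i) => [j ->|->];
  [rewrite tnthS; apply: xA.2|exact: xA.1].
Qed.

Section mx.
Context (m n : nat).
Implicit Types (a b : 'I_m -> 'I_n -> R).

Definition box (A : 'I_m -> 'I_n -> set R) : set 'M[R]_(m, n) :=
  [set x | forall i j, A i j (x i j)].

Definition obox a b := box (fun i j => `](a i j), (b i j)[%classic).

Lemma lebesgue_mx_box (A : 'I_m -> 'I_n -> set R) (r : 'I_m -> 'I_n -> R) :
  (forall i j, measurable (A i j : set (measurableTypeR R))) ->
  (forall i j, lebesgue_measure (A i j) = (r i j)%:E) ->
  lebesgue_mx (box A) = (\prod_i \prod_j r i j)%R%:E.
Proof.
move=> mA rA; rewrite /lebesgue_mx /pushforward.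
(* [g] inverts [mxvec_index]: a box of matrices becomes a box of tuples once its sides are
   relabelled along [g]. *)
have [g gK Kg] := curry_mxvec_bij m n.
pose h k := g k.
have gE i j : g (mxvec_index i j) = (i, j) by rewrite (gK (i, j)).
have Eg k : mxvec_index (g k).1 (g k).2 = k.
  by have := Kg k isT; rewrite /uncurry; case: (g k).
rewrite (_ : _ @^-1` _ =
    [set t | forall k, A (g k).1 (g k).2 (tnth t k)]); last first.
  apply/seteqP; split=> t /= tA.
    by move=> k; have := tA (g k).1 (g k).2; rewrite mxE Eg.
  by move=> i j; have := tA (mxvec_index i j); rewrite gE mxE.
rewrite (lebesgue_tuple_box (A := fun k => A (g k).1 (g k).2)
  (r := fun k => r (g k).1 (g k).2))//.
congr EFin; rewrite pair_bigA /=.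
rewrite (reindex (fun k => g k)) //=.
exists (fun p : 'I_m * 'I_n => mxvec_index p.1 p.2) => [k _|[i j] _].
  exact: Eg.
exact: gE.
Qed.

Lemma lebesgue_mx_obox a b : lebesgue_mx (obox a b) =
  (\prod_i \prod_j Num.max 0 (b i j - a i j))%R%:E.
Proof.
apply: lebesgue_mx_box => // i j; rewrite lebesgue_measure_itv/= lte_fin.
by case: ltP => [ab|ba]; [rewrite max_r// subr_ge0 ltW|rewrite max_l// subr_le0].
Qed.

Lemma obox_lty a b : lebesgue_mx (obox a b) < +oo.
Proof. by rewrite lebesgue_mx_obox ltry. Qed.

Lemma oboxE a b :
  obox a b = [set x | forall i j, a i j < x i j < b i j]%R.
Proof.
by apply/seteqP; split=> x xab i j; have := xab i j; rewrite /= in_itv.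
Qed.

(** Makes the boxes a pi-system; a disjoint pair is covered too, since bounds in the wrong order
    describe the empty box. *)
Lemma oboxI a b a' b' : obox a b `&` obox a' b' =
  obox (fun i j => Num.max (a i j) (a' i j)) (fun i j => Num.min (b i j) (b' i j)).
Proof.
rewrite !oboxE; apply/seteqP; split=> x /=.
  move=> [xa xb] i j; have := xa i j; have := xb i j.
  by rewrite gt_max lt_min => /andP[-> ->] /andP[-> ->].
move=> xab; split=> i j; have := xab i j; rewrite gt_max lt_min;
  by move=> /andP[/andP[? ?] /andP[? ?]]; apply/andP.
Qed.

Lemma open_obox a b : open (obox a b).
Proof.
rewrite (_ : obox a b = \bigcap_(ij in [set: 'I_m * 'I_n])
  ((fun x : 'M[R]_(m, n) => x ij.1 ij.2) @^-1`
     `](a ij.1 ij.2), (b ij.1 ij.2)[%classic)).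
  rewrite bigcap_fset_set; last exact: finite_finset.
  elim/big_ind: _ => [|A B|ij _]; [exact: openT|exact: openI|].
  apply: open_comp; last exact: itv_open.
  by move=> x _; exact: coord_continuous.
by apply/seteqP; split=> x /= xab; [move=> ij _|move=> i j];
  [exact: xab|exact: (xab (i, j))].
Qed.

Lemma measurable_obox a b : measurable (obox a b).
Proof. by apply: open_measurable_mx; exact: open_obox. Qed.

Definition rat_box (p : ('M[rat]_(m, n) * 'M[rat]_(m, n))%type) :=
  obox (fun i j => ratr (p.1 i j)) (fun i j => ratr (p.2 i j)).

Lemma rat_box_near (x : 'M[R]_(m, n)) (e : R) : (0 < e)%R ->
  exists p, rat_box p x /\ rat_box p `<=` [set y | forall i j, `|x i j - y i j| < e]%R.
Proof.
move=> e0.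
have lo i j : exists q : rat, (x i j - e < ratr q < x i j)%R.
  have [|q] := @rat_in_itvoo R (x i j - e)%R (x i j); last by rewrite in_itv => qx; exists q.
  by rewrite ltrBlDr ltrDl.
have up i j : exists q : rat, (x i j < ratr q < x i j + e)%R.
  have [|q] := @rat_in_itvoo R (x i j) (x i j + e)%R; last by rewrite in_itv => qx; exists q.
  by rewrite ltrDl.
exists (\matrix_(i, j) sval (cid (lo i j)), \matrix_(i, j) sval (cid (up i j))).
rewrite /rat_box !oboxE; split=> [i j|y /= yb i j].
  rewrite /= !mxE; case: cid => p /= /andP[_ ->].
  by case: cid => q /= /andP[-> _].
have := yb i j; rewrite !mxE.
case: cid => p /= /andP[ep _]; case: cid => q /= /andP[_ qe] /andP[py yq].
rewrite ltr_distlC; apply/andP; split; first exact: lt_trans py.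
exact: lt_trans yq qe.
Qed.

Lemma open_rat_boxes (A : set 'M[R]_(m, n)) : open A ->
  A = \bigcup_p (if `[< rat_box p `<=` A >] then rat_box p else set0).
Proof.
move=> oA; apply/seteqP; split=> [x Ax|x [p _]]; last first.
  by case: asboolP => // + px; apply.
have /nbhs_ballP[e /= e0 xeA] : nbhs x A by exact: open_nbhs_nbhs.
have [p [px pe]] := rat_box_near x e0.
exists p => //; case: asboolP => // -[] y /pe /= ye.
by apply: xeA; split => // i j; exact: ye.
Qed.

(** An open set is the union of the rational boxes that it contains, and there are countably many of
    these. *)
Lemma borel_oboxE : measurable =
  <<s [set A : set 'M[R]_(m, n) | exists a b, A = obox a b] >>.
Proof.
apply/seteqP; split; last first.
  apply: smallest_sub; first exact: sigma_algebra_measurable.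
  by move=> _ [a [b ->]]; exact: measurable_obox.
apply: smallest_sub; first exact: smallest_sigma_algebra.
move=> A oA; rewrite (open_rat_boxes oA).
apply: (@countable_bigcupT_measurable _ (g_sigma_algebraType _)) => // p.
case: asboolP => _; last exact: sigma_algebra0.
by apply: sub_sigma_algebra; do 2 eexists.
Qed.

Lemma obox_cover : \bigcup_k obox (fun _ _ => - k%:R)%R (fun _ _ => k%:R)%R
  = [set: 'M[R]_(m, n)].
Proof.
rewrite -subTset => x _.
exists (Num.truncn `|x|).+1 => //; rewrite oboxE => i j; rewrite -ltr_norml.
exact: le_lt_trans (ler_mx_coord _ _ _) (truncnS_gt _).
Qed.

(** Boxes form a generating pi-system and centred cubes of finite measure exhaust the space, so the
    uniqueness theorem for measures applies. Every invariance of Lebesgue measure below is reduced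
    to boxes in this way. *)
Lemma mx_measure_unique (m1 m2 : {measure set 'M[R]_(m, n) -> \bar R}) :
  (forall a b, m1 (obox a b) = m2 (obox a b)) ->
  (forall a b, m1 (obox a b) < +oo) ->
  forall A, measurable A -> m1 A = m2 A.
Proof.
move=> m12 m1oo; apply: (measure_unique _
  (fun k : nat => obox (fun _ _ => - k%:R)%R (fun _ _ => k%:R)%R) borel_oboxE).
- by move=> _ _ [a [b ->]] [a' [b' ->]]; rewrite oboxI; do 2 eexists.
- by move=> k; do 2 eexists.
- exact: obox_cover.
- by move=> _ [a [b ->]].
- by [].
Qed.

Lemma measurable_fun_mx d (T : measurableType d) (f : T -> 'M[R]_(m, n)) :
  (forall i j, measurable_fun setT (fun x => f x i j)) -> measurable_fun setT f.
Proof.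
move=> mf; apply: (measurability _ borel_oboxE) => _ [_ [a [b ->]] <-].
rewrite setTI (_ : _ @^-1` _ = \bigcap_(ij in [set: 'I_m * 'I_n])
  ((fun x => f x ij.1 ij.2) @^-1` `](a ij.1 ij.2), (b ij.1 ij.2)[%classic)).
  apply: fin_bigcap_measurable; first exact: finite_finset.
  move=> ij _; rewrite -[X in measurable X]setTI.
  by apply: mf => //; exact: measurable_itv.
apply/seteqP; split=> x /= xab; first by move=> ij _; exact: xab.
by move=> i j; exact: (xab (i, j)).
Qed.

Lemma continuous_measurable_mx (f : 'M[R]_(m, n) -> R) :
  continuous f -> measurable_fun setT f.
Proof.
move=> cf; apply: (measurability _ (measurable_realfun.RGenOpens.measurableE R)).
move=> _ [_ [a [b ->] <-]]; rewrite setTI; apply: open_measurable_mx.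
by apply: open_comp; [move=> x _; exact: cf|exact: itv_open].
Qed.

Lemma measurable_mx_coord i j : measurable_fun setT (fun x : 'M[R]_(m, n) => x i j).
Proof. by apply: continuous_measurable_mx; exact: coord_continuous. Qed.

Lemma sigma_finite_lebesgue_mx : sigma_finite setT (@lebesgue_mx R m n).
Proof.
exists (fun k : nat => obox (fun _ _ => - k%:R)%R (fun _ _ => k%:R)%R).
  by rewrite obox_cover.
by move=> k; split; [exact: measurable_obox|exact: obox_lty].
Qed.

HB.instance Definition _ := Measure_isSigmaFinite.Build _ _ _
  (@lebesgue_mx R m n) sigma_finite_lebesgue_mx.

End mx.
End boxes.

(** * Fubini for one row against the others, and invariance under row permutations *)

Section insert_row.
Context (R : realType) (n d : nat).
Local Open Scope ereal_scope.
Notation mu := lebesgue_mx.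

(** The position [i] is arbitrary: [ord0] serves the density of a wave function, a general [i] the
    weak derivatives in particle [i]. *)
Definition insert_row (i : 'I_n.+1) (p : 'rV[R]_d * 'M[R]_(n, d)) : 'M[R]_(n.+1, d) :=
  \matrix_(k, j) if unlift i k is Some k' then p.2 k' j else p.1 ord0 j.

Lemma insert_row_eq i p j : insert_row i p i j = p.1 ord0 j.
Proof. by rewrite mxE unlift_none. Qed.

Lemma insert_row_lift i p k j : insert_row i p (lift i k) j = p.2 k j.
Proof. by rewrite mxE liftK. Qed.

Lemma row_insert_row i p : row i (insert_row i p) = p.1.
Proof. by apply/rowP => j; rewrite mxE insert_row_eq. Qed.

Lemma row_lift_insert_row i p k : row (lift i k) (insert_row i p) = row k p.2.
Proof. by apply/rowP => j; rewrite !mxE liftK. Qed.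

Lemma insert_row_row i x : insert_row i (row i x, row' i x) = x.
Proof.
by apply/matrixP => k j; case: (unliftP i k) => [k' ->|->];
  rewrite ?insert_row_eq ?insert_row_lift !mxE.
Qed.

Lemma col_mxE_insert_row (x : 'rV[R]_d) (y : 'M[R]_(n, d)) :
  col_mx x y = insert_row ord0 (x, y).
Proof.
apply/matrixP => k j; case: (unliftP ord0 k) => [k' ->|->].
  rewrite insert_row_lift/=.
  rewrite (_ : lift ord0 k' = rshift 1 k'); last exact: val_inj.
  by rewrite col_mxEd.
rewrite insert_row_eq/= (_ : @ord0 n = @lshift 1 n ord0); last exact: val_inj.
by rewrite col_mxEu.
Qed.

Lemma measurable_insert_row i : measurable_fun setT (insert_row i).
Proof.
apply: measurable_fun_mx => k j.
case: (unliftP i k) => [k' ->|->].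
  rewrite (_ : (fun _ => _) = (fun y : 'M[R]_(n, d) => y k' j) \o snd).
    by apply: measurableT_comp => //; exact: measurable_mx_coord.
  by apply/funext => p; rewrite insert_row_lift.
rewrite (_ : (fun _ => _) = (fun y : 'rV[R]_d => y ord0 j) \o fst).
  by apply: measurableT_comp => //; exact: measurable_mx_coord.
by apply/funext => p; rewrite insert_row_eq.
Qed.

Let mins := measurable_insert_row.

(** Both measures give a box the product of its side lengths, with the factor of row [i] pulled out
    on the left. *)
Lemma lebesgue_insert_row i (A : set 'M[R]_(n.+1, d)) : measurable A ->
  pushforward (mu \x mu) (insert_row i) A = mu A.
Proof.
have HE (a b : 'I_n.+1 -> 'I_d -> R) :
    pushforward (mu \x mu) (insert_row i) (obox a b) = mu (obox a b).
  rewrite /pushforward (_ : _ @^-1` _ = obox (fun=> a i) (fun=> b i) `*`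
    obox (fun k : 'I_n => a (lift i k)) (fun k : 'I_n => b (lift i k))).
    rewrite product_measure1E; [|exact: measurable_obox|exact: measurable_obox].
    rewrite [X in X * _](lebesgue_mx_obox (fun=> a i)).
    rewrite [X in _ * X]lebesgue_mx_obox lebesgue_mx_obox big_ord1 -EFinM.
    congr EFin; rewrite (bigD1_ord i)//=.
  rewrite !oboxE; apply/seteqP; split=> -[x y] /= xy.
    split=> k j; first by have := xy i j; rewrite insert_row_eq (ord1 k).
    by have := xy (lift i k) j; rewrite insert_row_lift.
  move=> k j; case: (unliftP i k) => [k' ->|->].
    by rewrite insert_row_lift; exact: xy.2.
  by rewrite insert_row_eq; exact: xy.1.
apply: mx_measure_unique; first exact: HE.
by move=> a b; rewrite [ltLHS]HE; exact: obox_lty.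
Qed.

Lemma ge0_integral_insert_row i (f : 'M[R]_(n.+1, d) -> \bar R) :
  measurable_fun setT f -> (forall x, 0 <= f x) ->
  \int[mu]_x f x = \int[mu]_x \int[mu]_y f (insert_row i (x, y)).
Proof.
move=> mf f0.
rewrite -(eq_measure_integral _ (fun A mA _ => lebesgue_insert_row i mA)).
rewrite ge0_integral_pushforward//= preimage_setT.
rewrite fubini_tonelli1//.
exact: measurableT_comp.
Qed.

Lemma integrable_insert_row i (f : 'M[R]_(n.+1, d) -> \bar R) :
  mu.-integrable setT f -> (mu \x mu).-integrable setT (f \o insert_row i).
Proof.
move=> /integrableP[mf foo]; apply/integrableP; split.
  exact: measurableT_comp.
apply: le_lt_trans foo.
rewrite -[in leRHS](eq_measure_integral _ (fun A mA _ => lebesgue_insert_row i mA)).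
rewrite ge0_integral_pushforward//= ?preimage_setT//.
exact: measurableT_comp.
Qed.

Lemma integral_insert_row i (f : 'M[R]_(n.+1, d) -> \bar R) :
  mu.-integrable setT f ->
  \int[mu]_x f x = \int[mu]_y \int[mu]_x f (insert_row i (x, y)).
Proof.
move=> fi; have := fi => /integrableP[mf _].
rewrite -(eq_measure_integral _ (fun A mA _ => lebesgue_insert_row i mA)).
rewrite integral_pushforward//= preimage_setT; last exact: integrable_insert_row.
by rewrite -integral21_prod_meas1//; exact: integrable_insert_row.
Qed.

End insert_row.

Section row_perm.
Context (R : realType) (n d : nat) (s : 'S_n).
Local Open Scope ereal_scope.
Notation mu := (@lebesgue_mx R n d).

Lemma measurable_row_perm : measurable_fun setT (row_perm s : 'M[R]_(n, d) -> _).
Proof.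
apply: measurable_fun_mx => i j; under eq_fun do rewrite mxE.
exact: measurable_mx_coord.
Qed.

Let mperm := measurable_row_perm.

Lemma lebesgue_row_perm (A : set 'M[R]_(n, d)) : measurable A ->
  pushforward mu (row_perm s) A = mu A.
Proof.
have HE (a b : 'I_n -> 'I_d -> R) :
    pushforward mu (row_perm s) (obox a b) = mu (obox a b).
  rewrite /pushforward (_ : _ @^-1` _ =
    obox (fun k => a (s^-1 k)%g) (fun k => b (s^-1 k)%g)).
    rewrite !lebesgue_mx_obox; congr EFin.
    by rewrite (reindex_perm s); apply: eq_bigr => i _; rewrite permK.
  rewrite !oboxE; apply/seteqP; split=> x /= xy k j.
    by have := xy (s^-1 k)%g j; rewrite mxE permKV.
  by have := xy (s k) j; rewrite mxE permK.
apply: mx_measure_unique; first exact: HE.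
by move=> a b; rewrite [ltLHS]HE; exact: obox_lty.
Qed.

Lemma ge0_integral_row_perm (f : 'M[R]_(n, d) -> \bar R) :
  measurable_fun setT f -> (forall x, 0 <= f x) ->
  \int[mu]_x f (row_perm s x) = \int[mu]_x f x.
Proof.
move=> mf f0.
rewrite -[RHS](eq_measure_integral _ (fun A mA _ => lebesgue_row_perm mA)).
by rewrite (ge0_integral_pushforward mperm)//= preimage_setT.
Qed.

End row_perm.

Lemma measurable_row (R : realType) n d i :
  measurable_fun setT (row i : 'M[R]_(n, d) -> _).
Proof.
apply: measurable_fun_mx => k j; under eq_fun do rewrite mxE.
exact: measurable_mx_coord.
Qed.

(** * Products of one-particle functions *)

Section tensor.
Context (R : realType) (d : nat).
Local Open Scope ereal_scope.

Lemma measurable_tensor n (f : 'I_n -> 'rV[R]_d -> R) :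
  (forall i, measurable_fun setT (f i)) ->
  measurable_fun setT (fun x : 'M[R]_(n, d) => \prod_i f i (row i x))%R.
Proof.
move=> mf; apply: measurable_prod => i _.
by apply: measurableT_comp => //; exact: measurable_row.
Qed.

Lemma integral_tensor n (f : 'I_n -> 'rV[R]_d -> R) (r : 'I_n -> R) :
  (forall i, measurable_fun setT (f i)) -> (forall i x, 0 <= f i x)%R ->
  (forall i, \int[lebesgue_mx]_x (f i x)%:E = (r i)%:E) ->
  \int[lebesgue_mx]_(x in [set: 'M[R]_(n, d)]) (\prod_i f i (row i x))%R%:E
  = (\prod_i r i)%R%:E.
Proof.
elim: n f r => [|n IH] f r mf f0 fr.
  rewrite big_ord0; under eq_integral do rewrite big_ord0.
  rewrite integral_cst// mul1e.
  (* With no rows the whole space is a box, and its measure is the empty product 1. *)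
  rewrite (_ : setT = box (fun (_ : 'I_0) (_ : 'I_d) => setT)).
    have := @lebesgue_mx_box R 0 d (fun _ _ => setT) (fun _ _ => 0%R).
    by rewrite !big_ord0; apply=> -[].
  by apply/seteqP; split => // x _ [].
have r0 i : (0 <= r i)%R.
  by rewrite -lee_fin -fr integral_ge0// => x _; rewrite lee_fin.
rewrite (ge0_integral_insert_row ord0); last 2 first.
- by apply/measurable_EFinP; exact: measurable_tensor.
- by move=> x; rewrite lee_fin prodr_ge0.
have inner x : \int[lebesgue_mx]_y (\prod_i f i (row i (insert_row ord0 (x, y))))%R%:E =
    (f ord0 x)%:E * (\prod_i r (lift ord0 i))%R%:E.
  rewrite -(IH (fun i => f (lift ord0 i)))// -ge0_integralZl//; last 3 first.
  - by apply/measurable_EFinP; exact: (measurable_tensor (f := fun i : 'I_n => f (lift ord0 i))).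
  - by move=> y _; rewrite lee_fin prodr_ge0.
  - by rewrite lee_fin.
  apply: eq_integral => y _; rewrite big_ord_recl row_insert_row EFinM.
  by congr (_ * _%:E); apply: eq_bigr => i _; rewrite row_lift_insert_row.
under eq_integral do rewrite inner.
rewrite ge0_integralZr//; last 3 first.
- exact/measurable_EFinP.
- by move=> x _; rewrite lee_fin.
- by rewrite lee_fin prodr_ge0.
by rewrite fr big_ord_recl.
Qed.

End tensor.

(** * Calculus of smooth functions with bounded first derivatives *)

Section smooth_calculus.
Context (R : realType) (m n : nat).
Notation M := 'M[R]_(m, n).
Implicit Types (f g q : M -> R) (ij : 'I_m * 'I_n).

(** Grading smoothness by the order of differentiation allows induction: the derivative of a
    product, inverse or root is built from functions already known to be smooth up to the previous
    order. *)
Definition smooth_upto (k : nat) f : Prop :=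
  forall s : seq ('I_m * 'I_n), (size s <= k)%N ->
    forall x, differentiable (foldr (@partial R m n) f s) x.

Lemma smoothP f : smooth f <-> forall k, smooth_upto k f.
Proof.
split=> [sf k s _ x|sf s x]; first exact: sf.
exact: sf (size s) s (leqnn _) x.
Qed.

Lemma smooth_upto0 f : smooth_upto 0 f <-> forall x, differentiable f x.
Proof.
split=> [sf x|df s]; first exact: (sf [::]).
by rewrite leqn0 size_eq0 => /eqP ->.
Qed.

Lemma smooth_uptoS k f : smooth_upto k.+1 f <->
  (forall x, differentiable f x) /\ (forall ij, smooth_upto k (partial ij f)).
Proof.
split=> [sf|[df sf] s].
  split=> [x|ij s sk x]; first exact: (sf [::]).
  (* The derivative split off is the last in the list, the one applied to [f] before all others. *)
  by rewrite -foldr_rcons; apply: sf; rewrite size_rcons.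
by case/lastP: s => [|s ij] //; rewrite size_rcons foldr_rcons ltnS => /sf.
Qed.

Lemma smooth_upto_diff k f : smooth_upto k f -> forall x, differentiable f x.
Proof. by move=> sf x; exact: (sf [::]). Qed.

Lemma smooth_uptoW k f : smooth_upto k.+1 f -> smooth_upto k f.
Proof. by move=> sf s sk; apply: sf; exact: leqW. Qed.

Lemma smooth_diff f : smooth f -> forall x, differentiable f x.
Proof. by move=> sf x; exact: (sf [::]). Qed.

Lemma smooth_partial ij f : smooth f -> smooth (partial ij f).
Proof. by move=> sf s x; rewrite -foldr_rcons; exact: sf. Qed.

Lemma smooth_continuous f : smooth f -> continuous f.
Proof. by move=> sf x; exact/differentiable_continuous/smooth_diff. Qed.

Lemma partial_cst ij (c : R) : partial ij (cst c) = cst 0 :> (M -> R).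
Proof. by apply/funext => x; rewrite /partial derive_cst. Qed.

Lemma partialD ij f g : (forall x, differentiable f x) ->
  (forall x, differentiable g x) ->
  partial ij (fun x => f x + g x) = (fun x => partial ij f x + partial ij g x).
Proof.
move=> df dg; apply/funext => x.
by rewrite /partial (@deriveD _ _ _ f g)//; exact: diff_derivable.
Qed.

Lemma partialM ij f g : (forall x, differentiable f x) ->
  (forall x, differentiable g x) ->
  partial ij (fun x => f x * g x) =
  (fun x => partial ij f x * g x + f x * partial ij g x).
Proof.
move=> df dg; apply/funext => x.
rewrite /partial (@deriveM _ _ f g); [|exact: diff_derivable..].
by rewrite addrC /GRing.scale/= [X in X + _]mulrC.
Qed.

Lemma partialV ij f : (forall x, f x != 0) -> (forall x, differentiable f x) ->
  partial ij (fun x => (f x)^-1) =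
  (fun x => - (partial ij f x * ((f x)^-1 * (f x)^-1))).
Proof.
move=> f0 df; apply/funext => x.
rewrite /partial (@deriveV _ _ f)//; last exact: diff_derivable.
by rewrite /GRing.scale/= mulNr mulrC expr2 invfM.
Qed.

Lemma differentiable_comp1 (h : R -> R) f x dh : differentiable f x ->
  is_derive (f x) 1 h dh -> differentiable (h \o f) x.
Proof.
move=> df [hd _]; apply: differentiable_comp => //.
exact/derivable1_diffP.
Qed.

Lemma partial_comp ij (h : R -> R) f x dh : differentiable f x ->
  is_derive (f x) 1 h dh -> partial ij (h \o f) x = partial ij f x * dh.
Proof.
move=> df hd; have [hd1 hd2] := hd.
have dh1 : differentiable h (f x) by exact/derivable1_diffP.
rewrite /partial deriveE; last exact: differentiable_comp1 hd.
rewrite diff_comp//= diff1E// -deriveE//.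
by rewrite /GRing.scale/= derive1E hd2.
Qed.

Lemma smooth_cst (c : R) : smooth (cst c : M -> R).
Proof.
apply/smoothP => k; elim: k c => [|k IH] c.
  by apply/smooth_upto0 => x; exact: differentiable_cst.
apply/smooth_uptoS; split=> [x|ij]; first exact: differentiable_cst.
by rewrite partial_cst.
Qed.

Lemma smooth_uptoD k f g : smooth_upto k f -> smooth_upto k g ->
  smooth_upto k (fun x => f x + g x).
Proof.
elim: k f g => [|k IH] f g sf sg.
  by apply/smooth_upto0 => x; apply: differentiableD; [exact: smooth_upto_diff sf x|exact: smooth_upto_diff sg x].
apply/smooth_uptoS; split=> [x|ij].
  by apply: differentiableD; [exact: smooth_upto_diff sf x|exact: smooth_upto_diff sg x].
rewrite partialD; [|exact: smooth_upto_diff sf|exact: smooth_upto_diff sg].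
by move/smooth_uptoS: sf => [_ sf]; move/smooth_uptoS: sg => [_ sg]; exact: IH.
Qed.

Lemma smoothD f g : smooth f -> smooth g -> smooth (fun x => f x + g x).
Proof. by rewrite !smoothP => sf sg k; exact: smooth_uptoD. Qed.

Lemma smooth_uptoM k f g : smooth_upto k f -> smooth_upto k g ->
  smooth_upto k (fun x => f x * g x).
Proof.
elim: k f g => [|k IH] f g sf sg.
  by apply/smooth_upto0 => x; apply: differentiableM; [exact: smooth_upto_diff sf x|exact: smooth_upto_diff sg x].
apply/smooth_uptoS; split=> [x|ij].
  by apply: differentiableM; [exact: smooth_upto_diff sf x|exact: smooth_upto_diff sg x].
rewrite partialM; [|exact: smooth_upto_diff sf|exact: smooth_upto_diff sg].
have sf' := smooth_uptoW sf; have sg' := smooth_uptoW sg.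
move/smooth_uptoS: sf => [_ sf]; move/smooth_uptoS: sg => [_ sg].
by apply: smooth_uptoD; exact: IH.
Qed.

Lemma smoothM f g : smooth f -> smooth g -> smooth (fun x => f x * g x).
Proof. by rewrite !smoothP => sf sg k; exact: smooth_uptoM. Qed.

Lemma smoothN f : smooth f -> smooth (fun x => - f x).
Proof.
move=> sf; rewrite (_ : (fun x => _) = (fun x => cst (-1) x * f x)).
  by apply: smoothM => //; exact: smooth_cst.
by apply/funext => x; rewrite mulN1r.
Qed.

Lemma smooth_uptoN k f : smooth_upto k f -> smooth_upto k (fun x => - f x).
Proof.
move=> sf; rewrite (_ : (fun x => _) = (fun x => cst (-1) x * f x)).
  by apply: smooth_uptoM => //; apply: (smoothP _).1; exact: smooth_cst.
by apply/funext => x; rewrite mulN1r.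
Qed.

Lemma smoothV f : (forall x, f x != 0) -> smooth f -> smooth (fun x => (f x)^-1).
Proof.
move=> f0 /smoothP sf; apply/smoothP; elim=> [|k IH].
  by apply/smooth_upto0 => x; apply: differentiableV => //; exact: smooth_upto_diff (sf 0) x.
apply/smooth_uptoS; split=> [x|ij].
  by apply: differentiableV => //; exact: smooth_upto_diff (sf 0) x.
rewrite partialV//; last by move=> x; exact: smooth_upto_diff (sf 0) x.
apply: smooth_uptoN; apply: smooth_uptoM; last exact: smooth_uptoM.
by have /smooth_uptoS[_] := sf k.+1; exact.
Qed.

Lemma partial_sqrt ij q : (forall x, 0 < q x) -> (forall x, differentiable q x) ->
  partial ij (fun x => Num.sqrt (q x)) =
  (fun x => partial ij q x * (2^-1 * (Num.sqrt (q x))^-1)).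
Proof.
move=> q0 dq; apply/funext => x.
by rewrite (partial_comp ij (dq x) (is_derive1_sqrt (q0 x))) invfM.
Qed.

Lemma smooth_sqrt q : (forall x, 0 < q x) -> smooth q ->
  smooth (fun x => Num.sqrt (q x)).
Proof.
move=> q0 sq.
have dq := smooth_diff sq.
have dsq x : differentiable (fun x => Num.sqrt (q x)) x.
  exact: differentiable_comp1 (dq x) (is_derive1_sqrt (q0 x)).
have siq : smooth (fun x => (q x)^-1) by apply: smoothV => // x; rewrite gt_eqF.
apply/smoothP; elim=> [|k IH]; first exact/smooth_upto0.
apply/smooth_uptoS; split=> // ij; rewrite partial_sqrt//.
apply: smooth_uptoM; first by have /smoothP := smooth_partial ij sq; exact.
apply: smooth_uptoM; first exact: (smoothP _).1 (smooth_cst 2^-1) k.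
(* The inverse root is sqrt(q) / q, which returns the factor to the induction hypothesis on
   sqrt(q). *)
rewrite (_ : (fun x => _) = (fun x => Num.sqrt (q x) * (q x)^-1)).
  by apply: smooth_uptoM => //; exact: (smoothP _).1 siq k.
apply/funext => x; have s0 : Num.sqrt (q x) != 0 by rewrite sqrtr_eq0 -ltNge.
by apply: (mulfI s0); rewrite mulfV// mulrA -expr2 sqr_sqrtr ?ltW// mulfV ?gt_eqF.
Qed.

(** These are the multipliers under which weak differentiability and square integrability are
    stable. *)
Definition tame f : Prop := smooth f /\
  exists C : R, forall x, `|f x| <= C /\ forall ij, `|partial ij f x| <= C.

Lemma tame_cst (c : R) : tame (cst c : M -> R).
Proof.
split; first exact: smooth_cst.
by exists `|c| => x; split=> // ij; rewrite partial_cst normr0.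
Qed.

Lemma tameD f g : tame f -> tame g -> tame (fun x => f x + g x).
Proof.
move=> [sf [C fC]] [sg [D gD]]; split; first exact: smoothD.
exists (C + D) => x; have [? ?] := fC x; have [? ?] := gD x; split.
  by rewrite (le_trans (ler_normD _ _))// lerD.
move=> ij; rewrite partialD; [|exact: smooth_diff..].
by rewrite (le_trans (ler_normD _ _))// lerD.
Qed.

Lemma tameM f g : tame f -> tame g -> tame (fun x => f x * g x).
Proof.
move=> [sf [C fC]] [sg [D gD]]; split; first exact: smoothM.
exists (C * D + C * D) => x; have [fx dfx] := fC x; have [gx dgx] := gD x.
have C0 : 0 <= C by exact: le_trans fx.
have D0 : 0 <= D by exact: le_trans gx.
split; first by rewrite normrM (@le_trans _ _ (C * D))// ?ler_pM// lerDl mulr_ge0.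
move=> ij; rewrite partialM; [|exact: smooth_diff..].
by rewrite (le_trans (ler_normD _ _))// !normrM lerD// ler_pM.
Qed.

Lemma tameV f (c : R) : 0 < c -> (forall x, c <= f x) -> tame f ->
  tame (fun x => (f x)^-1).
Proof.
move=> c0 cf [sf [C fC]].
have f0 x : 0 < f x by exact: lt_le_trans (cf x).
have f1 x : f x != 0 by rewrite gt_eqF.
split; first exact: smoothV.
have fc x : `|(f x)^-1| <= c^-1.
  by rewrite ger0_norm ?invr_ge0 ?(ltW (f0 x))// lef_pV2 ?posrE.
have C0 : 0 <= C by exact: le_trans (fC 0).1.
exists (c^-1 + C * (c^-1 * c^-1)) => x; have [fx dfx] := fC x; split.
  by rewrite (le_trans (fc x))// lerDl !mulr_ge0// invr_ge0 ltW.
move=> ij; rewrite partialV//; last exact: smooth_diff.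
rewrite normrN !normrM (@le_trans _ _ (C * (c^-1 * c^-1)))//.
  by rewrite ler_pM// ?mulr_ge0// ler_pM.
by rewrite lerDr invr_ge0 ltW.
Qed.

Lemma tame_sqrt f (c : R) : 0 < c -> (forall x, c <= f x) -> tame f ->
  tame (fun x => Num.sqrt (f x)).
Proof.
move=> c0 cf [sf [C fC]].
have f0 x : 0 < f x by exact: lt_le_trans (cf x).
split; first exact: smooth_sqrt.
have C0 : 0 <= C by exact: le_trans (fC 0).1.
have K0 : 0 <= 2^-1 * (Num.sqrt c)^-1 by rewrite mulr_ge0// invr_ge0 sqrtr_ge0.
exists (Num.sqrt C + C * (2^-1 * (Num.sqrt c)^-1)) => x; have [fx dfx] := fC x; split.
  rewrite ger0_norm ?sqrtr_ge0// (@le_trans _ _ (Num.sqrt C))//.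
    by rewrite ler_sqrt// (le_trans _ fx)// ler_norm.
  by rewrite lerDl mulr_ge0.
move=> ij; rewrite partial_sqrt//; last exact: smooth_diff.
rewrite normrM (@le_trans _ _ (C * (2^-1 * (Num.sqrt c)^-1)))//; last first.
  by rewrite lerDr sqrtr_ge0.
rewrite ler_pM// ger0_norm ?mulr_ge0 ?invr_ge0 ?sqrtr_ge0//.
rewrite ler_pM2l// lef_pV2 ?posrE ?sqrtr_gt0//.
exact: ler_wsqrtr (cf x).
Qed.

Lemma tame_sum (I : Type) (r : seq I) (P : pred I) (f : I -> M -> R) :
  (forall i, P i -> tame (f i)) -> tame (fun x => \sum_(i <- r | P i) f i x).
Proof.
move=> tf; elim: r => [|i r IH].
  rewrite (_ : (fun x => _) = cst 0); first exact: tame_cst.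
  by apply/funext => x; rewrite big_nil.
rewrite (_ : (fun x => _) = if P i then
    (fun x => f i x + \sum_(j <- r | P j) f j x) else
    (fun x => \sum_(j <- r | P j) f j x)).
  by case: ifPn => // Pi; apply: tameD => //; exact: tf.
by apply/funext => x; rewrite big_cons; case: ifP.
Qed.

Lemma tame_prod (I : Type) (r : seq I) (P : pred I) (f : I -> M -> R) :
  (forall i, P i -> tame (f i)) -> tame (fun x => \prod_(i <- r | P i) f i x).
Proof.
move=> tf; elim: r => [|i r IH].
  rewrite (_ : (fun x => _) = cst 1); first exact: tame_cst.
  by apply/funext => x; rewrite big_nil.
rewrite (_ : (fun x => _) = if P i then
    (fun x => f i x * \prod_(j <- r | P j) f j x) else
    (fun x => \prod_(j <- r | P j) f j x)).
  by case: ifPn => // Pi; apply: tameM => //; exact: tf.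
by apply/funext => x; rewrite big_cons; case: ifP.
Qed.

Lemma partial_sum (I : Type) (r : seq I) (f : I -> M -> R) ij :
  (forall i, tame (f i)) ->
  partial ij (fun x => \sum_(i <- r) f i x) = (fun x => \sum_(i <- r) partial ij (f i) x).
Proof.
move=> tf; elim: r => [|i r IH].
  rewrite (_ : (fun x => _) = cst 0) ?partial_cst; last first.
    by apply/funext => x; rewrite big_nil.
  by apply/funext => x; rewrite big_nil.
rewrite (_ : (fun x => _) = (fun x => f i x + \sum_(j <- r) f j x)); last first.
  by apply/funext => x; rewrite big_cons.
rewrite partialD; [|exact: smooth_diff (tf i).1|].
  by rewrite IH; apply/funext => x; rewrite big_cons.
by apply: smooth_diff; apply: (tame_sum _ _).1 => j _; exact: tf.
Qed.

End smooth_calculus.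

(** * The flat function exp(-1/t) and its derivatives *)

Section flat.
Context (R : realType).
Implicit Types (t a b c : R).

(** The powers of 1/t make the family closed under differentiation up to linear combinations, so
    that all derivatives of [flat 0] are handled at once. *)
Definition flat (n : nat) t : R :=
  if 0 < t then t^-1 ^+ n * expR (- t^-1) else 0.

Lemma flat_ge0 n t : 0 <= flat n t.
Proof.
rewrite /flat; case: ifPn => // t0.
by rewrite mulr_ge0 ?expR_ge0// exprn_ge0// invr_ge0 ltW.
Qed.

(** With s = 1/t this is s^n / n! <= exp(s). *)
Lemma flat_le n t : flat n t <= n`!%:R.
Proof.
rewrite /flat; case: ifPn => // t0.
rewrite expRN ler_pdivrMr ?expR_gt0//.
case: n => [|n]; first by rewrite expr0 mul1r ltW// expR_gt1 invr_gt0.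
rewrite mulrC -ler_pdivrMr ?ltr0n ?fact_gt0//.
apply: le_trans (expR_ge1Dxn n _); first by rewrite lerDr.
by rewrite invr_ge0 ltW.
Qed.

Lemma flat0 t : flat 0 t = if 0 < t then expR (- t^-1) else 0.
Proof. by rewrite /flat expr0 mul1r. Qed.

Lemma flat_pos n t : 0 < t -> flat n t = t^-1 ^+ n * expR (- t^-1).
Proof. by rewrite /flat => ->. Qed.

Lemma flat_neg n t : t <= 0 -> flat n t = 0.
Proof. by rewrite /flat ltNge => ->. Qed.

Lemma is_derive_quadratic (f : R -> R) (C : R) :
  (forall h, `|f h| <= C * h ^+ 2) -> is_derive (0 : R) (1 : R) f 0.
Proof.
move=> fC.
have f0 : f 0 = 0.
  by apply/eqP; rewrite -normr_le0 (le_trans (fC 0))// expr0n mulr0.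
have cv : h^-1 *: ((f \o shift 0) (h *: (1 : R)) - f 0) @[h --> 0^'] --> (0 : R).
  apply/cvgrPdist_le => /= e e0.
  have C0 : 0 <= C by rewrite -[C]mulr1 -(expr1n _ 2) (le_trans _ (fC 1)).
  near=> h.
  have h0 : h != 0 by near: h; exact: nbhs_dnbhs_neq.
  rewrite f0 subr0 sub0r normrN addr0 /GRing.scale/= mulr1 normrM normfV.
  rewrite ler_pdivrMl ?normr_gt0// (le_trans (fC h))//.
  rewrite -[h ^+ 2]ger0_norm ?sqr_ge0// normrX.
  rewrite expr2 mulrA [leRHS]mulrC ler_pM2r ?normr_gt0//.
  have : `|h| <= e / (C + 1).
    by near: h; apply: dnbhs0_le; rewrite divr_gt0// ltr_wpDl.
  rewrite ler_pdivlMr ?ltr_wpDl// => hC; apply: le_trans hC.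
  by rewrite mulrDr mulr1 mulrC lerDl.
by apply: DeriveDef; [apply/cvg_ex; exists 0|exact: cvg_lim cv].
Unshelve. all: by end_near. Qed.

Lemma is_derive_flat n t :
  is_derive t 1 (flat n) (flat n.+2 t - n%:R * flat n.+1 t).
Proof.
case: (ltgtP t 0) => t0.
- rewrite !flat_neg ?ltW// mulr0 subr0.
  apply: (near_eq_is_derive (f := cst 0)).
    near=> s; rewrite flat_neg//; near: s.
    by exists (- t); [rewrite /= oppr_gt0|move=> s/=; rewrite ltr_distlC opprK;
      move=> /andP[_]; rewrite subrr => /ltW].
- have t1 : t != 0 by rewrite gt_eqF.
  apply: (near_eq_is_derive (f := (fun s : R => s ^+ n * expR (- s)) \o GRing.inv)).
    near=> s => /=; rewrite flat_pos//; near: s.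
    by exists t => //= s /=; rewrite ltr_distlC subrr => /andP[].
  have dX (s : R) : is_derive s 1 (fun s : R => s ^+ n) (n%:R * s ^+ n.-1).
    apply: DeriveDef; first exact: exprn_derivable.
    by rewrite exp_derive /GRing.scale/= mulr1.
  have dE (s : R) : is_derive s 1 (expR \o -%R) (expR (- s) * -1).
    exact: is_derive1_comp.
  have dXE := is_deriveM (dX t^-1) (dE t^-1).
  have dV : is_derive t 1 (fun s : R => s^-1) (- t^-1 ^+ 2).
    apply: DeriveDef; first exact: (@derivableV _ _ id).
    by rewrite (@deriveV _ _ id)// derive_id /GRing.scale/= mulr1 exprVn.
  have := is_derive1_comp dXE dV; rewrite /=.
  congr is_derive; rewrite !flat_pos// /GRing.scale/=.
  case: (n) => [|k]; first by rewrite !mul0r subr0 expr0 mulr0 addr0; ring.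
  rewrite -pred_Sn !exprS; ring.
(* At the origin, [flat n h] equals [flat n.+2 h * h ^+ 2] for h > 0, hence is at most (n+2)! h^2,
   and a quadratic bound forces derivative zero. *)
- rewrite t0 !flat_neg// mulr0 subr0.
  apply: (@is_derive_quadratic _ n.+2`!%:R) => h.
  have [h0|h0] := leP h 0.
    by rewrite flat_neg// normr0 mulr_ge0// sqr_ge0.
  rewrite ger0_norm ?flat_ge0//.
  rewrite (_ : flat n h = flat n.+2 h * h ^+ 2) ?ler_wpM2r ?sqr_ge0 ?flat_le//.
  rewrite !flat_pos// [RHS]mulrAC; congr (_ * _).
  by rewrite -addn2 exprD -mulrA -exprMn mulVf ?gt_eqF// expr1n mulr1.
Unshelve. all: by end_near. Qed.

End flat.

Section flat_coord.
Context (R : realType) (m n : nat).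
Notation M := 'M[R]_(m, n).

Lemma differentiable_affine_coord (a b : R) i j (x : M) :
  differentiable (fun x : M => a * x i j + b) x.
Proof.
apply: differentiableD => //; apply: differentiableM => //.
exact: differentiable_coord.
Qed.

Lemma partial_affine_coord (a b : R) i j kl :
  partial kl (fun x : M => a * x i j + b) =
  cst (a * ((i == kl.1) && (j == kl.2))%:R).
Proof.
apply/funext => x; apply/cvg_lim => //; apply: cvg_near_cst; near=> h.
have h0 : h != 0 by near: h; exact: nbhs_dnbhs_neq.
rewrite /= /shift /GRing.scale/= !mxE opprD addrACA subrr addr0 -mulrBr addrK.
by rewrite mulrCA mulKf// mulrCA.
Unshelve. all: by end_near. Qed.

Definition aflat k (a b : R) i j (x : M) : R := flat k (a * x i j + b).

Lemma differentiable_aflat k (a b : R) i j (x : M) :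
  differentiable (aflat k a b i j) x.
Proof.
exact: differentiable_comp1 (differentiable_affine_coord a b i j x)
  (is_derive_flat k _).
Qed.

Lemma partial_aflat k (a b : R) i j kl :
  partial kl (aflat k a b i j) = (fun x =>
    cst (a * ((i == kl.1) && (j == kl.2))%:R) x *
    (aflat k.+2 a b i j x + cst (- k%:R) x * aflat k.+1 a b i j x)).
Proof.
apply/funext => x; rewrite (partial_comp kl
  (differentiable_affine_coord a b i j x) (is_derive_flat k _)).
by rewrite partial_affine_coord mulNr.
Qed.

(** The induction on the order leaves [k] general, because each derivative raises the index of the
    flat function. *)
Lemma smooth_aflat k (a b : R) i j : smooth (aflat k a b i j).
Proof.
apply/smoothP => K; elim: K k => [|K IH] k.
  by apply/smooth_upto0 => x; exact: differentiable_aflat.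
apply/smooth_uptoS; split=> [x|kl]; first exact: differentiable_aflat.
have sc c : smooth_upto K (cst c : M -> R) by exact: (smoothP _).1 (smooth_cst c) K.
rewrite partial_aflat; apply: smooth_uptoM => //.
by apply: smooth_uptoD => //; exact: smooth_uptoM.
Qed.

Lemma tame_aflat k (a b : R) i j : tame (aflat k a b i j).
Proof.
split; first exact: smooth_aflat.
exists (k`!%:R + `|a| * (k.+2`!%:R + k%:R * k.+1`!%:R)) => x; split.
  rewrite ger0_norm ?flat_ge0// (le_trans (flat_le _ _))// lerDl.
  by rewrite mulr_ge0 ?addr_ge0 ?mulr_ge0.
move=> kl; rewrite partial_aflat normrM.
have key : `|aflat k.+2 a b i j x + cst (- k%:R) x * aflat k.+1 a b i j x| <=
  k.+2`!%:R + k%:R * k.+1`!%:R.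
  rewrite (le_trans (ler_normD _ _))// lerD//.
    by rewrite ger0_norm ?flat_ge0// flat_le.
  rewrite normrM /= normrN (ger0_norm (ler0n _ k)) ler_wpM2l//.
  by rewrite ger0_norm ?flat_ge0// flat_le.
rewrite (@le_trans _ _ (`|a| * (k.+2`!%:R + k%:R * k.+1`!%:R)))//; last first.
  by rewrite lerDr.
rewrite ler_pM// normrM ler_piMr//.
by case: (_ && _); rewrite ?normr1 ?normr0 ?ler01.
Qed.

End flat_coord.

(** * A smooth partition of unity of R^d into small cells *)

Section step.
Context (R : realType).

(** A smooth pair playing the roles of sine and cosine: [step true] vanishes for t <= 0,
    [step false] for t >= 1, and their squares add up to 1. *)
Definition step (c : bool) (t : R) : R :=
  flat 0 (if c then t else 1 - t) /
  Num.sqrt (flat 0 t ^+ 2 + flat 0 (1 - t) ^+ 2).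

(** One of [t] and [1 - t] is at least 1/2. The positive constant keeps the root of the denominator
    and its inverse tame. *)
Lemma step_den_ge (t : R) :
  expR (- 2) ^+ 2 <= flat 0 t ^+ 2 + flat 0 (1 - t) ^+ 2.
Proof.
have key (s : R) : 2^-1 <= s -> expR (- 2) ^+ 2 <= flat 0 s ^+ 2.
  move=> s2; have s0 : 0 < s by apply: lt_le_trans s2; rewrite invr_gt0.
  rewrite ler_sqr ?nnegrE ?expR_ge0 ?flat_ge0//.
  by rewrite flat_pos// expr0 mul1r ler_expR lerN2 -[leRHS]invrK lef_pV2 ?posrE.
have [t2|t2] := leP 2^-1 t.
  by rewrite (le_trans (key _ t2))// lerDl sqr_ge0.
rewrite (le_trans (key (1 - t) _)) ?lerDr ?sqr_ge0//.
lra.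
Qed.

Lemma step_den_gt0 (t : R) : 0 < flat 0 t ^+ 2 + flat 0 (1 - t) ^+ 2.
Proof. by apply: lt_le_trans (step_den_ge t); rewrite exprn_gt0 ?expR_gt0. Qed.

Lemma sqr_step (t : R) : step true t ^+ 2 + step false t ^+ 2 = 1.
Proof.
rewrite /step !expr_div_n sqr_sqrtr ?(ltW (step_den_gt0 t))// -mulrDl.
by rewrite mulfV// gt_eqF ?step_den_gt0.
Qed.

Lemma step_true_neq0 (t : R) : step true t != 0 -> 0 < t.
Proof. by rewrite ltNge; apply: contra => t0; rewrite /step flat_neg// mul0r. Qed.

Lemma step_false_neq0 (t : R) : step false t != 0 -> t < 1.
Proof.
by rewrite ltNge; apply: contra => t1; rewrite /step flat_neg ?mul0r// subr_le0.
Qed.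

Lemma tame_step m n (a b : R) i j c :
  tame (fun x : 'M[R]_(m, n) => step c (a * x i j + b)).
Proof.
have ft c' : tame (fun x : 'M[R]_(m, n) =>
    flat 0 (if c' then a * x i j + b else 1 - (a * x i j + b))).
  case: c'; first exact: tame_aflat.
  rewrite (_ : (fun x => _) = aflat 0 (- a) (1 - b) i j); first exact: tame_aflat.
  by apply/funext => x; rewrite /aflat; congr flat; ring.
have c0 : 0 < expR (- 2 : R) ^+ 2 by rewrite exprn_gt0 ?expR_gt0.
apply: tameM; first exact: ft.
apply: (@tameV _ _ _ _ (Num.sqrt (expR (- 2) ^+ 2))).
- by rewrite sqrtr_gt0.
- by move=> x; rewrite ler_wsqrtr// step_den_ge.
apply: (@tame_sqrt _ _ _ _ (expR (- 2) ^+ 2)) => //.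
  by move=> x; exact: step_den_ge.
by apply: tameD; apply: tameM; (exact: (ft true) || exact: (ft false)).
Qed.

End step.

(* A bit of [b] chooses, for a coordinate [j] and a threshold [- L + w * t],
   the side of that threshold: the squares of the products [theta b] form a
   partition of unity by distributivity. *)
Section partition.
Context (R : realType) (d T : nat) (L w : R).

Definition threshold (t : nat) : R := - L + w * t%:R.

Definition theta (b : {ffun 'I_d * 'I_T -> bool}) (v : 'rV[R]_d) : R :=
  \prod_jt step (b jt) (w^-1 * (v 0 jt.1 - threshold jt.2)).

Lemma sum_sqr_theta v : \sum_b theta b v ^+ 2 = 1.
Proof.
rewrite /theta; under eq_bigr do rewrite -prodrXl.
rewrite -(bigA_distr_bigA (fun (jt : 'I_d * 'I_T) c =>
  step c (w^-1 * (v 0 jt.1 - threshold jt.2)) ^+ 2)) /=.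
by rewrite big1// => jt _; rewrite big_bool/= sqr_step.
Qed.

Lemma tame_theta n i b : tame (fun x : 'M[R]_(n, d) => theta b (row i x)).
Proof.
apply: tame_prod => jt _.
rewrite (_ : (fun x => _) = (fun x : 'M[R]_(n, d) =>
  step (b jt) (w^-1 * x i jt.1 + - (w^-1 * threshold jt.2)))).
  exact: tame_step.
by apply/funext => x; rewrite mxE mulrBr.
Qed.

Hypothesis w0 : 0 < w.

Lemma theta_neq0 b v j t : theta b v != 0 ->
  if b (j, t) then threshold t < v 0 j else v 0 j < threshold t.+1.
Proof.
move=> /prodf_neq0/(_ (j, t) isT) /=; case: (b _).
  by move/step_true_neq0; rewrite pmulr_rgt0 ?invr_gt0// subr_gt0.
move/step_false_neq0; rewrite ltr_pdivrMl// mulr1 ltrBlDr.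
by rewrite /threshold -natr1; lra.
Qed.

(** If a coordinate of [u] lies between thresholds t and t+1, then [theta b u != 0] forces the bit
    at threshold t-1 to be true and the bit at t+1 to be false; this confines the coordinate of [v]
    between thresholds t-1 and t+2. The two conditions on [L] and [T] ensure that these thresholds
    exist. Only [u] has to lie in the ball. *)
Lemma theta_diam (l : R) b (u v : 'rV[R]_d) : l + w <= L -> l + L + w < w * T%:R ->
  (forall j, `|u 0 j| <= l) -> theta b u != 0 -> theta b v != 0 ->
  forall j, `|u 0 j - v 0 j| < 2 * w.
Proof.
move=> lwL LT ul bu bv j.
have /[!ler_norml]/andP[lu ul'] := ul j.
(* [r] is the coordinate measured in units of [w] from the lowest threshold. *)
pose r := (u 0 j + L) / w; pose t := Num.truncn r.
have uL0 : w <= u 0 j + L by lra.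
have r0 : 0 <= r by rewrite divr_ge0 ?(ltW w0)// (le_trans (ltW w0)).
have /andP[tr rt] := truncn_itv r0.
have uE : u 0 j = - L + w * r by rewrite /r mulrC divfK ?gt_eqF//; ring.
have t1 : (0 < t)%N.
  rewrite -(ltr_nat R) (lt_le_trans _ (_ : 1 <= t%:R))//.
  by rewrite ler1n truncn_gt0 ler_pdivlMr// mul1r.
have tT : (t.+1 < T)%N.
  rewrite -(ltr_nat R) -natr1 -(ltr_pM2l w0) mulrDr mulr1.
  apply: le_lt_trans LT; rewrite lerD2r.
  have wr : w * t%:R <= w * r by rewrite ler_pM2l.
  by apply: le_trans wr _; have : w * r <= l + L by lra.
have tT1 : (t.-1 < T)%N by rewrite (leq_ltn_trans (leq_pred _))// ltnW.
have vlo : threshold t.-1 < v 0 j.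
  have := theta_neq0 j (Ordinal tT1) bv; case: ifP => // bf _.
  have := theta_neq0 j (Ordinal tT1) bu; rewrite bf/= prednK// /threshold uE.
  by rewrite ltrD2l ltr_pM2l// ltNge tr.
have vup : v 0 j < threshold t.+2.
  have := theta_neq0 j (Ordinal tT) bv; case: ifP => // bf _.
  have := theta_neq0 j (Ordinal tT) bu; rewrite bf/= /threshold uE.
  by rewrite ltrD2l ltr_pM2l// ltNge (ltW rt).
move: vlo vup; rewrite /threshold -[t in t.+2]prednK// -!natr1.
have : w * t%:R <= w * r by rewrite ler_pM2l.
have : w * r < w * t.+1%:R by rewrite ltr_pM2l.
rewrite -[t]prednK// -!natr1 uE ltr_norml; nra.
Qed.

End partition.

(** * Measures given by a density *)

Section density_measure.
Context d (T : measurableType d) (R : realType) (mu : {measure set T -> \bar R}).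
Local Open Scope ereal_scope.

Section def.
Variables (f : T -> R) (mf : measurable_fun setT f) (f0 : forall x, (0 <= f x)%R).

(** The proofs are arguments of the set function so that the measure structure can be attached to it
    directly. *)
Definition dens_of (f0 : forall x, (0 <= f x)%R) (mf : measurable_fun setT f)
  (A : set T) : \bar R := \int[mu]_(x in A) (f x)%:E.

Let dens := dens_of f0 mf.

Let dens0 : dens set0 = 0. Proof. exact: integral_set0. Qed.

Let dens_ge0 A : 0 <= dens A.
Proof. by apply: integral_ge0 => x _; rewrite lee_fin. Qed.

Let dens_sigma_additive : semi_sigma_additive dens.
Proof.
apply: semi_sigma_additive_nng_induced => [|x]; first exact/measurable_EFinP.
by rewrite lee_fin.
Qed.

HB.instance Definition _ := isMeasure.Build _ _ _ dens
  dens0 dens_ge0 dens_sigma_additive.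

Definition dens_measure : {measure set T -> \bar R} := dens.

End def.

Import HBNNSimple.

(** True for indicators by the hypothesis on [nu], hence for simple functions; monotone convergence
    on both sides carries it over to [g]. *)
Lemma ge0_integral_density (nu : {measure set T -> \bar R}) (f : T -> R)
    (g : T -> \bar R) :
  measurable_fun setT f -> (forall x, (0 <= f x)%R) ->
  (forall A, measurable A -> nu A = \int[mu]_(x in A) (f x)%:E) ->
  measurable_fun setT g -> (forall x, 0 <= g x) ->
  \int[nu]_x g x = \int[mu]_x (g x * (f x)%:E).
Proof.
move=> mf f0 nuE mg g0; pose h := nnsfun_approx measurableT mg.
have cvh x : (h n x)%:E @[n --> \oo] --> g x by exact: cvg_nnsfun_approx.
have ndh x : {homo (fun n => h n x) : a b / (a <= b)%N >-> (a <= b)%R}.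
  by move=> a b ab; exact/lefP/nd_nnsfun_approx.
transitivity (limn (fun n => \int[nu]_x (h n x)%:E)).
  rewrite -monotone_convergence//=.
  - by apply: eq_integral => x _; apply/esym/cvg_lim => //; exact: cvh.
  - by move=> n; apply/measurable_EFinP; exact: measurable_funP.
  - by move=> n x _; rewrite lee_fin.
  - by move=> x _ a b ab; rewrite lee_fin; exact: ndh.
transitivity (limn (fun n => \int[mu]_x ((h n x)%:E * (f x)%:E))); last first.
  rewrite -monotone_convergence//=.
  - apply: eq_integral => x _; apply/cvg_lim => //.
    apply: (cvgeZr (f := fun n => (h n x)%:E)) => //.
  - by move=> n; apply: emeasurable_funM; apply/measurable_EFinP.
  - by move=> n x _; rewrite lee_fin mulr_ge0.
  - by move=> x _ a b ab; rewrite lee_fin ler_wpM2r//; exact: ndh.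
congr (limn _); apply/funext => n.
under eq_integral do rewrite fimfunE -fsumEFin//.
rewrite ge0_integral_fsum//; last 2 first.
- by move=> r; exact/measurable_EFinP/measurableT_comp.
- by move=> r x _; rewrite EFinM nnfun_muleindic_ge0.
under [RHS]eq_integral.
  move=> x _; rewrite fimfunE -fsumEFin// ge0_mule_fsuml; last first.
    by move=> r; rewrite EFinM nnfun_muleindic_ge0.
  over.
rewrite ge0_integral_fsum//; last 2 first.
- move=> r; apply: emeasurable_funM; last exact/measurable_EFinP.
  exact/measurable_EFinP/measurableT_comp.
- by move=> r x _; apply: mule_ge0; [rewrite EFinM nnfun_muleindic_ge0|rewrite lee_fin].
apply: eq_fsbigr => r _; rewrite integralZl_indic_nnsfun// integral_indic// setIT.
(* A negative value [r] is not taken by the nonnegative function [h n]: its fibre is empty and both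
   terms vanish. *)
have [r0|r0] := leP 0%R r; last first.
  rewrite (_ : h n @^-1` [set r] = set0) ?measure0 ?mule0.
    by apply/esym/integral0_eq => x _; rewrite indic0 mulr0 mul0e.
  by rewrite -subset0 => x /= hr; move: r0; rewrite -hr ltNge fun_ge0.
rewrite nuE// integral_mkcond -ge0_integralZl//=; last 2 first.
- apply: (measurable_restrictT _ _).1 => //.
  by apply: measurable_funTS; exact/measurable_EFinP.
- by move=> x _; rewrite erestrict_ge0// => y _; rewrite lee_fin.
apply: eq_integral => x _; rewrite patchE indicE; case: ifPn => _.
  by rewrite mulr1.
by rewrite mulr0 mul0e mule0.
Qed.

End density_measure.

(** * Compact sets, test functions and square-integrable functions *)

Section matrix_topology.
Context (R : realType) (m n : nat).

Lemma continuous_mx (T : topologicalType) (f : T -> 'M[R]_(m, n)) :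
  (forall i j, continuous (fun x => f x i j)) -> continuous f.
Proof.
move=> cf x; apply/cvgrPdist_lt => /= e e0.
have : \forall y \near x, forall ij : 'I_m * 'I_n,
    `|f x ij.1 ij.2 - f y ij.1 ij.2| < e.
  apply: filter_forall => ij.
  by have /cvgrPdist_lt/(_ _ e0) := cf ij.1 ij.2 x.
apply: filterS => y xy; apply: mx_norm_lt => // i j.
by rewrite !mxE; exact: xy (i, j).
Qed.

(** Transported along the continuous map [vec_mx] from row vectors, where a product of segments is
    compact. *)
Lemma compact_box (a b : 'I_m -> 'I_n -> R) :
  compact (box (fun i j => `[a i j, b i j]%classic)).
Proof.
pose g k := enum_val (cast_ord (esym (mxvec_cast m n)) k).
have gE i j : g (mxvec_index i j) = (i, j).
  by rewrite /g /mxvec_index cast_ordK enum_rankK.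
have Eg k : mxvec_index (g k).1 (g k).2 = k.
  by rewrite /g /mxvec_index -surjective_pairing enum_valK cast_ordKV.
have := @rV_compact R (m * n) (fun k => `[a (g k).1 (g k).2, b (g k).1 (g k).2]%classic)
  (fun k => @segment_compact _ _ _).
move=> /(@continuous_compact _ _ (fun v : 'rV[R]_(m * n) => vec_mx v)).
rewrite (_ : _ @` _ = box (fun i j => `[a i j, b i j]%classic)).
  apply; apply: continuous_subspaceT; apply: continuous_mx => i j.
  under eq_fun do rewrite mxE.
  exact: coord_continuous.
apply/seteqP; split=> [_ [v /= vk <-] i j|x xk].
  by rewrite /= mxE; have := vk (mxvec_index i j); rewrite gE.
exists (mxvec x); last exact: mxvecK.
by move=> k /=; have := xk (g k).1 (g k).2; rewrite /= -mxvecE Eg.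
Qed.

Lemma compact_measurable_mx (K : set 'M[R]_(m, n)) : compact K -> measurable K.
Proof.
move=> cK; rewrite -[K]setCK; apply: measurableC; apply: open_measurable_mx.
by apply: closed_openC; apply: compact_closed => //; exact: norm_hausdorff.
Qed.

Lemma bounded_sub_obox (A : set 'M[R]_(m, n)) : bounded_set A ->
  exists k : nat, A `<=` obox (fun _ _ => - k%:R) (fun _ _ => k%:R).
Proof.
move=> [M [_ AM]]; exists (Num.truncn (`|M| + 1)).+1 => x Ax.
rewrite oboxE => i j; rewrite -ltr_norml.
apply: le_lt_trans (truncnS_gt _); apply: le_trans (ler_mx_coord _ _ _) _.
by apply: AM => //; rewrite (le_lt_trans (ler_norm _))// ltrDl.
Qed.

Lemma compact_lty (K : set 'M[R]_(m, n)) : compact K -> (lebesgue_mx K < +oo)%E.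
Proof.
move=> cK; have [k Kk] := bounded_sub_obox (compact_bounded cK).
apply: le_lt_trans (obox_lty (fun _ _ => - k%:R) (fun _ _ => k%:R)).
by apply: le_measure => //; rewrite inE;
  [exact: compact_measurable_mx|exact: measurable_obox].
Qed.

Definition cube (k : nat) : set 'M[R]_(m, n) :=
  box (fun _ _ => `[- k%:R, k%:R]%classic).

Lemma compact_cube k : compact (cube k). Proof. exact: compact_box. Qed.

Lemma obox_sub_cube k : obox (fun _ _ => - k%:R) (fun _ _ => k%:R) `<=` cube k.
Proof.
by move=> x xk i j; have := xk i j; rewrite /= !in_itv/= => /andP[/ltW -> /ltW ->].
Qed.

Lemma cube_cover : \bigcup_k cube k = setT.
Proof.
rewrite -subTset -(@obox_cover R m n) => x [k _ xk].
by exists k => //; exact: obox_sub_cube.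
Qed.

End matrix_topology.

Section test_functions.
Context (R : realType) (m n : nat).
Notation M := 'M[R]_(m, n).
Implicit Types (phi u : M -> R).

(** Outside its closed support [phi] vanishes on a neighbourhood, hence so do its derivatives. *)
Lemma test_support phi : test_function phi ->
  exists2 K, compact K &
    forall x, ~ K x -> phi x = 0 /\ forall ij, partial ij phi x = 0.
Proof.
move=> [sphi cphi]; exists (closure [set x | phi x != 0]) => // x nKx.
have oC : open (~` closure [set x | phi x != 0]).
  by apply: closed_openC; exact: closed_closure.
have nx : \forall y \near x, phi y = 0.
  apply: filterS (open_nbhs_nbhs (conj oC nKx)) => y nKy.
  by apply/eqP/negPn/negP => py; apply: nKy; exact: subset_closure.
split; first exact: nbhs_singleton nx.
move=> ij; rewrite /partial (near_eq_derive (g := cst 0)) ?derive_cst//.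
Qed.

Lemma test_functionP phi (K : set M) : smooth phi -> compact K ->
  (forall x, ~ K x -> phi x = 0) -> test_function phi.
Proof.
move=> sphi cK pK; split => //.
have cl : closed K by apply: compact_closed => //; exact: norm_hausdorff.
apply: (subclosed_compact _ cK); first exact: closed_closure.
rewrite [X in _ `<=` X](closure_id K).1//; apply: closure_subset => x /= px.
by apply: contrapT => /pK/eqP; exact/negP.
Qed.

Lemma test_partial ij phi : test_function phi -> test_function (partial ij phi).
Proof.
move=> tphi; have [K cK pK] := test_support tphi.
apply: (@test_functionP _ K) => //; first exact: smooth_partial tphi.1.
by move=> x /pK[].
Qed.

Lemma test_mul s phi : smooth s -> test_function phi ->
  test_function (fun x => s x * phi x).
Proof.
move=> ss tphi; have [K cK pK] := test_support tphi.
apply: (@test_functionP _ K) => //; first exact: smoothM ss tphi.1.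
by move=> x /pK[-> _]; rewrite mulr0.
Qed.

Lemma test_bounded phi : test_function phi -> exists C : R, forall x, `|phi x| <= C.
Proof.
move=> tphi; have [K cK pK] := test_support tphi.
have : compact (phi @` K).
  by apply: continuous_compact => //; apply: continuous_subspaceT;
    exact: smooth_continuous tphi.1.
move=> /compact_bounded[C [_ KC]]; exists (`|C| + 1) => x.
have [Kx|/pK[-> _]] := pselect (K x); last by rewrite normr0 addr_ge0.
by apply: KC; [rewrite (le_lt_trans (ler_norm _))// ltrDl|exists x].
Qed.

Lemma locally_integrable_measurable u : locally_integrable_mx u ->
  measurable_fun setT u.
Proof.
move=> iu; rewrite -(@cube_cover R m n).
apply/measurable_fun_bigcup => k.
  by apply: compact_measurable_mx; exact: compact_cube.
apply/measurable_EFinP; apply: (measurable_int lebesgue_mx); apply: iu.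
exact: compact_cube.
Qed.

Lemma integrable_compact_support u phi (K : set M) (C : R) : locally_integrable_mx u ->
  compact K -> measurable_fun setT phi -> (forall x, `|phi x| <= C) ->
  (forall x, ~ K x -> phi x = 0) ->
  lebesgue_mx.-integrable setT (EFin \o (fun x => u x * phi x)).
Proof.
move=> iu cK mphi phiC phiK; have mK := compact_measurable_mx cK.
have mu := locally_integrable_measurable iu.
rewrite (_ : _ \o _ = (EFin \o (fun x => u x * phi x)) \_ K).
  apply/(integrable_mkcond _ mK).
  apply: (le_integrable mK (g := fun x => (C%:E * (u x)%:E)%E)) => [|x Kx|].
  - by apply/measurable_EFinP/measurable_funTS; exact: measurable_funM.
  - rewrite /= lee_fin !normrM mulrC ler_wpM2r//.
    exact: le_trans (phiC x) (ler_norm _).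
  - by apply: integrableZl => //; exact: iu.
apply/funext => x; rewrite patchE; case: ifPn => // /negP xK.
by rewrite /= phiK ?mulr0// => Kx; apply: xK; rewrite inE.
Qed.

Lemma integrable_test u phi : locally_integrable_mx u -> test_function phi ->
  lebesgue_mx.-integrable setT (EFin \o (fun x => u x * phi x)).
Proof.
move=> iu tphi; have [K cK pK] := test_support tphi.
have [C phiC] := test_bounded tphi.
apply: (integrable_compact_support iu cK _ phiC) => [|x /pK[]//].
by apply: continuous_measurable_mx; exact: smooth_continuous tphi.1.
Qed.

Lemma Lfun2P u : (u \in Lfun (@lebesgue_mx R m n) 2%:E) <->
  measurable_fun setT u /\ (\int[lebesgue_mx]_x (u x ^+ 2)%:E < +oo)%E.
Proof.
split=> [u2|[mu u2]].
  split; first by move: u2; rewrite inE => /andP[/[1!inE]].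
  have /integrableP[_] := Lfun2_integrable_sqr u2.
  apply: le_lt_trans; rewrite le_eqVlt; apply/orP; left; apply/eqP.
  by apply: eq_integral => x _ /=; rewrite ger0_norm// sqr_ge0.
rewrite inE; apply/andP; split; rewrite inE//=.
rewrite /finite_norm unlock /= poweR_lty//.
apply: le_lt_trans u2; rewrite le_eqVlt; apply/orP; left; apply/eqP.
apply: eq_integral => x _ /=.
by rewrite powR_mulrn// real_normK ?num_real.
Qed.

(** On a compact set, which has finite measure, |u| is dominated by the integrable function 1 +
    u^2. *)
Lemma Lfun2_locally_integrable u : u \in Lfun (@lebesgue_mx R m n) 2%:E ->
  locally_integrable_mx u.
Proof.
move=> /Lfun2P[mu u2] K cK; have mK := compact_measurable_mx cK.
have i1 : lebesgue_mx.-integrable K (EFin \o (cst 1 : M -> R)).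
  apply/integrableP; split; first exact/measurable_EFinP.
  under eq_integral do rewrite /= normr1.
  by rewrite integral_cst// mul1e; exact: compact_lty.
apply: (le_integrable mK (g := fun x => (1%:E + (u x ^+ 2)%:E)%E)) => [|x Kx|].
- by apply/measurable_EFinP/measurable_funTS.
- rewrite /= lee_fin [leRHS]ger0_norm ?addr_ge0 ?sqr_ge0//.
  have := sqr_ge0 (`|u x| - 1); rewrite sqrrB1 real_normK ?num_real//.
  have := normr_ge0 (u x); lra.
apply: integrableD => //; apply: (integrableS measurableT) => //.
apply/integrableP; split.
  by apply/measurable_EFinP; exact: measurable_funX.
by under eq_integral do rewrite /= ger0_norm ?sqr_ge0//.
Qed.

End test_functions.

(** * The fundamental lemma of the calculus of variations *)

Section du_bois_reymond.
Context (R : realType) (m n : nat).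
Notation M := 'M[R]_(m, n).
Implicit Types (a b : 'I_m -> 'I_n -> R) (u v : M -> R).

(** Test functions bounded by 1 that converge pointwise to the indicator of the open box as [k]
    grows. *)
Definition bump a b (k : nat) (x : M) : R :=
  \prod_(p : 'I_m * 'I_n) (flat 0 (k.+1%:R * (x p.1 p.2 - a p.1 p.2)) *
                           flat 0 (k.+1%:R * (b p.1 p.2 - x p.1 p.2))).

Lemma bump_ge0 a b k x : 0 <= bump a b k x.
Proof. by apply: prodr_ge0 => p _; rewrite mulr_ge0 ?flat_ge0. Qed.

Lemma bump_le1 a b k x : bump a b k x <= 1.
Proof.
apply: prodr_ile1 => p _; rewrite mulr_ge0 ?flat_ge0//=.
have f1 (t : R) : flat 0 t <= 1 := flat_le 0 t.
by rewrite mulr_ile1 ?flat_ge0.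
Qed.

Lemma bump_out a b k x : ~ obox a b x -> bump a b k x = 0.
Proof.
move=> xab; apply/eqP/negPn/negP => /prodf_neq0 xp; apply: xab.
rewrite oboxE => i j; have := xp (i, j) isT; rewrite mulf_eq0 negb_or /=.
have pos (t : R) : flat 0 (k.+1%:R * t) != 0 -> 0 < t.
  rewrite ltNge; apply: contra => t0; rewrite flat_neg//.
  by rewrite pmulr_rle0.
by move=> /andP[/pos + /pos]; rewrite !subr_gt0 => -> ->.
Qed.

Lemma tame_bump a b k : tame (bump a b k).
Proof.
apply: tame_prod => p _; apply: tameM.
  rewrite (_ : (fun x => _) = aflat 0 k.+1%:R (- (k.+1%:R * a p.1 p.2)) p.1 p.2).
    exact: tame_aflat.
  by apply/funext => x; rewrite /aflat mulrBr.
rewrite (_ : (fun x => _) = aflat 0 (- k.+1%:R) (k.+1%:R * b p.1 p.2) p.1 p.2).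
  exact: tame_aflat.
by apply/funext => x; rewrite /aflat; congr flat; ring.
Qed.

Lemma test_bump a b k : test_function (bump a b k).
Proof.
apply: (@test_functionP _ _ _ _ (box (fun i j => `[a i j, b i j]%classic))).
- exact: (tame_bump a b k).1.
- exact: compact_box.
move=> x xab; apply: bump_out; apply: contra_not xab.
by move=> xab i j; have := xab i j; rewrite /= !in_itv/= => /andP[/ltW -> /ltW ->].
Qed.

Lemma cvg_bump a b x : bump a b k x @[k --> \oo] --> (\1_(obox a b) x : R).
Proof.
rewrite indicE; case: (boolP (x \in _)) => [|/negP] /[!inE] xab; last first.
  by under eq_fun do rewrite bump_out//; exact: cvg_cst.
(* Inside the box the product of the exponentials is exp(-S / (k+1)), which tends to 1. *)
pose S := \sum_(p : 'I_m * 'I_n)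
  ((x p.1 p.2 - a p.1 p.2)^-1 + (b p.1 p.2 - x p.1 p.2)^-1).
rewrite (_ : (fun k => _) = (fun k => expR (- (S * k.+1%:R^-1)))).
  have cS : - (S * k.+1%:R^-1) @[k --> \oo] --> (0 : R).
    rewrite -oppr0 -(mulr0 S).
    by apply: cvgN; apply: cvgM; [exact: cvg_cst|exact: cvg_harmonic].
  have := continuous_cvg _ (@continuous_expR R 0) cS.
  rewrite expR0; exact.
apply/funext => k; rewrite /bump /S mulr_suml -sumrN expR_sum.
apply: eq_bigr => p _; move: xab; rewrite oboxE => /(_ p.1 p.2)/andP[ax xb].
have k0 : 0 < k.+1%:R :> R by [].
rewrite !flat_pos ?mulr_gt0 ?subr_gt0// !expr0 !mul1r -expRD.
by congr expR; rewrite !invfM mulrDl opprD ![k.+1%:R^-1 * _]mulrC.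
Qed.

Lemma locally_integrable_mxD u v : locally_integrable_mx u ->
  locally_integrable_mx v -> locally_integrable_mx (fun x => u x + v x).
Proof.
move=> iu iv K cK; have := integrableD (compact_measurable_mx cK) (iu K cK) (iv K cK).
by [].
Qed.

Lemma locally_integrable_le u v : measurable_fun setT u ->
  (forall x, `|u x| <= `|v x|) -> locally_integrable_mx v -> locally_integrable_mx u.
Proof.
move=> mu uv iv K cK; apply: le_integrable (iv K cK) => [||x Kx].
- exact: compact_measurable_mx.
- by apply/measurable_EFinP/measurable_funTS.
- by rewrite /= lee_fin.
Qed.

Lemma locally_integrable_mulr u (s : M -> R) (C : R) :
  measurable_fun setT s -> (forall x, `|s x| <= C) ->
  locally_integrable_mx u -> locally_integrable_mx (fun x => s x * u x).
Proof.
move=> ms sC iu; have mu := locally_integrable_measurable iu.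
apply: (@locally_integrable_le _ (fun x => C * u x)) => [|x|K cK].
- exact: measurable_funM.
- by rewrite !normrM ler_wpM2r// (le_trans (sC x))// ler_norm.
- by have := integrableZl (compact_measurable_mx cK) C (iu K cK).
Qed.

Lemma locally_integrable_max u : locally_integrable_mx u ->
  locally_integrable_mx (fun x => Num.max (u x) 0).
Proof.
move=> iu; apply: locally_integrable_le (iu).
  apply: (@measurable_maxr _ _ _ _ u (cst 0)) => //.
  exact: locally_integrable_measurable.
by move=> x; case: (leP (u x) 0) => //; rewrite normr0.
Qed.

Lemma locally_integrable_mxN u : locally_integrable_mx u ->
  locally_integrable_mx (fun x => - u x).
Proof.
move=> iu; apply: locally_integrable_le (iu).
  by apply: measurableT_comp => //; exact: locally_integrable_measurable.
by move=> x; rewrite normrN.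
Qed.

Lemma cvg_integral_test (u_ : nat -> M -> R) u U phi :
  (forall k, measurable_fun setT (u_ k)) ->
  (forall x, u_ k x @[k --> \oo] --> u x) ->
  (forall k x, `|u_ k x| <= U x) -> locally_integrable_mx U ->
  test_function phi ->
  (\int[lebesgue_mx]_x (u_ k x * phi x))%R @[k --> \oo] -->
  (\int[lebesgue_mx]_x (u x * phi x))%R.
Proof.
move=> mu_ cu uU iU tphi.
have mphi : measurable_fun setT phi.
  by apply: continuous_measurable_mx; exact: smooth_continuous tphi.1.
have iUphi := integrable_test iU tphi.
have iF : lebesgue_mx.-integrable setT (fun x => `|(U x * phi x)%:E|%E).
  exact: integrable_abse iUphi.
have cv x : u_ k x * phi x @[k --> \oo] --> u x * phi x by apply: cvgM => //; exact: cvg_cst.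
have mk k : measurable_fun setT (fun x => (u_ k x * phi x)%:E).
  by apply/measurable_EFinP; exact: measurable_funM.
have U0 x : 0 <= U x by exact: le_trans (uU 0 x).
have [] := @dominated_convergence _ _ _ lebesgue_mx setT measurableT
  (fun k x => (u_ k x * phi x)%:E) (fun x => (u x * phi x)%:E) _ mk _ _ iF _.
- apply/measurable_EFinP; apply: (measurable_fun_cvg _ (fun x _ => cv x)) => k.
  exact: measurable_funM.
- by apply: aeW => x _; apply: cvg_EFin; [exact: nearW|exact: cv].
- apply: aeW => x k _; rewrite /= lee_fin !normrM ler_wpM2r//.
  by rewrite (ger0_norm (U0 x)).
move=> iu _ cvi.
have fin : (\int[lebesgue_mx]_x (u x * phi x)%:E)%E \is a fin_num.
  exact: integrable_fin_num.
by move: cvi; rewrite -(fineK fin); exact: fine_cvg.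
Qed.

(** Bumps approximate indicators of boxes, so equality against test functions gives equal integrals
    over boxes, then over all Borel subsets of a cube, then almost everywhere. *)
Lemma du_bois_reymond u v : locally_integrable_mx u -> locally_integrable_mx v ->
  (forall phi, test_function phi ->
    \int[lebesgue_mx]_x (u x * phi x) = \int[lebesgue_mx]_x (v x * phi x)) ->
  {ae @lebesgue_mx R m n, forall x, u x = v x}.
Proof.
move=> iu iv uv.
(* Moving the negative parts across gives nonnegative [p] and [q] with p - q = u - v; as densities
   they define measures, to which uniqueness on boxes applies. *)
pose p x := Num.max (u x) 0 + Num.max (- v x) 0.
pose q x := Num.max (v x) 0 + Num.max (- u x) 0.
have maxB (t : R) : Num.max t 0 - Num.max (- t) 0 = t.
  case: (leP t 0) => t0; [rewrite max_l ?oppr_ge0//|rewrite max_r ?oppr_le0 ?ltW//].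
    by rewrite sub0r opprK.
  by rewrite subr0.
have pq x : p x - q x = u x - v x.
  by rewrite -[in RHS](maxB (u x)) -[in RHS](maxB (v x)) /p /q; ring.
have p0 x : 0 <= p x by rewrite addr_ge0// le_max lexx orbT.
have q0 x : 0 <= q x by rewrite addr_ge0// le_max lexx orbT.
have ip : locally_integrable_mx p.
  by apply: locally_integrable_mxD; apply: locally_integrable_max => //;
    exact: locally_integrable_mxN.
have iq : locally_integrable_mx q.
  by apply: locally_integrable_mxD; apply: locally_integrable_max => //;
    exact: locally_integrable_mxN.
have mp := locally_integrable_measurable ip.
have mq := locally_integrable_measurable iq.
have pqphi phi : test_function phi ->
    \int[lebesgue_mx]_x (p x * phi x) = \int[lebesgue_mx]_x (q x * phi x).
  move=> tphi; apply/eqP; rewrite -subr_eq0.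
  rewrite -RintegralB//; [|exact: integrable_test..].
  rewrite (_ : (fun x => _) = (fun x => u x * phi x - v x * phi x)).
    rewrite RintegralB//; [|exact: integrable_test..].
    by rewrite uv// subrr.
  by apply/funext => x; rewrite -!mulrBl pq.
have box_int w a b : locally_integrable_mx w -> (forall x, 0 <= w x) ->
    ((\int[lebesgue_mx]_x (w x * bump a b k x))%:E @[k --> \oo] -->
      \int[lebesgue_mx]_(x in obox a b) (w x)%:E)%E.
  move=> iw w0.
  have mw := locally_integrable_measurable iw.
  have mab := measurable_obox a b.
  have wl : lebesgue_mx.-integrable (obox a b) (EFin \o w).
    have cb := @compact_box R m n a b; have iwc := iw _ cb.
    apply: integrableS iwc => //; first exact: compact_measurable_mx.
    by move=> x xab i j; have := xab i j; rewrite /= !in_itv/= => /andP[/ltW -> /ltW ->].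
  rewrite integral_mkcond.
  have iwab : lebesgue_mx.-integrable setT ((EFin \o w) \_ (obox a b)).
    exact/(integrable_mkcond _ mab).
  have mk k : measurable_fun setT (fun x => (w x * bump a b k x)%:E).
    apply/measurable_EFinP; apply: measurable_funM => //.
    by apply: continuous_measurable_mx; exact: smooth_continuous (tame_bump a b k).1.
  have [] := @dominated_convergence _ _ _ lebesgue_mx setT measurableT
    (fun k x => (w x * bump a b k x)%:E) ((EFin \o w) \_ (obox a b))
    ((EFin \o w) \_ (obox a b)) mk (measurable_int _ iwab) _ iwab _.
  - apply: aeW => x _; rewrite (_ : patch _ _ _ _ = (w x * \1_(obox a b) x)%:E).
      apply: cvg_EFin; first exact: nearW.
      by apply: cvgM; [exact: cvg_cst|exact: cvg_bump].
    by rewrite patchE indicE; case: ifP => _; rewrite ?mulr1 ?mulr0.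
  - apply: aeW => x k _; rewrite patchE; case: ifPn => [_|/negP xab].
      by rewrite lee_fin ger0_norm ?mulr_ge0 ?bump_ge0// ler_piMr// bump_le1.
    by rewrite bump_out ?mulr0 ?abse0// => xab'; apply: xab; rewrite inE.
  move=> _ _; apply: cvg_trans; apply: near_eq_cvg; apply: nearW => k.
  rewrite /Rintegral fineK//; apply: integrable_fin_num => //.
  exact: integrable_test (test_bump a b k).
have pq_box a b : (\int[lebesgue_mx]_(x in obox a b) (p x)%:E =
    \int[lebesgue_mx]_(x in obox a b) (q x)%:E)%E.
  apply: (cvg_unique _ (box_int _ a b ip p0)) => //.
  have := box_int _ a b iq q0.
  rewrite (_ : (fun k => _) = (fun k => (\int[lebesgue_mx]_x (p x * bump a b k x))%:E))//.
  by apply/funext => k; rewrite pqphi//; exact: test_bump.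
pose Q (k : nat) : set M := obox (fun _ _ => - k%:R) (fun _ _ => k%:R).
have mQ k : measurable (Q k) by exact: measurable_obox.
have ipQ k w : locally_integrable_mx w -> lebesgue_mx.-integrable (Q k) (EFin \o w).
  move=> iw; have cb := @compact_cube R m n k; have iwc := iw _ cb.
  apply: integrableS iwc => //; first exact: compact_measurable_mx.
  exact: obox_sub_cube.
have eqQ k E : measurable E -> E `<=` Q k ->
    (\int[lebesgue_mx]_(x in E) (p x)%:E = \int[lebesgue_mx]_(x in E) (q x)%:E)%E.
  move=> mE EQ.
  (* Restricting to the cube [Q k] makes the two measures finite on boxes. *)
  pose D w := fun x : M => \1_(Q k) x * w x : R.
  have D0 w : (forall x, 0 <= w x) -> forall x, 0 <= D w x.
    by move=> w0 x; rewrite mulr_ge0.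
  have mD w : measurable_fun setT w -> measurable_fun setT (D w).
    by move=> mw; apply: measurable_funM.
  have DE w A : (\int[lebesgue_mx]_(x in A) (D w x)%:E =
      \int[lebesgue_mx]_(x in A `&` Q k) (w x)%:E)%E.
    rewrite integral_mkcondr; apply: eq_integral => x _.
    by rewrite patchE /D indicE; case: ifP => _; rewrite ?mul1r ?mul0r.
  have pQoo : (\int[lebesgue_mx]_(x in Q k) (p x)%:E < +oo)%E.
    have /integrableP[_] := ipQ k p ip; apply: le_lt_trans.
    rewrite le_eqVlt; apply/orP; left; apply/eqP.
    by apply: eq_integral => x _; rewrite /= ger0_norm.
  have := @mx_measure_unique R m n (dens_measure lebesgue_mx (mD p mp) (D0 p p0))
    (dens_measure lebesgue_mx (mD q mq) (D0 q q0)).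
  rewrite /dens_measure /= /dens_of => /(_ _ _ E mE).
  rewrite !DE setIidl//; apply => a b.
    by rewrite !DE oboxI pq_box.
  rewrite DE; apply: le_lt_trans pQoo.
  apply: ge0_subset_integral => //; first by apply: measurableI => //; exact: measurable_obox.
    by apply/measurable_EFinP/measurable_funTS.
  by move=> x _; rewrite lee_fin.
have ae_k k : {ae @lebesgue_mx R m n, forall x, Q k x -> (p x)%:E = (q x)%:E}.
  apply: integral_ae_eq; [exact: mQ|exact: ipQ| |]; last first.
    by move=> E EQ mE; exact: eqQ mE EQ.
  by apply/measurable_EFinP/measurable_funTS.
apply: filterS (ae_foralln ae_k) => x xpq.
have [k _ xk] : (\bigcup_k Q k) x by rewrite obox_cover.
have [pqx] := xpq k xk.
by apply/eqP; rewrite -subr_eq0 -pq pqx subrr.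
Qed.

End du_bois_reymond.

(** * Weak derivatives: uniqueness, Leibniz rule, limits, square roots *)

Section weak_calculus.
Context (R : realType) (m n : nat).
Notation M := 'M[R]_(m, n).
Implicit Types (u v s phi : M -> R) (ij : 'I_m * 'I_n).

(** The derivative picked by [xget] is itself a weak derivative as soon as one exists, and two of
    them agree almost everywhere by [du_bois_reymond]. *)
Lemma weak_partial_ae ij u g : is_weak_partial ij u g ->
  {ae @lebesgue_mx R m n, forall x, weak_partial ij u x = g x}.
Proof.
move=> ug; have [lw uw] : is_weak_partial ij u (weak_partial ij u).
  by apply: (@xgetPex _ (fun=> 0) [set g | is_weak_partial ij u g]); exists g.
have [lg {}ug] := ug.
apply: du_bois_reymond => // phi tphi.
by apply: oppr_inj; rewrite -uw// ug.
Qed.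

Lemma is_weak_partial0 ij : is_weak_partial ij (cst 0 : M -> R) (cst 0).
Proof.
split; first by move=> K cK; exact: integrable0.
move=> phi _; rewrite /Rintegral !integral0_eq ?oppr0//= => x _;
  by rewrite mul0r.
Qed.

(** For a test function phi, s phi is again one; testing [u] against its derivative produces both
    terms of the Leibniz rule. *)
Lemma is_weak_partialM ij u v s : tame s -> locally_integrable_mx u ->
  is_weak_partial ij u v ->
  is_weak_partial ij (fun x => s x * u x) (fun x => s x * v x + partial ij s x * u x).
Proof.
move=> [ss [C sC]] lu [lv uv].
have ms : measurable_fun setT s.
  by apply: continuous_measurable_mx; exact: smooth_continuous.
have mds : measurable_fun setT (partial ij s).
  by apply: continuous_measurable_mx; apply: smooth_continuous; exact: smooth_partial.
have lsv : locally_integrable_mx (fun x => s x * v x).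
  by apply: (locally_integrable_mulr ms (C := C)) => // x; have [] := sC x.
have ldsu : locally_integrable_mx (fun x => partial ij s x * u x).
  by apply: (locally_integrable_mulr mds (C := C)) => // x; have [_] := sC x.
split; first exact: (locally_integrable_mxD lsv ldsu).
move=> phi tphi; have tsphi := test_mul ss tphi.
have tdphi := test_partial ij tphi.
have tdsphi := test_mul (smooth_partial ij ss) tphi.
have dE x : partial ij (fun x => s x * phi x) x =
    partial ij s x * phi x + s x * partial ij phi x.
  by rewrite partialM//; [exact: smooth_diff|exact: smooth_diff tphi.1].
have := uv _ tsphi.
transitivity (\int[lebesgue_mx]_x (u x * partial ij (fun x => s x * phi x) x -
    u x * (partial ij s x * phi x))).
  by apply: eq_Rintegral => x _; rewrite dE; ring.
rewrite RintegralB//; last 2 first.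
- by apply: integrable_test => //; exact: test_partial.
- exact: integrable_test.
rewrite H -opprD; congr (- _).
rewrite -RintegralD//; [|exact: integrable_test|exact: integrable_test].
by apply: eq_Rintegral => x _; ring.
Qed.

(** Dominated convergence in both sides of the identity defining the weak derivative. *)
Lemma is_weak_partial_lim ij (u_ v_ : nat -> M -> R) u v U V :
  (forall k, is_weak_partial ij (u_ k) (v_ k)) ->
  (forall k, measurable_fun setT (u_ k)) ->
  (forall x, u_ k x @[k --> \oo] --> u x) ->
  (forall x, v_ k x @[k --> \oo] --> v x) ->
  (forall k x, `|u_ k x| <= U x) -> (forall k x, `|v_ k x| <= V x) ->
  locally_integrable_mx U -> locally_integrable_mx V ->
  is_weak_partial ij u v.
Proof.
move=> uv mu cu cv uU vV lU lV.
have mv k : measurable_fun setT (v_ k).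
  exact: locally_integrable_measurable (uv k).1.
split.
  apply: (locally_integrable_le _ _ lV).
    by apply: (measurable_fun_cvg _ (fun x _ => cv x)).
  move=> x; apply: le_trans (ler_norm _).
  apply: (ler_cvg_to (cvg_norm (cv x)) (cvg_cst (V x))); exact: nearW.
move=> phi tphi.
have := cvg_integral_test mu cu uU lU (test_partial ij tphi).
rewrite (_ : (fun k => _) = (fun k => - \int[lebesgue_mx]_x (v_ k x * phi x))).
  move/cvg_unique; apply => //.
  by apply: cvgN; exact: cvg_integral_test vV lV tphi.
by apply/funext => k; exact: (uv k).2.
Qed.

(** The root of [g] need not be smooth where [g] vanishes, so it is replaced by the root of g +
    1/(k+1), which is tame. The bound on the derivative of [g] by A sqrt(g) keeps the derivatives of
    these roots below [A] uniformly in [k], and the limit is dominated. *)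
Lemma is_weak_partial_sqrt ij u v g (A : R) : 0 <= A -> tame g -> (forall x, 0 <= g x) ->
  (forall x, `|partial ij g x| <= A * Num.sqrt (g x)) ->
  locally_integrable_mx u -> is_weak_partial ij u v ->
  is_weak_partial ij (fun x => Num.sqrt (g x) * u x)
    (fun x => Num.sqrt (g x) * v x +
              partial ij g x * (2^-1 * (Num.sqrt (g x))^-1) * u x).
Proof.
move=> A0 tg g0 dgA lu uv.
have [sg [C gC]] := tg.
pose q (k : nat) x := g x + cst k.+1%:R^-1 x.
have k0 (k : nat) : 0 < k.+1%:R^-1 :> R by rewrite invr_gt0.
have qk k x : k.+1%:R^-1 <= q k x by rewrite lerDr.
have q0 k x : 0 < q k x by exact: lt_le_trans (qk k x).
have tq k : tame (q k) by apply: tameD => //; exact: tame_cst.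
have dq k : partial ij (q k) = partial ij g.
  rewrite partialD ?partial_cst; last by move=> x; exact: differentiable_cst.
    by apply/funext => x; rewrite addr0.
  exact: smooth_diff.
have tsq k : tame (fun x => Num.sqrt (q k x)) by exact: tame_sqrt (qk k) (tq k).
have cq x : q k x @[k --> \oo] --> g x.
  rewrite -[X in _ --> X]addr0; apply: cvgD; first exact: cvg_cst.
  exact: cvg_harmonic.
have csq x : Num.sqrt (q k x) @[k --> \oo] --> Num.sqrt (g x).
  exact: continuous_cvg (@sqrt_continuous R (g x)) (cq x).
have mu := locally_integrable_measurable lu.
have lv := uv.1; have mv := locally_integrable_measurable lv.
have mnorm (w : M -> R) : measurable_fun setT w -> measurable_fun setT (fun x => `|w x|).
  by move=> mw; exact: measurableT_comp.
have lnorm (w : M -> R) (c : R) : locally_integrable_mx w -> locally_integrable_mx (fun x => c * `|w x|).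
  move=> lw; apply: (locally_integrable_mulr (C := `|c|)) => //.
  apply: locally_integrable_le (lw) => [|x]; last by rewrite normr_id.
  by apply: mnorm; exact: locally_integrable_measurable lw.
have sqC k x : `|Num.sqrt (q k x)| <= Num.sqrt (C + 1).
  rewrite ger0_norm ?sqrtr_ge0// ler_wsqrtr// lerD//.
    exact: le_trans (ler_norm _) (gC x).1.
  by rewrite /= invf_le1// ler1n.
have dsC k x : `|partial ij g x * (2^-1 * (Num.sqrt (q k x))^-1)| <= A.
  have s0 : 0 < Num.sqrt (q k x) by rewrite sqrtr_gt0.
  rewrite normrM [X in _ * X]ger0_norm ?mulr_ge0 ?invr_ge0 ?sqrtr_ge0//.
  rewrite mulrA ler_pdivrMr// (@le_trans _ _ (`|partial ij g x|))//.
    have h2 : 2^-1 <= 1 :> R by lra.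
    by rewrite ler_piMr.
  by rewrite (le_trans (dgA x))// ler_wpM2l// ler_wsqrtr// lerDl; exact: ltW (k0 k).
apply: (@is_weak_partial_lim ij (fun k x => Num.sqrt (q k x) * u x)
  (fun k x => Num.sqrt (q k x) * v x +
     partial ij (fun x => Num.sqrt (q k x)) x * u x) _ _
  (fun x => Num.sqrt (C + 1) * `|u x|)
  (fun x => Num.sqrt (C + 1) * `|v x| + A * `|u x|)).
- by move=> k; exact: is_weak_partialM.
- move=> k; apply: measurable_funM => //.
  by apply: continuous_measurable_mx; exact: smooth_continuous (tsq k).1.
- by move=> x; apply: cvgM => //; exact: cvg_cst.
- move=> x; apply: cvgD; first by apply: cvgM => //; exact: cvg_cst.
  apply: cvgM; last exact: cvg_cst.
  rewrite (_ : (fun k => _) =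
    (fun k => partial ij g x * (2^-1 * (Num.sqrt (q k x))^-1))); last first.
    by apply/funext => k; rewrite partial_sqrt ?dq//; exact: smooth_diff (tq _).1.
  (* At a zero of [g] its derivative is zero too, so the approximations and the limit formula, where
     the inverse of 0 is 0, all vanish. *)
  have [gx0|gx0] := eqVneq (g x) 0.
    have dg0 : partial ij g x = 0.
      by apply/eqP; rewrite -normr_le0 (le_trans (dgA x))// gx0 sqrtr0 mulr0.
    by rewrite dg0; under eq_fun do rewrite mul0r; rewrite mul0r; exact: cvg_cst.
  apply: cvgM; first exact: cvg_cst.
  apply: cvgM; first exact: cvg_cst.
  by apply: cvgV => //; rewrite sqrtr_eq0 -ltNge lt0r gx0 g0.
- by move=> k x; rewrite normrM ler_wpM2r.
- move=> k x; rewrite partial_sqrt//; last exact: smooth_diff (tq _).1.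
  rewrite dq (le_trans (ler_normD _ _))// lerD//.
    by rewrite normrM ler_wpM2r.
  by rewrite normrM ler_wpM2r.
- exact: lnorm.
- by apply: locally_integrable_mxD; exact: lnorm.
Qed.

End weak_calculus.

(** * Slices in one particle, and weak derivatives of tensor products *)

Lemma continuous_insert_row (R : realType) n d (i : 'I_n.+1) (y : 'M[R]_(n, d)) :
  continuous (fun x : 'rV[R]_d => insert_row i (x, y)).
Proof.
apply: continuous_mx => k j.
case: (unliftP i k) => [k' ->|->]; under eq_fun do rewrite ?insert_row_lift ?insert_row_eq.
  exact: cst_continuous.
exact: coord_continuous.
Qed.

Section slices.
Context (R : realType) (n d : nat) (i : 'I_n.+1) (y : 'M[R]_(n, d)).
Implicit Types (phi : 'M[R]_(n.+1, d) -> R).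

Let slice (x : 'rV[R]_d) : 'M[R]_(n.+1, d) := insert_row i (x, y).

Let sliceE (h : R) (v x : 'rV[R]_d) :
  slice (h *: v + x) = h *: insert_row i (v, 0) + slice x.
Proof.
apply/matrixP => k j; rewrite /slice !mxE; case: (unlift i k) => [k'|];
  by rewrite /= ?mxE ?mulr0 ?add0r.
Qed.

Let differentiable_slice x : differentiable slice x.
Proof.
pose lin0 (x : 'rV[R]_d) := slice x - slice 0.
have lin0E x' : lin0 x' = insert_row i (x', 0).
  by rewrite /lin0 -[x' in LHS]addr0 -[x' in LHS]scale1r sliceE scale1r addrK.
have lin : linear lin0.
  move=> h u v; rewrite !lin0E; apply/matrixP => k j.
  by rewrite !mxE; case: (unlift i k) => [k'|]; rewrite /= ?mxE ?mulr0 ?addr0.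
pose lM := GRing.isLinear.Build _ _ _ _ _ lin.
pose L : {linear 'rV[R]_d -> 'M[R]_(n.+1, d)} := HB.pack lin0 lM.
rewrite (_ : slice = (fun x => L x + cst (slice 0) x)); last first.
  by apply/funext => x'; rewrite /= /lin0 subrK.
apply: differentiableD; last exact: differentiable_cst.
apply: linear_differentiable; rewrite (_ : (L : _ -> _) = fun x => insert_row i (x, 0)).
  exact: continuous_insert_row.
exact/funext.
Qed.

(** The slice is affine with direction row [i], so its difference quotients are those of [phi] in
    that row. *)
Lemma partial_slice phi p :
  partial p (phi \o slice) = partial (i, p.2) phi \o slice.
Proof.
apply/funext => x; rewrite /partial /derive /=.
rewrite (_ : (fun h : R => h^-1 *: _) = (fun h : R => h^-1 *:
  ((phi \o shift (slice x)) (h *: delta_mx i p.2) - phi (slice x))))//.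
apply/funext => h /=; congr (_ *: (phi _ - _)).
rewrite sliceE; congr (_ *: _ + _); apply/matrixP => k j.
case: (unliftP i k) => [k' ->|->].
  by rewrite insert_row_lift /= !mxE [lift i k' == i]eq_sym eq_liftF.
by rewrite insert_row_eq !mxE !eqxx [p.1]ord1.
Qed.

Lemma smooth_slice phi : smooth phi -> smooth (phi \o slice).
Proof.
move=> sphi s x.
have -> : foldr (@partial R 1 d) (phi \o slice) s =
    foldr (@partial R n.+1 d) phi [seq (i, p.2) | p <- s] \o slice.
  by elim: s => //= p s ->; rewrite partial_slice.
by apply: differentiable_comp => //; exact: sphi.
Qed.

Lemma test_slice phi : test_function phi -> test_function (phi \o slice).
Proof.
move=> tphi; have [K cK pK] := test_support tphi.
apply: (@test_functionP _ _ _ _ (row i @` K)).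
- exact: smooth_slice tphi.1.
- apply: continuous_compact => //; apply: continuous_subspaceT.
  apply: continuous_mx => k j; under eq_fun do rewrite mxE.
  exact: coord_continuous.
- move=> x xK; apply: (pK _ _).1 => Kx; apply: xK; exists (slice x) => //.
  by rewrite row_insert_row.
Qed.

End slices.

Section tensor_sobolev.
Context (R : realType) (d : nat).
Local Notation mu := lebesgue_mx.

Lemma Lfun2_tensor n (h : 'I_n -> 'rV[R]_d -> R) :
  (forall l, h l \in Lfun (@lebesgue_mx R 1 d) 2%:E) ->
  (fun x : 'M[R]_(n, d) => \prod_l h l (row l x)) \in Lfun (@lebesgue_mx R n d) 2%:E.
Proof.
move=> hl; apply/Lfun2P; split.
  by apply: measurable_tensor => l; have /Lfun2P[] := hl l.
under eq_integral do rewrite -prodrXl.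
rewrite (integral_tensor (f := fun l x => h l x ^+ 2)
  (r := fun l => fine (\int[mu]_x (h l x ^+ 2)%:E))) ?ltry//.
- by move=> l; apply: measurable_funX; have /Lfun2P[] := hl l.
- by move=> l x; rewrite sqr_ge0.
- move=> l; rewrite fineK// ge0_fin_numE; first by have /Lfun2P[] := hl l.
  by apply: integral_ge0 => x _; rewrite lee_fin sqr_ge0.
Qed.

(** By Fubini the other rows may be frozen: their factors form a constant, and the slice of the test
    function in row [i] is a one-particle test function, against which [v] is the weak derivative of
    [f]. *)
Lemma is_weak_partial_tensor n (f v : 'rV[R]_d -> R) (i : 'I_n) (j : 'I_d) :
  f \in Lfun (@lebesgue_mx R 1 d) 2%:E -> v \in Lfun (@lebesgue_mx R 1 d) 2%:E ->
  is_weak_partial (ord0, j) f v ->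
  is_weak_partial (i, j) (fun x : 'M[R]_(n, d) => \prod_l f (row l x))
    (fun x => \prod_l (if l == i then v else f) (row l x)).
Proof.
case: n i => [[]//|n] i f2 v2 [lv fv].
pose w (x : 'M[R]_(n.+1, d)) := \prod_l f (row l x).
pose w' (x : 'M[R]_(n.+1, d)) := \prod_l (if l == i then v else f) (row l x).
have lw : locally_integrable_mx w.
  by apply: Lfun2_locally_integrable; exact: (Lfun2_tensor (h := fun=> f)).
have lw' : locally_integrable_mx w'.
  by apply: Lfun2_locally_integrable; apply: (Lfun2_tensor (h := fun l => if l == i then v else f)) => l; case: ifP.
split => // phi tphi.
pose P (y : 'M[R]_(n, d)) := \prod_l f (row l y).
have wE x y : w (insert_row i (x, y)) = P y * f x.
  rewrite /w (bigD1_ord i)//= row_insert_row mulrC; congr (_ * _).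
  by apply: eq_bigr => l _; rewrite row_lift_insert_row.
have w'E x y : w' (insert_row i (x, y)) = P y * v x.
  rewrite /w' (bigD1_ord i)//= eqxx row_insert_row mulrC; congr (_ * _).
  by apply: eq_bigr => l _; rewrite row_lift_insert_row eq_sym (negbTE (neq_lift _ _)).
have i1 := integrable_test lw (test_partial (i, j) tphi).
have i2 := integrable_test lw' tphi.
have i3 : mu.-integrable setT (EFin \o (fun x => -1 * (w' x * phi x))).
  by have := integrableZl measurableT (-1) i2.
rewrite -mulN1r -RintegralZl// /Rintegral.
rewrite (integral_insert_row i i1) (integral_insert_row i i3).
congr fine; apply: eq_integral => y _.
have tphiy := test_slice i y tphi.
have lf := Lfun2_locally_integrable f2.
have j1 := integrable_test lf (test_partial (ord0, j) tphiy).
have j2 := integrable_test lv tphiy.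
transitivity (P y * (\int[mu]_x (f x * partial (ord0, j) (phi \o (fun x => insert_row i (x, y))) x)))%:E.
  rewrite -RintegralZl// /Rintegral fineK; last first.
    apply: integrable_fin_num => //.
    by have := integrableZl measurableT (P y) j1.
  by apply: eq_integral => x _; rewrite /= wE partial_slice/= mulrA.
rewrite fv// mulrN -mulNr -RintegralZl// /Rintegral fineK; last first.
  apply: integrable_fin_num => //.
  by have := integrableZl measurableT (- P y) j2.
by apply: eq_integral => x _; rewrite /= w'E mulN1r !mulNr mulrA.
Qed.

End tensor_sobolev.

(** * Exchange of mass on a finite product with all marginals preserved *)

Section swap.
Context (R : realFieldType) (K : finType) (n : nat).
Notation index := {ffun 'I_n.+1 -> K}.

(** A product of probability vectors has its factors as marginals. *)
Lemma sum_prod_fixed (F : 'I_n.+1 -> K -> R) i b :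
  (forall i', \sum_c F i' c = 1) ->
  \sum_(l : index | l i == b) \prod_i' F i' (l i') = F i b.
Proof.
move=> F1.
(* Erasing the values other than [b] at coordinate [i] turns the constrained sum into a full one,
   where distributivity applies. *)
pose G i' c := if (i' == i) && (c != b) then 0 else F i' c.
transitivity (\sum_(l : index) \prod_i' G i' (l i')).
  rewrite [RHS](bigID (fun l : index => l i == b))/= [X in _ + X]big1 ?addr0.
    apply: eq_bigr => l lb; apply: eq_bigr => i' _; rewrite /G.
    by case: eqP => //= ->; rewrite lb.
  by move=> l lb; rewrite (bigD1 i)//= /G eqxx lb/= mul0r.
rewrite -(bigA_distr_bigA G) (bigD1 i)//= [X in _ * X]big1 ?mulr1.
  rewrite (bigD1 b)//= /G !eqxx/= [X in _ + X]big1 ?addr0// => c cb.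
  by rewrite cb.
by move=> i' i'i; rewrite -(F1 i'); apply: eq_bigr => c _; rewrite /G (negbTE i'i).
Qed.

Variables (M : nat) (p : index -> R) (D : pred index) (S : 'I_M -> pred index)
  (a : index -> 'I_n.+1 -> 'I_M) (eta kappa : R).
Hypotheses (p0 : forall k, 0 <= p k) (SD : forall e k, S e k -> ~~ D k)
  (kappa0 : 0 < kappa) (Skappa : forall e, kappa <= \sum_(k | S e k) p k)
  (Deta : \sum_(k | D k) p k <= eta) (etakappa : n.+1%:R * eta <= kappa).

Let mass e := \sum_(k | S e k) p k.

Let mass_gt0 e : 0 < mass e. Proof. exact: lt_le_trans (Skappa e). Qed.

(** The [i]-th marginal of the [j]-th ingredient of the exchange for [k]: the Dirac mass at [k] for
    j = 0, otherwise [p] conditioned on the reservoir [S (a k j)]. *)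
Let piece (k : index) (j i : 'I_n.+1) (b : K) : R :=
  if j == ord0 then (k i == b)%:R
  else (\sum_(r | S (a k j) r && (r i == b)) p r) / mass (a k j).

Let piece_ge0 k j i b : 0 <= piece k j i b.
Proof.
rewrite /piece; case: ifP => // _.
by rewrite divr_ge0 ?sumr_ge0// ltW.
Qed.

Let sum_piece k j i : \sum_b piece k j i b = 1.
Proof.
rewrite /piece; case: (j == ord0).
  rewrite (bigD1 (k i))//= eqxx big1 ?addr0// => b.
  by rewrite eq_sym => /negbTE ->.
rewrite -mulr_suml -(partition_big (fun r : index => r i) predT)//.
by rewrite mulfV// gt_eqF// mass_gt0.
Qed.

(** For each bad [k] and each cyclic shift [s], a product law of mass [p k] whose coordinate [i]
    comes from ingredient [i + s], the addition being modulo the number of coordinates. [used] below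
    is the mass drawn from the reservoirs to pay for this. *)
Let new (l : index) : R :=
  \sum_(k | D k) p k * \sum_(s : 'I_n.+1) \prod_i piece k (i + s) i (l i).

Let used (l : index) : R :=
  \sum_(k | D k) p k * \sum_(j : 'I_n.+1 | j != ord0)
    (if S (a k j) l then p l / mass (a k j) else 0).

Let kept (l : index) : R := if D l then 0 else p l - used l.

Let used_ge0 l : 0 <= used l.
Proof.
apply: sumr_ge0 => k _; apply: mulr_ge0 => //; apply: sumr_ge0 => j _.
by case: ifP => // _; rewrite divr_ge0// ltW.
Qed.

(** Bad indices have total mass at most [eta], each draws on fewer than [n.+1] reservoirs, and each
    reservoir has mass at least [kappa]; thus at most the fraction (n+1) eta / kappa <= 1 of [p l]
    is drawn. *)
Let used_le l : used l <= p l.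
Proof.
have cst_le (k : index) : \sum_(j : 'I_n.+1 | j != ord0)
    (if S (a k j) l then p l / mass (a k j) else 0) <= n.+1%:R * (p l / kappa).
  rewrite mulr_natl -[n.+1 in leRHS]card_ord -sumr_const big_mkcond/=.
  apply: ler_sum => j _; case: ifP => _; last by rewrite divr_ge0// ltW.
  case: ifP => _; last by rewrite divr_ge0// ltW.
  by rewrite ler_wpM2l// lef_pV2 ?posrE ?mass_gt0 ?Skappa.
rewrite (@le_trans _ _ (\sum_(k | D k) p k * (n.+1%:R * (p l / kappa))))//.
  by apply: ler_sum => k _; rewrite ler_wpM2l.
rewrite -mulr_suml (@le_trans _ _ (eta * (n.+1%:R * (p l / kappa))))//.
  by rewrite ler_wpM2r// mulr_ge0// divr_ge0// ltW.
rewrite (_ : eta * _ = (n.+1%:R * eta / kappa) * p l); last by ring.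
by rewrite ler_piMl// ler_pdivrMr// mul1r.
Qed.

(** For fixed [i] the shift [s] runs [i + s] through every ingredient exactly once. *)
Let marginal_new i b : \sum_(l : index | l i == b) new l =
  \sum_(k | D k) p k * \sum_j piece k j i b.
Proof.
rewrite /new exchange_big/=; apply: eq_bigr => k _.
rewrite -mulr_sumr exchange_big/=; congr (_ * _).
rewrite [RHS](reindex_inj (addrI i))/=; apply: eq_bigr => s _.
exact: (sum_prod_fixed (F := fun i' => piece k (i' + s) i')).
Qed.

(** No reservoir meets the bad set, so what is drawn is exactly the ingredients with nonzero [j]. *)
Let marginal_kept i b : \sum_(l : index | l i == b) kept l =
  \sum_(l : index | (l i == b) && ~~ D l) p l -
  \sum_(k | D k) p k * \sum_(j | j != ord0) piece k j i b.
Proof.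
transitivity (\sum_(l : index | (l i == b) && ~~ D l) (p l - used l)).
  rewrite big_mkcondr/=; apply: eq_bigr => l _; rewrite /kept.
  by case: (D l).
rewrite sumrB; congr (_ - _); rewrite /used exchange_big/=.
apply: eq_bigr => k _; rewrite -mulr_sumr exchange_big/=; congr (_ * _).
apply: eq_bigr => j j0; rewrite /piece (negbTE j0) mulr_suml -big_mkcondr/=.
apply: eq_bigl => l; case Sl: (S _ l); last by rewrite andbF.
by rewrite (SD Sl) !andbT.
Qed.

(** What [kept] loses, the bad indices and the ingredients drawn from reservoirs, returns coordinate
    by coordinate in [new]. The fourth clause records where the coordinates of a new index come
    from; it is what bounds the new energy. *)
Lemma swap_plan : exists kept new : index -> R,
  [/\ forall l, 0 <= kept l <= (if D l then 0 else p l),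
      forall l, 0 <= new l,
      \sum_l new l <= n.+1%:R * eta,
      forall l, new l != 0 -> exists k (s : 'I_n.+1), D k /\
        forall i, if i + s == ord0 then l i = k i
                  else exists2 r, S (a k (i + s)) r & r i = l i &
      forall i b, \sum_(l : index | l i == b) (kept l + new l) =
                  \sum_(l : index | l i == b) p l].
Proof.
exists kept, new; split.
- move=> l; rewrite /kept; case: (D l); first by rewrite lexx.
  by rewrite subr_ge0 used_le lerBlDr lerDl used_ge0.
- move=> l; apply: sumr_ge0 => k _; apply: mulr_ge0 => //.
  by apply: sumr_ge0 => s _; apply: prodr_ge0 => i _; exact: piece_ge0.
- rewrite /new exchange_big/= (@le_trans _ _ (\sum_(k | D k) p k * n.+1%:R))//.
    apply: ler_sum => k _; rewrite -mulr_sumr exchange_big/= ler_wpM2l//.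
    rewrite (eq_bigr (fun=> 1)) ?sumr_const ?card_ord// => s _.
    rewrite -(bigA_distr_bigA (fun i c => piece k (i + s) i c))/=.
    by rewrite big1.
  by rewrite -mulr_suml mulrC ler_wpM2l.
- move=> l lnew.
  have [k Dk] : exists2 k, D k &
      p k * (\sum_(s : 'I_n.+1) \prod_i piece k (i + s) i (l i)) != 0.
    apply/exists_inP; apply: contraNT lnew => /exists_inPn nl.
    by apply/eqP; apply: big1 => k Dk; have /negPn/eqP := nl k Dk.
  rewrite mulf_eq0 negb_or => /andP[_ sk].
  have [s sk'] : exists s : 'I_n.+1, \prod_i piece k (i + s) i (l i) != 0.
    apply/existsP; apply: contraNT sk => /existsPn nl.
    by apply/eqP; apply: big1 => s _; have /negPn/eqP := nl s.
  exists k, s; split => // i; move/prodf_neq0/(_ i isT): sk'.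
  rewrite /piece; case: ifP => _.
    by case: (k i =P l i) => [->//|_]; rewrite eqxx.
  rewrite mulf_eq0 negb_or => /andP[rk _].
  have [r /andP[Sr ri] _] : exists2 r, S (a k (i + s)) r && (r i == l i) & p r != 0.
    apply/exists_inP; apply: contraNT rk => /exists_inPn nl.
    by apply/eqP; apply: big1 => r Dr; have /negPn/eqP := nl r Dr.
  by exists r => //; exact/eqP.
- move=> i b; rewrite big_split/= marginal_new marginal_kept.
  have -> : \sum_(k | D k) p k * \sum_j piece k j i b =
      \sum_(k | D k) p k * (k i == b)%:R +
      \sum_(k | D k) p k * \sum_(j | j != ord0) piece k j i b.
    rewrite -big_split/=; apply: eq_bigr => k _.
    by rewrite -mulrDr (bigD1 ord0)//= {1}/piece eqxx.
  rewrite addrACA addNr addr0 [RHS](bigID (fun l => ~~ D l))/=; congr (_ + _).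
  rewrite [RHS]big_mkcondl/=; apply: eq_big => [k|k _].
    by rewrite negbK.
  by case: eqP => _; rewrite ?mulr1 ?mulr0.
Qed.

End swap.

(** * The Coulomb interaction: perturbation, symmetry, measurability *)

Section coulomb.
Context (R : realType) (d : nat).
Implicit Types (u v x y : 'rV[R]_d).

Lemma coord_le_euclid v j : `|v 0 j| <= euclid v.
Proof.
rewrite -sqrtr_sqr ler_wsqrtr// (bigD1 j)//= lerDl.
by apply: sumr_ge0 => k _; exact: sqr_ge0.
Qed.

Lemma norm_le_euclid v : `|v| <= euclid v.
Proof.
rewrite [leLHS]/Num.norm/= mx_normrE; apply/bigmax_leP.
split; first exact: sqrtr_ge0.
by move=> [i j] _ /=; rewrite (ord1 i); exact: coord_le_euclid.
Qed.

Lemma euclid_eq0 v : (euclid v == 0) = (v == 0).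
Proof.
apply/idP/eqP => [/eqP v0|->].
  apply/rowP => j; rewrite mxE; apply/eqP; rewrite -normr_le0 -v0.
  exact: coord_le_euclid.
by rewrite /euclid big1 ?sqrtr0// => j _; rewrite mxE expr0n.
Qed.

(** With E the length of [x], each y_j^2 is at most x_j^2 + 2Et + t^2; summing gives at most (E +
    dt)^2. *)
Lemma euclid_perturb (t : R) x y : 0 <= t -> (forall j, `|y 0 j - x 0 j| <= t) ->
  euclid y <= euclid x + d%:R * t.
Proof.
move=> t0 yx; set E := euclid x.
have E0 : 0 <= E by exact: sqrtr_ge0.
have EE : E ^+ 2 = \sum_j x 0 j ^+ 2.
  by rewrite sqr_sqrtr// sumr_ge0// => j _; exact: sqr_ge0.
have Edt : 0 <= E + d%:R * t by rewrite addr_ge0// mulr_ge0.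
rewrite -(ger0_norm Edt) -sqrtr_sqr ler_wsqrtr//.
have key j : y 0 j ^+ 2 <= x 0 j ^+ 2 + (2 * E * t + t ^+ 2).
  have := yx j; have := coord_le_euclid x j; rewrite -/E.
  rewrite !ler_norml => /andP[xE1 xE2] /andP[yx1 yx2].
  have : (y 0 j - x 0 j) ^+ 2 <= t ^+ 2.
    by rewrite -real_normK ?num_real// ler_sqr ?nnegrE// yx.
  have xE : x 0 j * (y 0 j - x 0 j) <= E * t.
    rewrite (le_trans (ler_norm _))// normrM ler_pM// ?yx//.
    by rewrite ler_norml xE1 xE2.
  by move=> h; rewrite -[y 0 j](subrK (x 0 j)) sqrrD; lra.
apply: (le_trans (ler_sum _ (fun j _ => key j))).
rewrite big_split/= -EE sumr_const card_ord -mulr_natl sqrrD.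
case: (d) => [|d']; first by rewrite !mul0r expr0n/= mulr0 mul0rn !addr0.
have d1 : 1 <= d'.+1%:R :> R by rewrite ler1n.
have : d'.+1%:R * t ^+ 2 <= (d'.+1%:R * t) ^+ 2.
  by rewrite exprMn ler_wpM2r ?sqr_ge0// expr2 ler_peMl.
by move=> h; lra.
Qed.

Lemma continuous_euclid : continuous (@euclid R d).
Proof.
move=> v; apply: (@continuous_comp _ _ _ (fun v : 'rV[R]_d => \sum_j v 0 j ^+ 2) Num.sqrt);
  last exact: sqrt_continuous.
apply: differentiable_continuous.
rewrite (_ : (fun v => _) = \sum_(j < d) (fun v : 'rV[R]_d => v 0 j ^+ 2)).
  apply: differentiable_sum => j.
  exact: (differentiableM (differentiable_coord v 0 j) (differentiable_coord v 0 j)).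
by apply/funext => u; rewrite fct_sumE.
Qed.

Lemma coulomb_ge0 x y : (0 <= coulomb x y)%E.
Proof.
by rewrite /coulomb; case: ifP => // _; rewrite lee_fin invr_ge0 sqrtr_ge0.
Qed.

Lemma coulombC x y : coulomb x y = coulomb y x.
Proof.
rewrite /coulomb eq_sym; congr (if _ then _ else (_^-1)%:E).
congr Num.sqrt; apply: eq_bigr => j _; rewrite !mxE -sqrrN; congr (_ ^+ 2).
by rewrite opprB.
Qed.

Lemma coulomb_le (b : R) x y : 0 < b -> b <= `|x - y| -> (coulomb x y <= b^-1%:E)%E.
Proof.
move=> b0 bxy; rewrite /coulomb; case: eqP => [xy|_].
  by move: bxy; rewrite xy subrr normr0 leNgt b0.
rewrite lee_fin lef_pV2 ?posrE//; first exact: le_trans (norm_le_euclid _).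
exact: lt_le_trans (lt_le_trans b0 bxy) (norm_le_euclid _).
Qed.

(** The length of x' - y' is at most that of x - y plus 2dt, hence at most 1 + e times it. If x' =
    y' the right side is infinite. *)
Lemma coulomb_perturb (b t e : R) x y x' y' : 0 < b -> 0 <= t -> 0 <= e ->
  2 * (d%:R * t) <= e * b -> b <= `|x - y| ->
  (forall j, `|x' 0 j - x 0 j| <= t) -> (forall j, `|y' 0 j - y 0 j| <= t) ->
  (coulomb x y <= (1 + e)%:E * coulomb x' y')%E.
Proof.
move=> b0 t0 e0 dte bxy xx yy.
have e1 : 0 < 1 + e by rewrite ltr_wpDr.
have bE : b <= euclid (x - y) by exact: le_trans (norm_le_euclid _).
have xyE : 0 < euclid (x - y) by exact: lt_le_trans bE.
rewrite {2}/coulomb; case: eqP => [xy|/eqP xy].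
  by rewrite gt0_muley ?lte_fin// leey.
rewrite /coulomb; case: eqP => [xy'|_].
  by move: xyE; rewrite xy' subrr lt_neqAle eq_sym euclid_eq0 eqxx.
have E' : 0 < euclid (x' - y').
  by rewrite lt_neqAle eq_sym euclid_eq0 subr_eq0 xy sqrtr_ge0.
rewrite -EFinM lee_fin -ler_pdivrMl//.
rewrite -invfM lef_pV2 ?posrE ?mulr_gt0//.
rewrite (@le_trans _ _ (euclid (x - y) + d%:R * (2 * t)))//.
  apply: euclid_perturb => [|j]; first by rewrite mulr_ge0.
  rewrite !mxE (_ : _ - _ = (x' 0 j - x 0 j) - (y' 0 j - y 0 j)); last by ring.
  by rewrite (le_trans (ler_normB _ _))// mulr2n mulrDl mul1r lerD.
have : e * b <= e * euclid (x - y) by rewrite ler_wpM2l.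
by move: dte => h1 h2; lra.
Qed.

End coulomb.

Section energy.
Context (R : realType) (d n : nat).
Implicit Types (x : 'M[R]_(n, d)).
Local Open Scope ereal_scope.

Definition energy x : \bar R :=
  \sum_(i < n) \sum_(j < n | (i < j)%N) coulomb (row i x) (row j x).

Lemma energy_ge0 x : 0 <= energy x.
Proof. by apply: sume_ge0 => i _; apply: sume_ge0 => j _; exact: coulomb_ge0. Qed.

(** Doubling replaces ordered indices i < j by all pairs of distinct ones, a form visibly stable
    under permutations. *)
Lemma energyD x : energy x + energy x =
  \sum_(i < n) \sum_(j < n | j != i) coulomb (row i x) (row j x).
Proof.
have -> : energy x + energy x = \sum_(i < n) \sum_(j < n | (i < j)%N) coulomb (row i x) (row j x) +
    \sum_(i < n) \sum_(j < n | (j < i)%N) coulomb (row i x) (row j x).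
  congr (_ + _); rewrite /energy.
  under eq_bigr do rewrite big_mkcond/=.
  rewrite exchange_big/=; apply: eq_bigr => i _; rewrite -big_mkcond/=.
  by apply: eq_bigr => j _; exact: coulombC.
rewrite -big_split/=; apply: eq_bigr => i _.
rewrite [RHS](bigID (fun j : 'I_n => (i < j)%N))/=; congr (_ + _);
  by apply: eq_bigl => j; rewrite -(inj_eq val_inj)/=; case: ltngtP.
Qed.

Lemma energy_row_perm (s : 'S_n) x : energy (row_perm s x) = energy x.
Proof.
have : energy (row_perm s x) + energy (row_perm s x) = energy x + energy x.
  rewrite !energyD [RHS](reindex_perm s)/=; apply: eq_bigr => i _.
  rewrite [RHS](reindex_perm s)/=; apply: eq_big => [j|j _].
    by rewrite (inj_eq perm_inj).
  by congr coulomb; apply/rowP => k; rewrite !mxE.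
(* Halving an equality of extended reals: the two sides are nonnegative, and are real or infinite
   together. *)
have := energy_ge0 x; have := energy_ge0 (row_perm s x).
case: (energy x) => [a| |]; case: (energy _) => [b| |]//= _ _.
move=> /eqP; rewrite -!EFinD eqe -!mulr2n => /eqP h; congr EFin.
by apply: (mulIf (_ : 2%:R != 0 :> R)%R); rewrite ?pnatr_eq0// !mulr_natr.
Qed.

Lemma continuous_row_sub (i j : 'I_n) :
  continuous (fun x : 'M[R]_(n, d) => row i x - row j x)%R.
Proof.
move=> x; apply: (@continuous_mx R 1 d _ (fun x : 'M[R]_(n, d) => row i x - row j x)%R).
move=> k l {}x; under eq_fun do rewrite !mxE.
exact: (continuousB (@coord_continuous R n d i l x) (@coord_continuous R n d j l x)).
Qed.

Lemma measurable_coulomb_row i j :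
  measurable_fun setT (fun x : 'M[R]_(n, d) => coulomb (row i x) (row j x)).
Proof.
pose r (x : 'M[R]_(n, d)) := euclid (row i x - row j x)%R.
have mr : measurable_fun setT r.
  apply: continuous_measurable_mx => x.
  exact: (continuous_comp (@continuous_row_sub i j x) (@continuous_euclid R d _)).
rewrite (_ : (fun x => _) = (fun x => if r x == 0%R then +oo else (r x `^ (-1))%R%:E)).
  apply: measurable_fun_ifT => //; first exact: measurable_fun_eqr.
  apply/measurable_EFinP.
  exact: (measurableT_comp (measurable_powR (-1)%R) mr).
apply/funext => x; rewrite /coulomb /r euclid_eq0 subr_eq0.
by case: eqP => // _; rewrite powR_inv1// sqrtr_ge0.
Qed.

Lemma measurable_energy : measurable_fun setT energy.
Proof.
apply: emeasurable_sum => i.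
rewrite (_ : (fun x => _) = (fun x => \sum_(j < n)
  if (i < j)%N then coulomb (row i x) (row j x) else 0)).
  apply: emeasurable_sum => j; case: (i < j)%N => //.
  exact: measurable_coulomb_row.
by apply/funext => x; rewrite big_mkcond.
Qed.

Lemma energy_le (b : R) x : (0 < b)%R ->
  (forall i j : 'I_n, i != j -> b <= `|row i x - row j x|)%R ->
  energy x <= (n%:R * (n%:R * b^-1))%:E.
Proof.
move=> b0 bx.
have inner (i : 'I_n) : \sum_(j < n | (i < j)%N) coulomb (row i x) (row j x) <=
    (n%:R * b^-1)%:E.
  rewrite big_mkcond/= (@le_trans _ _ (\sum_(j < n) (b^-1)%:E))//.
    apply: lee_sum => j _; case: ifP => ij; last by rewrite lee_fin invr_ge0 ltW.
    by apply: coulomb_le => //; apply: bx; rewrite neq_ltn ij.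
  by rewrite sumEFin sumr_const card_ord mulr_natl.
rewrite (@le_trans _ _ (\sum_(i < n) (n%:R * b^-1)%:E))//.
  by apply: lee_sum => i _; exact: inner.
by rewrite sumEFin sumr_const card_ord lee_fin -[leLHS]mulr_natl.
Qed.

Lemma energy_perturb (b t e : R) (x y : 'M[R]_(n, d)) : (0 < b)%R -> (0 <= t)%R -> (0 <= e)%R ->
  (2 * (d%:R * t) <= e * b)%R ->
  (forall i j : 'I_n, i != j -> b <= `|row i x - row j x|)%R ->
  (forall i j, `|y i j - x i j| <= t)%R ->
  energy x <= (1 + e)%:E * energy y.
Proof.
move=> b0 t0 e0 dte bx yx.
rewrite /energy ge0_sume_distrr; last first.
  by move=> i _; apply: sume_ge0 => j _; exact: coulomb_ge0.
apply: lee_sum => i _; rewrite ge0_sume_distrr; last first.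
  by move=> j _; exact: coulomb_ge0.
apply: lee_sum => j ij; apply: (@coulomb_perturb _ _ b t e) => //.
- by apply: bx; rewrite neq_ltn ij.
- by move=> k; rewrite !mxE.
- by move=> k; rewrite !mxE.
Qed.

End energy.

(** * From a wave function to a coupling *)

Lemma normsq_ge0 (R : realType) (z : R[i]) : 0 <= normsq z.
Proof. by rewrite addr_ge0 ?sqr_ge0. Qed.

Lemma V_eeE (R : realType) (d n : nat) (psi : wave_function R d n) :
  (V_ee psi = \sum_(alpha : {ffun 'I_n -> 'I_2})
    \int[lebesgue_mx]_x ((normsq (psi (config x alpha)))%:E * energy x))%E.
Proof.
apply: eq_bigr => alpha _; apply: eq_integral => x _.
rewrite /energy ge0_sume_distrr; last first.
  by move=> i _; apply: sume_ge0 => j _; exact: coulomb_ge0.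
apply: eq_bigr => i _; rewrite ge0_sume_distrr// => j _.
exact: coulomb_ge0.
Qed.

Section wave_coupling.
Context (R : realType) (d n : nat) (rho : 'rV[R]_d -> R)
  (psi : wave_function R d n.+1) (bpsi : bosonic psi)
  (dpsi : has_wave_density psi rho) (mrho : measurable_fun setT rho)
  (rho0 : forall x, 0 <= rho x).
Local Open Scope ereal_scope.
Notation mu := lebesgue_mx.

Let f alpha (x : 'M[R]_(n.+1, d)) : R := normsq (psi (config x alpha)).
Let F x : R := (\sum_(alpha : {ffun 'I_n.+1 -> 'I_2}) f alpha x)%R.

Let f0 alpha x : (0 <= f alpha x)%R. Proof. exact: normsq_ge0. Qed.

Let F0 x : (0 <= F x)%R. Proof. by apply: sumr_ge0 => alpha _; exact: f0. Qed.

Let mf alpha : measurable_fun setT (f alpha).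
Proof.
have [H1 _ _] := bpsi; have [[/Lfun2P[mre _] _] [/Lfun2P[mim _] _]] := H1 alpha.
by apply: measurable_funD; apply: measurable_funX.
Qed.

Let mF : measurable_fun setT F.
Proof. by apply: measurable_sum => alpha; exact: mf. Qed.

Let F1 : \int[mu]_x (F x)%:E = 1.
Proof.
have [_ <- _] := bpsi; rewrite /int_config -ge0_integral_sum//; last 2 first.
- by move=> alpha; apply/measurable_EFinP; exact: mf.
- by move=> alpha x _; rewrite lee_fin f0.
by apply: eq_integral => x _; rewrite sumEFin.
Qed.

Let P : probability 'M[R]_(n.+1, d) R :=
  HB.pack_for (probability 'M[R]_(n.+1, d) R) (dens_of mu F0 mF)
    (Measure_isProbability.Build _ _ _ (dens_of mu F0 mF) F1).

(** The symmetry of [psi] permutes positions and spins together; summing over the spins absorbs the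
    permutation of [alpha]. *)
Let Fperm (s : 'S_n.+1) : {ae @lebesgue_mx R n.+1 d, forall x, F (row_perm s x) = F x}.
Proof.
have [_ _ sym] := bpsi.
have : {ae @lebesgue_mx R n.+1 d, forall x, forall alpha : {ffun 'I_n.+1 -> 'I_2},
    psi (config x alpha \o s) = psi (config x alpha)}.
  by apply: filter_forall => alpha; exact: sym.
apply: filterS => x xs; rewrite /F.
pose g (alpha : {ffun 'I_n.+1 -> 'I_2}) := [ffun i => alpha (s i)].
pose h (alpha : {ffun 'I_n.+1 -> 'I_2}) := [ffun i => alpha (s^-1 i)%g].
rewrite (reindex g)/=; last first.
  exists h => alpha _; apply/ffunP => i; rewrite !ffunE ?permK ?permKV//.
apply: eq_bigr => alpha _; rewrite /f -xs; congr (normsq (psi _)).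
apply/funext => i; rewrite /config /= ffunE; congr pair.
by apply/rowP => j; rewrite !mxE.
Qed.

(** The coupling has density [F]. Its first marginal is [rho] by the density condition, the others
    by symmetry. *)
Lemma coupling_of_wave : exists2 P : probability 'M[R]_(n.+1, d) R,
  couplings rho P & coulomb_cost P = V_ee psi.
Proof.
exists P.
  move=> i A mA; rewrite /pushforward [LHS]/=.
  rewrite /dens_of integral_mkcond.
  have m1A : measurable_fun setT (\1_A : 'rV[R]_d -> R) by exact: measurable_indic.
  pose G i x := ((\1_A (row i x))%:E * (F x)%:E).
  have mG j : measurable_fun setT (G j).
    apply: emeasurable_funM; last exact/measurable_EFinP.
    apply/measurable_EFinP.
    exact: (measurableT_comp m1A (@measurable_row R n.+1 d j)).
  have G0 j x : 0 <= G j x by rewrite mule_ge0// lee_fin.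
  transitivity (\int[mu]_x G i x).
    apply: eq_integral => x _; rewrite patchE /G indicE.
    have -> : (row i x \in A) = (x \in row i @^-1` A) by apply/idP/idP; rewrite !inE.
    by case: ifP; rewrite ?mul1e ?mul0e.
  (* Exchanging rows [i] and [ord0] preserves Lebesgue measure and, almost everywhere, [F]; this
     reduces marginal [i] to the first. *)
  pose s := tperm i ord0.
  rewrite -(ge0_integral_row_perm s (mG i) (G0 i)).
  transitivity (\int[mu]_x G ord0 x).
    apply: ge0_ae_eq_integral => //.
      by apply: measurableT_comp => //; exact: measurable_row_perm.
    apply: filterS (Fperm s) => x Fx _; rewrite /G Fx; congr ((\1_A _)%:E * _).
    by apply/rowP => j; rewrite !mxE /s tpermL.
  rewrite (ge0_integral_insert_row ord0 (mG _) (G0 _)) [RHS]integral_mkcond.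
  have GE x : \int[mu]_y G ord0 (insert_row ord0 (x, y)) = (\1_A x)%:E * density psi x.
    have mfx alpha : measurable_fun setT (fun y : 'M[R]_(n, d) =>
        (f alpha (insert_row ord0 (x, y)))%:E).
      apply/measurable_EFinP; apply: (measurableT_comp (mf alpha)).
      by apply: measurableT_comp => //; exact: measurable_insert_row.
    have -> : density psi x = \int[mu]_y (F (insert_row ord0 (x, y)))%:E.
      rewrite /density -ge0_integral_sum//; last 2 first.
      - by move=> alpha; under eq_fun do rewrite col_mxE_insert_row; exact: mfx.
      - by move=> alpha y _; rewrite lee_fin normsq_ge0.
      apply: eq_integral => y _; rewrite sumEFin; congr EFin.
      by apply: eq_bigr => alpha _; rewrite col_mxE_insert_row.
    rewrite -ge0_integralZl//; last 2 first.
    - apply/measurable_EFinP; apply: measurable_sum => alpha.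
      by apply/measurable_EFinP; exact: mfx.
    - by move=> y _; rewrite lee_fin.
    by apply: eq_integral => y _; rewrite /G row_insert_row.
  apply: ge0_ae_eq_integral => //.
  - apply: (measurable_fun_fubini_tonelli_F (m2 := mu)
      (G ord0 \o insert_row ord0)) => [|p]; last exact: G0.
    by apply: measurableT_comp => //; exact: measurable_insert_row.
  - apply: (measurable_restrictT _ _).1 => //.
    by apply: measurable_funTS; exact/measurable_EFinP.
  - by move=> x _; apply: integral_ge0 => y _; exact: G0.
  - by move=> x _; rewrite patchE; case: ifP; rewrite ?lee_fin.
  apply: filterS dpsi => x dx _; rewrite GE dx patchE indicE.
  by case: ifP; rewrite ?mul1e ?mul0e.
have -> : coulomb_cost P = \int[P]_x energy x by [].
rewrite (ge0_integral_density (mu := mu) mF F0)//; last 2 first.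
- exact: measurable_energy.
- exact: energy_ge0.
rewrite V_eeE -ge0_integral_sum//; last 2 first.
- move=> alpha; apply: emeasurable_funM; last exact: measurable_energy.
  by apply/measurable_EFinP; exact: (mf alpha).
- by move=> alpha x _; rewrite mule_ge0 ?energy_ge0// lee_fin normsq_ge0.
apply: eq_integral => x _; rewrite muleC /F -sumEFin ge0_sume_distrl//.
by move=> alpha _; rewrite lee_fin.
Qed.

End wave_coupling.

(** * Square-integrable weak derivatives and finite kinetic energy *)

Section H1.
Context (R : realType) (m n : nat).
Implicit Types (u v g : 'M[R]_(m, n) -> R).
Local Notation L2 := (Lfun (@lebesgue_mx R m n) 2%:E).

Lemma Lfun2_le u v : measurable_fun setT u -> (forall x, `|u x| <= `|v x|) ->
  v \in L2 -> u \in L2.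
Proof.
move=> mu uv /Lfun2P[mv v2]; apply/Lfun2P; split => //.
apply: le_lt_trans v2; apply: ge0_le_integral => //.
- by move=> x _; rewrite lee_fin sqr_ge0.
- by apply/measurable_EFinP; exact: measurable_funX.
- by apply/measurable_EFinP; exact: measurable_funX.
- by move=> x _; rewrite lee_fin -[leLHS]real_normK ?num_real// -[leRHS]real_normK ?num_real// ler_sqr ?nnegrE.
Qed.

Lemma Lfun2_mulr (s : 'M[R]_(m, n) -> R) (C : R) u : measurable_fun setT s ->
  (forall x, `|s x| <= C) -> u \in L2 -> (fun x => s x * u x) \in L2.
Proof.
move=> ms sC /Lfun2P[mu u2].
have C0 : 0 <= C by exact: le_trans (sC 0).
apply: (@Lfun2_le _ (fun x => C * u x)).
- exact: measurable_funM.
- by move=> x; rewrite !normrM ler_wpM2r// (ger0_norm C0).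
- apply/Lfun2P; split; first exact: measurable_funM.
  under eq_integral do rewrite exprMn EFinM.
  rewrite ge0_integralZl//.
  + by rewrite lte_mul_pinfty// lee_fin sqr_ge0.
  + by apply/measurable_EFinP; exact: measurable_funX.
  + by move=> x _; rewrite lee_fin sqr_ge0.
  + by rewrite lee_fin sqr_ge0.
Qed.

Lemma Lfun2_ae u v : measurable_fun setT u ->
  {ae @lebesgue_mx R m n, forall x, u x = v x} -> v \in L2 -> u \in L2.
Proof.
move=> mu uv /Lfun2P[mv v2]; apply/Lfun2P; split => //.
rewrite (ge0_ae_eq_integral (g := fun x => (v x ^+ 2)%:E))//.
- by apply/measurable_EFinP; exact: measurable_funX.
- by apply/measurable_EFinP; exact: measurable_funX.
- by move=> x _; rewrite lee_fin sqr_ge0.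
- by move=> x _; rewrite lee_fin sqr_ge0.
- by apply: filterS uv => x -> _.
Qed.

Lemma Lfun2D u v : u \in L2 -> v \in L2 -> (fun x => u x + v x) \in L2.
Proof.
move=> /Lfun2P[mu u2] /Lfun2P[mv v2].
have m2 (w : 'M[R]_(m, n) -> R) : measurable_fun setT w ->
    measurable_fun setT (fun x => (w x ^+ 2)%:E).
  by move=> mw; apply/measurable_EFinP; exact: measurable_funX.
apply/Lfun2P; split; first exact: measurable_funD.
apply: (@le_lt_trans _ _ (\int[lebesgue_mx]_x
    (2%:E * ((u x ^+ 2)%:E + (v x ^+ 2)%:E)))%E).
  apply: ge0_le_integral => //.
  - by move=> x _; rewrite lee_fin sqr_ge0.
  - by apply: (m2 (fun x => u x + v x)); exact: measurable_funD.
  - by apply: measurable_funeM; apply: emeasurable_funD; exact: m2.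
  - move=> x _; rewrite -EFinD -EFinM lee_fin.
    by have := sqr_ge0 (u x - v x); rewrite sqrrB sqrrD; lra.
rewrite ge0_integralZl//; last 2 first.
- by apply: emeasurable_funD; exact: m2.
- by move=> x _; rewrite adde_ge0// lee_fin sqr_ge0.
rewrite lte_mul_pinfty// ge0_integralD//.
- exact: lte_add_pinfty.
- by move=> x _; rewrite lee_fin sqr_ge0.
- exact: m2.
- by move=> x _; rewrite lee_fin sqr_ge0.
- exact: m2.
Qed.

Lemma in_H1_weak_partial ij u : in_H1 u -> weak_partial ij u \in L2.
Proof.
move=> [_ /(_ ij)[g ug g2]].
have [lw _] : is_weak_partial ij u (weak_partial ij u).
  by apply: (@xgetPex _ (fun=> 0) [set g | is_weak_partial ij u g]); exists g.
by apply: Lfun2_ae (weak_partial_ae ug) g2; exact: locally_integrable_measurable.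
Qed.

Lemma in_H10 : in_H1 (cst 0 : 'M[R]_(m, n) -> R).
Proof.
have z2 : cst 0 \in L2.
  apply/Lfun2P; split => //.
  by rewrite integral0_eq// => x _; rewrite expr0n.
by split => // ij; exists (cst 0) => //; exact: is_weak_partial0.
Qed.

End H1.

(** This finiteness is what lets a small hbar make the kinetic energy of a fixed wave function
    negligible. *)
Lemma kinetic_lty (R : realType) (d n : nat) (psi : wave_function R d n) :
  in_H1_wave psi ->
  (\sum_(alpha : {ffun 'I_n -> 'I_2})
    \int[lebesgue_mx]_x (grad_normsq psi alpha x)%:E < +oo)%E.
Proof.
move=> psi1; apply: lte_sum_pinfty => alpha _.
have [/in_H1_weak_partial wre /in_H1_weak_partial wim] := psi1 alpha.
rewrite /grad_normsq; under eq_integral do rewrite -sumEFin.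
have mterm (ij : 'I_n * 'I_d) : measurable_fun setT (fun x =>
    (weak_partial ij (re_part psi alpha) x ^+ 2 +
     weak_partial ij (im_part psi alpha) x ^+ 2)%:E).
  have /Lfun2P[m1 _] := wre ij; have /Lfun2P[m2 _] := wim ij.
  by apply/measurable_EFinP; apply: measurable_funD; exact: measurable_funX.
rewrite ge0_integral_sum//; last first.
  by move=> ij x _; rewrite lee_fin addr_ge0 ?sqr_ge0.
apply: lte_sum_pinfty => ij _.
have /Lfun2P[m1 f1] := wre ij; have /Lfun2P[m2 f2] := wim ij.
under eq_integral do rewrite EFinD.
rewrite ge0_integralD//; first exact: lte_add_pinfty.
- by move=> x _; rewrite lee_fin sqr_ge0.
- by apply/measurable_EFinP; exact: measurable_funX.
- by move=> x _; rewrite lee_fin sqr_ge0.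
- by apply/measurable_EFinP; exact: measurable_funX.
Qed.

(** * The wave function of a symmetric plan on cells *)

Section plan_wave.
Context (R : realType) (d n : nat) (rho : 'rV[R]_d -> R) (hrho : in_H rho)
  (K : finType) (th : K -> 'rV[R]_d -> R)
  (tame_th : forall N i b, tame (fun x : 'M[R]_(N, d) => th b (row i x)))
  (sum_th : forall v, \sum_b th b v ^+ 2 = 1).
Notation mu := lebesgue_mx.
Notation index := {ffun 'I_n.+1 -> K}.

Lemma measurable_density : measurable_fun setT rho.
Proof.
have [r0 _ [/Lfun2P[ms _] _]] := hrho.
rewrite (_ : rho = (fun x => Num.sqrt (rho x) ^+ 2)); first exact: measurable_funX.
by apply/funext => x; rewrite sqr_sqrtr.
Qed.

Let rho0 x : 0 <= rho x. Proof. by have [] := hrho. Qed.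

Let mrho := measurable_density.

Lemma measurable_th b : measurable_fun setT (th b).
Proof.
apply: continuous_measurable_mx; apply: smooth_continuous.
rewrite (_ : th b = (fun x : 'rV[R]_d => th b (row 0 x))).
  exact: (tame_th 0 b).1.
by apply/funext => x; congr (th b _); apply/rowP => j; rewrite mxE.
Qed.

Lemma sqr_th_le1 b v : th b v ^+ 2 <= 1.
Proof.
rewrite -(sum_th v) (bigD1 b)//= lerDl.
by apply: sumr_ge0 => c _; exact: sqr_ge0.
Qed.

Definition cell_mass b : R := fine (\int[mu]_x (th b x ^+ 2 * rho x)%:E).

Let mthr b : measurable_fun setT (fun x => th b x ^+ 2 * rho x).
Proof. by apply: measurable_funM => //; apply: measurable_funX; exact: measurable_th. Qed.

Let thr0 b x : 0 <= th b x ^+ 2 * rho x.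
Proof. by rewrite mulr_ge0 ?sqr_ge0. Qed.

Lemma cell_massE b : (\int[mu]_x (th b x ^+ 2 * rho x)%:E = (cell_mass b)%:E)%E.
Proof.
rewrite fineK// ge0_fin_numE; last by apply: integral_ge0 => x _; rewrite lee_fin.
have [_ r1 _] := hrho; apply: (@le_lt_trans _ _ 1%E); last exact: ltry.
rewrite -r1; apply: ge0_le_integral => //.
- by move=> x _; rewrite lee_fin.
- exact/measurable_EFinP.
- exact/measurable_EFinP.
- by move=> x _; rewrite lee_fin ler_piMl// sqr_th_le1.
Qed.

Lemma cell_mass_ge0 b : 0 <= cell_mass b.
Proof. by rewrite -lee_fin -cell_massE integral_ge0// => x _; rewrite lee_fin. Qed.

Definition tensor_th (l : index) (x : 'M[R]_(n.+1, d)) : R :=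
  \prod_i th (l i) (row i x).

Lemma tame_tensor_th l : tame (tensor_th l).
Proof. by apply: tame_prod => i _; exact: tame_th. Qed.

Lemma sum_sqr_tensor_th x : \sum_l tensor_th l x ^+ 2 = 1.
Proof.
rewrite /tensor_th; under eq_bigr do rewrite -prodrXl.
rewrite -(bigA_distr_bigA (fun i b => th b (row i x) ^+ 2))/=.
by rewrite big1.
Qed.

Variables (p : index -> R) (p0 : forall l, 0 <= p l)
  (p_sym : forall (s : 'S_n.+1) (l : index), p [ffun i => l (s i)] = p l)
  (p_marg : forall i b, \sum_(l : index | l i == b) p l = cell_mass b).

(** Spreads the mass [p l] over a product of cells along the normalised densities theta^2 rho / cell
    mass. Where a cell mass is 0 the quotient is 0, consistently with [p_eq0]: such an index has no
    mass. *)
Definition plan_coef l : R := p l / \prod_i cell_mass (l i).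

Let coef0 l : 0 <= plan_coef l.
Proof. by rewrite divr_ge0// prodr_ge0// => i _; exact: cell_mass_ge0. Qed.

Let p_eq0 (l : index) i : cell_mass (l i) = 0 -> p l = 0.
Proof.
move=> m0; have := p_marg i (l i); rewrite m0 => /psumr_eq0P -> //.
Qed.

Definition plan_factor x : R := \sum_l plan_coef l * tensor_th l x ^+ 2.

Let g := plan_factor.

Let g0 x : 0 <= g x.
Proof. by apply: sumr_ge0 => l _; rewrite mulr_ge0 ?sqr_ge0. Qed.

Let tame_g : tame g.
Proof.
apply: tame_sum => l _; apply: tameM; first exact: tame_cst.
by apply: tameM; exact: tame_tensor_th.
Qed.

(** [g] is a sum of terms c t^2; the derivative of one is 2 (sqrt(c) t') (sqrt(c) t), where t' is
    bounded and sqrt(c) |t| is at most sqrt(g). *)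
Let partial_g : exists2 A, 0 <= A &
  forall ij x, `|partial ij g x| <= A * Num.sqrt (g x).
Proof.
have /choice[C tC] l := (tame_tensor_th l).2.
have C0 l : 0 <= C l by exact: le_trans (tC l 0).1.
exists (\sum_l 2 * Num.sqrt (plan_coef l) * C l).
  by apply: sumr_ge0 => l _; rewrite !mulr_ge0 ?sqrtr_ge0.
move=> ij x.
have dth l y : differentiable (tensor_th l) y by exact: smooth_diff (tame_tensor_th l).1 y.
have -> : partial ij g x = \sum_l plan_coef l *
    (partial ij (tensor_th l) x * tensor_th l x + tensor_th l x * partial ij (tensor_th l) x).
  have tterm l : tame (fun x => cst (plan_coef l) x * (tensor_th l x * tensor_th l x)).
    by apply: tameM; [exact: tame_cst|apply: tameM; exact: tame_tensor_th].
  rewrite /g /plan_factor (partial_sum _ _ tterm); apply: eq_bigr => l _.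
  rewrite partialM; [|exact: differentiable_cst|move=> y; exact: differentiableM].
  by rewrite partial_cst mul0r add0r partialM.
rewrite mulr_suml (le_trans (ler_norm_sum _ _ _))//; apply: ler_sum => l _.
have cg : Num.sqrt (plan_coef l) * `|tensor_th l x| <= Num.sqrt (g x).
  rewrite -sqrtr_sqr -sqrtrM// ler_wsqrtr// /g /plan_factor (bigD1 l)//= lerDl.
  by apply: sumr_ge0 => k _; rewrite mulr_ge0 ?sqr_ge0.
set a := partial ij _ x; set b := tensor_th l x in cg *; set s := Num.sqrt (plan_coef l) in cg *.
have s0 : 0 <= s by exact: sqrtr_ge0.
have -> : plan_coef l * (a * b + b * a) = 2 * (s * a) * (s * b).
  by rewrite -(sqr_sqrtr (coef0 l)) -/s; ring.
rewrite !normrM normr_nat (ger0_norm s0).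
have aC : s * `|a| <= s * C l by rewrite ler_wpM2l//; exact: (tC l x).2.
rewrite -[2 * s * C l]mulrA; apply: ler_pM => //; first by rewrite !mulr_ge0.
  by rewrite mulr_ge0.
by rewrite ler_wpM2l.
Qed.

Let f v := Num.sqrt (rho v).
Let w (x : 'M[R]_(n.+1, d)) := \prod_i f (row i x).

Definition plan_amplitude x : R := Num.sqrt (g x) * w x.

Let u := plan_amplitude.

Let f2 : f \in Lfun (@lebesgue_mx R 1 d) 2%:E.
Proof. by have [_ _ []] := hrho. Qed.

Let w2 : w \in Lfun (@lebesgue_mx R n.+1 d) 2%:E.
Proof. by apply: (Lfun2_tensor (h := fun=> f)). Qed.

Let msg : measurable_fun setT (fun x => Num.sqrt (g x)).
Proof.
apply: continuous_measurable_mx => x.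
exact: (continuous_comp (smooth_continuous tame_g.1 (x := x)) (@sqrt_continuous R _)).
Qed.

Let sg_bounded : exists C, forall x, `|Num.sqrt (g x)| <= C.
Proof.
have [C gC] := tame_g.2; exists (Num.sqrt C) => x.
rewrite ger0_norm ?sqrtr_ge0// ler_wsqrtr//.
exact: le_trans (ler_norm _) (gC x).1.
Qed.

Let u_H1 : in_H1 u.
Proof.
have [C sgC] := sg_bounded; split; first exact: Lfun2_mulr msg sgC w2.
move=> [i j]; have [A A0 gA] := partial_g.
have [_ _ [_ /(_ (ord0, j))[v fv v2]]] := hrho.
have wv := is_weak_partial_tensor i f2 v2 fv.
pose w' (x : 'M[R]_(n.+1, d)) := \prod_l (if l == i then v else f) (row l x).
have w'2 : w' \in Lfun (@lebesgue_mx R n.+1 d) 2%:E.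
  by apply: (Lfun2_tensor (h := fun l => if l == i then v else f)) => l; case: ifP.
have uv := is_weak_partial_sqrt A0 tame_g g0 (gA (i, j))
  (Lfun2_locally_integrable w2) wv.
eexists; first exact: uv.
have t1 := Lfun2_mulr msg sgC w'2.
have m1 : measurable_fun setT (fun x => Num.sqrt (g x) * w' x).
  by have /Lfun2P[] := t1.
apply: Lfun2D => //.
(* The term carrying the derivative of [g] is dominated by A |w|, again by [partial_g]. *)
apply: (@Lfun2_le _ _ _ _ (fun x => A * w x)).
- rewrite (_ : (fun x => _) = (fun x => Num.sqrt (g x) * w' x +
    partial (i, j) g x * (2^-1 / Num.sqrt (g x)) * w x - Num.sqrt (g x) * w' x)).
    by apply: measurable_funB => //; exact: locally_integrable_measurable uv.1.
  by apply/funext => x; rewrite addrAC subrr add0r.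
- move=> x; rewrite !normrM ler_wpM2r// -normrM (ger0_norm A0).
  have [z|nz] := eqVneq (Num.sqrt (g x)) 0.
    by rewrite z invr0 mulr0 normr0 mulr0.
  have s0 : 0 < Num.sqrt (g x) by rewrite lt_neqAle eq_sym nz sqrtr_ge0.
  rewrite [X in _ * X]ger0_norm ?mulr_ge0 ?invr_ge0 ?sqrtr_ge0//.
  rewrite mulrA ler_pdivrMr// (le_trans _ (gA (i, j) x))//.
  by have h2 : 2^-1 <= 1 :> R by [lra]; rewrite ler_piMr.
- apply: (Lfun2_mulr (s := cst A) (C := A)) => // x.
  by rewrite ger0_norm.
Qed.

Let u_perm (s : 'S_n.+1) x : u (row_perm s x) = u x.
Proof.
rewrite /u /plan_amplitude /w; congr (Num.sqrt _ * _); last first.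
  rewrite [RHS](reindex_perm s)/=; apply: eq_bigr => i _.
  by congr f; apply/rowP => j; rewrite !mxE.
rewrite /g /plan_factor.
pose h (l : index) : index := [ffun i => l (s i)].
pose h' (l : index) : index := [ffun i => l (s^-1 i)%g].
rewrite (reindex h)/=; last first.
  by exists h' => l _; apply/ffunP => i; rewrite !ffunE ?permK ?permKV.
apply: eq_bigr => l _; congr (_ * _ ^+ 2).
  rewrite /plan_coef p_sym; congr (_ / _).
  by rewrite [RHS](reindex_perm s)/=; apply: eq_bigr => i _; rewrite ffunE.
rewrite /tensor_th [RHS](reindex_perm s)/=; apply: eq_bigr => i _.
by rewrite ffunE; congr th; apply/rowP => j; rewrite !mxE.
Qed.

Let u_sqr x : u x ^+ 2 = \sum_l plan_coef l *
  \prod_i (th (l i) (row i x) ^+ 2 * rho (row i x)).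
Proof.
rewrite /u /plan_amplitude exprMn sqr_sqrtr// /w -prodrXl mulr_suml.
apply: eq_bigr => l _; rewrite -mulrA; congr (_ * _).
rewrite /tensor_th -prodrXl -big_split/=; apply: eq_bigr => i _.
by rewrite sqr_sqrtr.
Qed.

(** The quotient of [cell_mass b] by itself is 1, or 0 for a massless cell; the latter are dealt
    with almost everywhere in [plan_wave_density]. *)
Let u_marginal x : (\int[mu]_(y in [set: 'M[R]_(n, d)]) (u (insert_row ord0 (x, y)) ^+ 2)%:E =
  (\sum_b (cell_mass b / cell_mass b) * (th b x ^+ 2 * rho x))%:E)%E.
Proof.
have mt l : measurable_fun setT (fun y : 'M[R]_(n, d) =>
    \prod_(i < n) (th (l i) (row i y) ^+ 2 * rho (row i y))).
  exact: (measurable_tensor (f := fun i v => th (l i) v ^+ 2 * rho v)).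
have t0 (l : 'I_n -> K) (y : 'M[R]_(n, d)) : 0 <= \prod_(i < n) (th (l i) (row i y) ^+ 2 * rho (row i y)).
  by apply: prodr_ge0 => i _.
transitivity (\int[mu]_(y in [set: 'M[R]_(n, d)]) \sum_l
    ((plan_coef l * (th (l ord0) x ^+ 2 * rho x)) *
     \prod_(i < n) (th (l (lift ord0 i)) (row i y) ^+ 2 * rho (row i y)))%:E)%E.
  apply: eq_integral => y _; rewrite u_sqr sumEFin; congr EFin.
  apply: eq_bigr => l _; rewrite big_ord_recl row_insert_row !mulrA; congr (_ * _).
  by apply: eq_bigr => i _; rewrite row_lift_insert_row.
rewrite ge0_integral_sum//; last 2 first.
- by move=> l; apply/measurable_EFinP; apply: measurable_funM => //; exact: mt.
- by move=> l y _; rewrite lee_fin mulr_ge0 ?t0// mulr_ge0.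
transitivity (\sum_l ((plan_coef l * (th (l ord0) x ^+ 2 * rho x)) *
     \prod_(i < n) cell_mass (l (lift ord0 i)))%:E)%E.
  apply: eq_bigr => l _; under eq_integral do rewrite EFinM.
  rewrite ge0_integralZl//.
  - rewrite (integral_tensor (f := fun i v => th (l (lift ord0 i)) v ^+ 2 * rho v)
      (r := fun i => cell_mass (l (lift ord0 i))))// => i.
    exact: cell_massE.
  - by apply/measurable_EFinP; exact: mt.
  - by move=> y _; rewrite lee_fin t0.
  - by rewrite lee_fin mulr_ge0.
rewrite sumEFin; congr EFin.
rewrite (partition_big (fun l : index => l ord0) predT)//=.
apply: eq_bigr => b _.
transitivity (\sum_(l : index | l ord0 == b) p l * ((cell_mass b)^-1 * (th b x ^+ 2 * rho x))).
  apply: eq_bigr => l /eqP lb; rewrite lb mulrAC [RHS]mulrA; congr (_ * _).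
  rewrite /plan_coef big_ord_recl lb.
  (* If another cell of [l] has no mass, then [p l] is 0 and both sides vanish. *)
  have [z|nz] := eqVneq (\prod_(i < n) cell_mass (l (lift ord0 i))) 0.
    have [i _ /eqP i0] : exists2 i : 'I_n, true & cell_mass (l (lift ord0 i)) == 0.
      by move/eqP: z => /prodf_eq0.
    by rewrite (p_eq0 i0) !mul0r.
  by rewrite invfM mulrA mulfVK.
by rewrite -mulr_suml p_marg [LHS]mulrA.
Qed.

Let pos (z : configuration R d n.+1) : 'M[R]_(n.+1, d) := \matrix_(i, j) (z i).1 ord0 j.

(** All spins are 0, an assignment fixed by every permutation, so symmetry is a matter of positions
    only. *)
Definition plan_wave : wave_function R d n.+1 := fun z =>
  if [forall i, (z i).2 == ord0] then (u (pos z))%:C%C else 0.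

Let zero_spin : {ffun 'I_n.+1 -> 'I_2} := [ffun=> ord0].

Let plan_waveE x (alpha : {ffun 'I_n.+1 -> 'I_2}) :
  plan_wave (config x alpha) = if alpha == zero_spin then (u x)%:C%C else 0.
Proof.
rewrite /plan_wave /config /=.
have -> : [forall i, alpha i == ord0] = (alpha == zero_spin).
  apply/forallP/eqP => [a0|-> i]; last by rewrite ffunE.
  by apply/ffunP => i; rewrite ffunE; exact/eqP.
case: ifP => // _; congr (u _)%:C%C.
by apply/matrixP => i j; rewrite !mxE.
Qed.

Let normsqE x (alpha : {ffun 'I_n.+1 -> 'I_2}) :
  normsq (plan_wave (config x alpha)) = if alpha == zero_spin then u x ^+ 2 else 0.
Proof.
rewrite plan_waveE; case: ifP => _; rewrite /normsq /= expr0n ?addr0//.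
Qed.

Let sum_zero_spin (F : {ffun 'I_n.+1 -> 'I_2} -> \bar R) :
  (forall alpha, alpha != zero_spin -> F alpha = 0%E) ->
  (\sum_alpha F alpha = F zero_spin)%E.
Proof.
by move=> F0; rewrite (bigD1 zero_spin)//= big1 ?adde0// => alpha /F0.
Qed.

Let plan_wave_H1 : in_H1_wave plan_wave.
Proof.
move=> alpha; split.
  rewrite (_ : re_part _ _ = if alpha == zero_spin then u else cst 0).
    by case: ifP => _; [exact: u_H1|exact: in_H10].
  by apply/funext => x; rewrite /re_part plan_waveE; case: ifP.
rewrite (_ : im_part _ _ = cst 0); first exact: in_H10.
by apply/funext => x; rewrite /im_part plan_waveE; case: ifP.
Qed.

(** A massless cell contributes theta^2 rho, which has integral 0 and so vanishes almost everywhere;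
    the remaining quotients are 1 and the squares of theta add up to 1. *)
Lemma plan_wave_density : has_wave_density plan_wave rho.
Proof.
have ae0 : {ae mu, forall x, forall b, cell_mass b = 0 -> th b x ^+ 2 * rho x = 0}.
  apply: filter_forall => b.
  have [m0|m0] := eqVneq (cell_mass b) 0; last first.
    by apply: aeW => x mb; move: m0; rewrite mb eqxx.
  have : ae_eq mu setT (fun x => (th b x ^+ 2 * rho x)%:E) (cst 0%E).
    apply/(ae_eq_integral_abs _ measurableT); first exact/measurable_EFinP.
    by rewrite -[RHS]/(0%:E) -m0 -cell_massE; apply: eq_integral => x _; rewrite gee0_abs ?lee_fin.
  by apply: filterS => x /(_ I)[].
apply: filterS ae0 => x x0.
rewrite /density sum_zero_spin; last first.
  move=> alpha /negbTE a0; apply: integral0_eq => y _.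
  by rewrite normsqE a0.
under eq_integral do rewrite normsqE eqxx col_mxE_insert_row.
rewrite u_marginal -[in RHS](mul1r (rho x)) -(sum_th x) mulr_suml.
congr EFin; apply: eq_bigr => b _.
have [m0|m0] := eqVneq (cell_mass b) 0; last by rewrite mulfV// mul1r.
by rewrite m0 !mul0r x0.
Qed.

Let mu2 : measurable_fun setT (fun x => (u x ^+ 2)%:E).
Proof.
apply/measurable_EFinP; apply: measurable_funX.
by have [/Lfun2P[]] := u_H1.
Qed.

Lemma plan_wave_bosonic : bosonic plan_wave.
Proof.
split; first exact: plan_wave_H1.
- rewrite /int_config sum_zero_spin; last first.
    move=> alpha /negbTE a0; apply: integral0_eq => y _.
    by rewrite normsqE a0.
  under eq_integral do rewrite normsqE eqxx.
  (* Normalisation follows from the density: integrating out all rows but the first leaves [rho]. *)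
  rewrite (ge0_integral_insert_row ord0)//; last first.
    by move=> x; rewrite lee_fin sqr_ge0.
  have [_ <- _] := hrho; apply: ge0_ae_eq_integral => //.
  + apply: (measurable_fun_fubini_tonelli_F (m2 := mu)
      ((fun x => (u x ^+ 2)%:E) \o insert_row ord0)) => [|q]; last by rewrite /= lee_fin sqr_ge0.
    by apply: measurableT_comp => //; exact: measurable_insert_row.
  + exact/measurable_EFinP.
  + by move=> x _; apply: integral_ge0 => y _; rewrite lee_fin sqr_ge0.
  + by move=> x _; rewrite lee_fin.
  apply: filterS plan_wave_density => x <- _.
  rewrite /density sum_zero_spin; last first.
    move=> alpha /negbTE a0; apply: integral0_eq => y _.
    by rewrite normsqE a0.
  by apply: eq_integral => y _; rewrite normsqE eqxx col_mxE_insert_row.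
- move=> s alpha; apply: aeW => x.
  have -> : config x alpha \o s = config (row_perm s x) [ffun i => alpha (s i)].
    apply/funext => i; rewrite /config /= ffunE; congr pair.
    by apply/rowP => j; rewrite !mxE.
  rewrite !plan_waveE u_perm; congr (if _ then _ else _).
  apply/eqP/eqP => [/ffunP as0|->].
    by apply/ffunP => i; have := as0 (s^-1 i)%g; rewrite !ffunE permKV.
  by apply/ffunP => i; rewrite !ffunE.
Qed.

(** On the product of cells [l] the energy times [p l] is at most [E l], and the normalised density
    on that product has integral at most 1. *)
Lemma plan_wave_energy (E : index -> R) : (forall l, 0 <= E l) ->
  (forall l x, tensor_th l x != 0 -> (energy x * (p l)%:E <= (E l)%:E)%E) ->
  (V_ee plan_wave <= (\sum_l E l)%:E)%E.
Proof.
move=> E0 pE; rewrite V_eeE sum_zero_spin; last first.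
  move=> alpha /negbTE a0; apply: integral0_eq => y _.
  by rewrite normsqE a0 mul0e.
pose t l (x : 'M[R]_(n.+1, d)) := \prod_i (th (l i) (row i x) ^+ 2 * rho (row i x)).
have mt (l : index) : measurable_fun setT (t l).
  exact: (measurable_tensor (f := fun i v => th (l i) v ^+ 2 * rho v)).
have t0 (l : index) x : 0 <= t l x by apply: prodr_ge0 => i _.
have P0 (l : index) : 0 <= \prod_i cell_mass (l i).
  by apply: prodr_ge0 => i _; exact: cell_mass_ge0.
apply: (@le_trans _ _ (\int[mu]_x \sum_l ((E l / \prod_i cell_mass (l i)) * t l x)%:E)%E).
  apply: ge0_le_integral => //.
  - by move=> x _; rewrite normsqE eqxx mule_ge0 ?energy_ge0// lee_fin sqr_ge0.
  - under eq_fun do rewrite normsqE eqxx.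
    by apply: emeasurable_funM => //; exact: measurable_energy.
  - apply: emeasurable_sum => l; apply/measurable_EFinP.
    by apply: measurable_funM.
  move=> x _; rewrite normsqE eqxx u_sqr -sumEFin ge0_sume_distrl; last first.
    by move=> l _; rewrite lee_fin mulr_ge0 ?coef0 ?(t0 l).
  apply: lee_sum => l _; rewrite -/(t l x).
  have [tx|tx] := eqVneq (t l x) 0; first by rewrite tx !mulr0 mul0e.
  have thx : tensor_th l x != 0.
    apply: contraNneq tx => z; rewrite /t big_split/=.
    by rewrite prodrXl -/(tensor_th l x) z expr0n/= mul0r.
  rewrite /plan_coef (_ : (p l / _ * _)%:E = (p l)%:E * (t l x / \prod_i cell_mass (l i))%:E)%E; last first.
    by rewrite -EFinM; congr EFin; rewrite mulrAC mulrA.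
  rewrite (_ : (E l / _ * _)%:E = (E l)%:E * (t l x / \prod_i cell_mass (l i))%:E)%E; last first.
    by rewrite -EFinM; congr EFin; rewrite mulrAC mulrA.
  rewrite muleC muleA lee_wpmul2r ?lee_fin ?divr_ge0//.
  exact: pE.
rewrite ge0_integral_sum//; last 2 first.
- by move=> l; apply/measurable_EFinP; exact: measurable_funM.
- by move=> l x _; rewrite lee_fin mulr_ge0// divr_ge0.
rewrite -sumEFin; apply: lee_sum => l _.
under eq_integral do rewrite EFinM.
rewrite ge0_integralZl//; last 3 first.
- exact/measurable_EFinP.
- by move=> x _; rewrite lee_fin.
- by rewrite lee_fin divr_ge0.
rewrite (integral_tensor (f := fun i v => th (l i) v ^+ 2 * rho v)
  (r := fun i => cell_mass (l i)))//; last by move=> i; exact: cell_massE.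
rewrite -EFinM lee_fin.
have [z|nz] := eqVneq (\prod_i cell_mass (l i)) 0; first by rewrite z mulr0.
by rewrite mulfVK.
Qed.

End plan_wave.

(** * Couplings of finite cost: free choices, support points, reservoirs, spread configurations *)

Lemma free_injection (N : nat) (blocked : pred 'I_(N + N)) (f : 'I_(N + N) -> 'I_N) :
  {in blocked &, injective f} ->
  exists a : 'I_N -> 'I_(N + N), injective a /\ forall i, ~~ blocked (a i).
Proof.
move=> finj.
have cb : (#|blocked| <= N)%N.
  by rewrite -(card_in_image finj) -[leqRHS]card_ord max_card.
have cf : (N <= #|[predC blocked]|)%N.
  by have := cardC blocked; rewrite card_ord => /esym/eqP;
     rewrite -(leq_add2l #|blocked|); move=> /eqP <-; rewrite leq_add2r.
exists (fun i => enum_val (widen_ord cf i)); split.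
  by move=> i j /enum_val_inj/(congr1 val)/= /val_inj.
by move=> i; have := enum_valP (widen_ord cf i); rewrite inE.
Qed.

Section couplings.
Context (R : realType) (d n : nat) (rho : 'rV[R]_d -> R)
  (P : probability 'M[R]_(n, d) R).
Notation M := 'M[R]_(n, d).

Definition support_point (y : M) : Prop :=
  forall b : R, 0 < b -> (0 < P [set x | forall i j, `|y i j - x i j| < b]%R)%E.

Lemma measurable_neighbourhood (y : M) (b : R) :
  measurable [set x : M | forall i j, `|y i j - x i j| < b].
Proof.
rewrite (_ : mkset _ = obox (fun i j => y i j - b) (fun i j => y i j + b)).
  exact: measurable_obox.
rewrite oboxE; apply/seteqP; split=> x /= yx i j.
  by rewrite -ltr_distlC.
by rewrite ltr_distlC.
Qed.

(** A point outside the support lies in a rational box of probability 0, and there are countably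
    many such boxes. *)
Lemma ae_support_point : {ae P, forall y, support_point y}.
Proof.
pose null (p : 'M[rat]_(n, d) * 'M[rat]_(n, d)) := `[< P (@rat_box R n d p) = 0%E >].
pose F k := if unpickle k is Some p then
  (if null p then @rat_box R n d p else set0) else set0.
apply: (@negligibleS _ _ _ _ (\bigcup_k F k)); last first.
  apply: negligible_bigcup => k; rewrite /F /null; case: unpickle => [p|].
    case: asboolP => [p0|_]; last exact: negligible_set0.
    have mp : measurable (@rat_box R n d p) by exact: measurable_obox.
    exact: (((negligibleP P mp).2 p0)).
  exact: negligible_set0.
move=> y /existsNP[b /not_implyP[b0 yb]].
have yb0 : P [set x | forall i j, `|y i j - x i j| < b]%R = 0%E.
  by apply/eqP; rewrite eq_le measure_ge0 andbT leNgt; exact/negP.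
have [p [py pb]] := rat_box_near y b0.
exists (pickle p) => //; rewrite /F pickleK /null; case: asboolP => //; case.
apply/eqP; rewrite eq_le measure_ge0 andbT -yb0.
by apply: le_measure => //; rewrite inE;
  [exact: measurable_obox|exact: measurable_neighbourhood].
Qed.

Lemma ae_rows_distinct : (coulomb_cost P < +oo)%E ->
  {ae P, forall x, forall i j : 'I_n, i != j -> row i x != row j x}.
Proof.
move=> Poo.
have ie : P.-integrable setT (@energy R d n).
  apply/integrableP; split; first exact: measurable_energy.
  by under eq_integral do rewrite gee0_abs ?energy_ge0//.
apply: filterS (integrable_ae measurableT ie) => x /(_ I) ex i j ij.
apply/eqP => rij; move: ex; rewrite (_ : energy x = +oo%E)//.
wlog lij : i j ij rij / (i < j)%N.
  move=> H; have [lij|lji|/val_inj eij] := ltngtP i j; first exact: (H i j).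
    by apply: (H j i); rewrite // eq_sym.
  by move: ij; rewrite eij eqxx.
rewrite /energy (bigD1 i)//= (bigD1 j)//= {1}/coulomb rij eqxx.
rewrite addye; last first.
  by rewrite gt_eqF//; apply: lt_le_trans (sume_ge0 _ _) => //; move=> k _; exact: coulomb_ge0.
rewrite addye// gt_eqF//; apply: lt_le_trans (sume_ge0 _ _) => //.
by move=> k _; apply: sume_ge0 => l _; exact: coulomb_ge0.
Qed.

Hypothesis cP : couplings rho P.
Hypothesis mrho : measurable_fun setT rho.
Hypothesis rho0 : forall x, 0 <= rho x.

Lemma coupling_integral i (h : 'rV[R]_d -> R) : measurable_fun setT h ->
  (forall v, 0 <= h v) ->
  (\int[P]_x (h (row i x))%:E = \int[lebesgue_mx]_v (h v * rho v)%:E)%E.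
Proof.
move=> mh h0; have mr := @measurable_row R n d i.
rewrite -[LHS](ge0_integral_pushforward mr P (D := setT) (f := EFin \o h))//; last 2 first.
- exact/measurable_EFinP.
- by move=> v _; rewrite /= lee_fin.
rewrite (ge0_integral_density (mu := @lebesgue_mx R 1 d) mrho rho0)//.
- by move=> A mA; exact: (cP i mA).
- exact/measurable_EFinP.
Qed.

(** The marginals have a density, and a point is Lebesgue null in positive dimension. *)
Lemma ae_row_neq i (v : 'rV[R]_d) : (0 < d)%N -> {ae P, forall x, row i x != v}.
Proof.
move=> d0.
have m1 : measurable [set v].
  by apply: compact_measurable_mx; exact: compact_set1.
have v0 : lebesgue_mx [set v] = 0%E.
  rewrite (_ : [set v] = box (fun k j => [set v k j])).
    rewrite (@lebesgue_mx_box _ _ _ _ (fun _ _ => 0)).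
    - by rewrite big_ord1 prodr_const card_ord expr0n eqn0Ngt d0.
    - by move=> k j; exact: measurable_set1.
    - by move=> k j; rewrite lebesgue_measure_set1.
  apply/seteqP; split=> [_ -> //|x xv].
  by apply/matrixP => k j; exact: xv.
exists (row i @^-1` [set v]); split.
- by rewrite -[X in measurable X]setTI; exact: measurable_row.
- rewrite -[LHS]/(pushforward P (row i) [set v]) (cP i m1).
  by apply: null_set_integral => //; apply/measurable_EFinP/measurable_funTS.
- by move=> x /= /negP/negPn/eqP.
Qed.

(** One configuration at a time: almost every one is a support point, has distinct rows, and avoids
    the finitely many rows chosen so far. *)
Lemma reservoirs (m : nat) : (0 < d)%N -> (coulomb_cost P < +oo)%E ->
  exists y : nat -> M, (forall a, (a < m)%N -> support_point (y a)) /\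
    forall a b i j, (a < m)%N -> (b < m)%N -> row i (y a) = row j (y b) -> a = b /\ i = j.
Proof.
move=> d0 Poo; elim: m => [|m [y [sy dy]]].
  by exists (fun=> 0).
have PT : (0 < P setT)%E by rewrite probability_setT.
have sep_y : {ae P, forall z : M, forall q : 'I_n * ('I_m * 'I_n),
    row q.1 z != row q.2.2 (y q.2.1)}.
  by apply: filter_forall => q; exact: ae_row_neq.
have [|z [[sz dz] az]] := filter_ex
  (filterI (filterI ae_support_point (ae_rows_distinct Poo)) sep_y).
  exact: ae_properfilter_algebraOfSetsType.
exists (fun a => if (a < m)%N then y a else z); split.
  by move=> a; case: ifP => [am _|]; [exact: sy|].
move=> a b i j; rewrite !ltnS => am bm.
case: ifP => am'; case: ifP => bm'.
- exact: dy.
- by move=> e; have /= := az (j, (Ordinal am', i)); rewrite e eqxx.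
- by move=> e; have /= := az (i, (Ordinal bm', j)); rewrite e eqxx.
have -> : a = m by apply/eqP; rewrite eqn_leq am leqNgt am'.
have -> : b = m by apply/eqP; rewrite eqn_leq bm leqNgt bm'.
by move=> e; split => //; apply/eqP/negPn/negP => /dz; rewrite e eqxx.
Qed.

Definition spread (t : nat) : set M :=
  [set x : M | (forall i j, `|x i j| <= t%:R) /\
           forall i j : 'I_n, i != j -> t.+1%:R^-1 <= `|row i x - row j x|]%R.

Lemma measurable_spread t : measurable (spread t).
Proof.
rewrite (_ : spread t = (\bigcap_(ij in [set: 'I_n * 'I_d]) [set x : M | `|x ij.1 ij.2| <= t%:R]) `&`
   \bigcap_(ij in [set: 'I_n * 'I_n]) [set x : M | ij.1 != ij.2 -> t.+1%:R^-1 <= `|row ij.1 x - row ij.2 x|]).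
  have norm_le (f : M -> R) c : measurable_fun setT f -> measurable [set x | f x <= c].
    move=> mf; rewrite -[X in measurable X]setTI.
    by have := mf measurableT _ (measurable_itv `]-oo, c]); congr measurable;
      apply/seteqP; split=> x []; rewrite /= in_itv.
  apply: measurableI; apply: fin_bigcap_measurable; try exact: finite_finset.
    by move=> ij _; apply: norm_le; apply: measurableT_comp => //; exact: measurable_mx_coord.
  move=> [i j] _ /=; case: (i != j) => /=; last first.
    by rewrite (_ : mkset _ = setT)//; apply/seteqP; split.
  rewrite (_ : mkset _ = [set x : M | - `|row i x - row j x| <= - t.+1%:R^-1]).
    apply: norm_le; apply: measurableT_comp => //; apply: continuous_measurable_mx => x.
    exact: (continuous_comp (@continuous_row_sub R d n i j x) (@norm_continuous _ _ _)).
  by apply/seteqP; split=> x /=; rewrite lerN2; [apply|].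
apply/seteqP; split=> x [x1 x2]; split.
- by move=> ij _ /=; exact: x1.
- by move=> ij _ /=; exact: x2.
- by move=> i j; exact: (x1 (i, j)).
- by move=> i j; exact: (x2 (i, j)).
Qed.

(** The complements of the spread sets decrease to a set of configurations with two equal rows,
    which is null at finite cost. *)
Lemma spread_lt (e : R) : (coulomb_cost P < +oo)%E -> 0 < e ->
  exists t0 : nat, forall t, (t0 <= t)%N -> (P (~` spread t) <= e%:E)%E.
Proof.
Proof.
move=> Poo e0; pose B t := ~` spread t.
have mB t : measurable (B t) by apply: measurableC; exact: measurable_spread.
have spreadS s t : (s <= t)%N -> spread s `<=` spread t.
  move=> st x [x1 x2]; split=> [i j|i j ij].
    by rewrite (le_trans (x1 i j))// ler_nat.
  by rewrite (le_trans _ (x2 i j ij))// lef_pV2 ?posrE// ler_nat.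
have capB : P (\bigcap_t B t) = 0%E.
  apply/negligibleP; first exact: bigcap_measurable.
  apply: negligibleS (ae_rows_distinct Poo) => x xB dx.
  have [t0 t0P] : exists t : nat, spread t x.
    pose f (ij : 'I_n * 'I_d) := (Num.truncn `|x ij.1 ij.2|).+1.
    pose g (ij : 'I_n * 'I_n) := (Num.truncn `|row ij.1 x - row ij.2 x|^-1).+1.
    (* A sum of naturals exceeds each of them, hence every coordinate and every inverse distance. *)
    exists (\sum_ij f ij + \sum_ij g ij)%N; split=> [i j|i j ij].
      rewrite (le_trans (ltW (truncnS_gt _)))// ler_nat.
      by rewrite (leq_trans _ (leq_addr _ _))// (bigD1 (i, j))//= leq_addr.
    have r0 : 0 < `|row i x - row j x| by rewrite normr_gt0 subr_eq0 dx.
    rewrite -[leRHS]invrK lef_pV2 ?posrE ?invr_gt0//.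
    rewrite (le_trans (ltW (truncnS_gt _)))// ler_nat leqW//.
    by rewrite (leq_trans _ (leq_addl _ _))// (bigD1 (i, j))//= leq_addr.
  exact: (xB t0 I).
have : P \o B @ \oo --> (0 : \bar R).
  rewrite -capB; apply: nonincreasing_cvg_mu => //.
  - by rewrite (le_lt_trans (probability_le1 _ _))// ltry.
  - exact: bigcap_measurable.
  - by move=> s t st; apply/subsetPset/subsetC/spreadS.
have e1 : nbhs (0 : \bar R) [set x | x < e%:E]%E 
  by apply: open_nbhs_nbhs; split; [exact: open_ereal_lt_ereal|rewrite /= lte_fin].
move=> /(_ _ e1)[t0 _ t0P]; exists t0 => t /t0P /ltW; exact.
Qed.

End couplings.

(** * Averaging a plan over permutations *)

Section symmetrized.
Context (R : realType) (d n : nat) (rho : 'rV[R]_d -> R) (hrho : in_H rho)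
  (K : finType) (th : K -> 'rV[R]_d -> R)
  (tame_th : forall N i b, tame (fun x : 'M[R]_(N, d) => th b (row i x)))
  (sum_th : forall v, \sum_b th b v ^+ 2 = 1).
Notation index := {ffun 'I_n.+1 -> K}.

Definition permute_index (s : 'S_n.+1) (l : index) : index := [ffun i => l (s i)].

Lemma permute_index_bij s : bijective (permute_index s).
Proof.
exists (permute_index s^-1%g) => l; apply/ffunP => i;
  by rewrite !ffunE ?permK ?permKV.
Qed.

Definition symmetrize (q : index -> R) l : R :=
  (n.+1`!)%:R^-1 * \sum_(s : 'S_n.+1) q (permute_index s l).

Lemma symmetrize_ge0 q l : (forall l, 0 <= q l) -> 0 <= symmetrize q l.
Proof. by move=> q0; rewrite mulr_ge0 ?invr_ge0// sumr_ge0. Qed.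

Lemma symmetrize_permute q s l : symmetrize q (permute_index s l) = symmetrize q l.
Proof.
congr (_ * _); rewrite [RHS](reindex_inj (mulIg s))/=; apply: eq_bigr => t _.
by congr q; apply/ffunP => i; rewrite !ffunE permM.
Qed.

Let card_perm_neq0 : (n.+1`!)%:R != 0 :> R.
Proof. by rewrite pnatr_eq0 -lt0n fact_gt0. Qed.

Let sum_perm_cst (c : R) : \sum_(s : 'S_n.+1) c = (n.+1`!)%:R * c.
Proof. by rewrite sumr_const card_Sn mulr_natl. Qed.

Lemma sum_symmetrize q : \sum_l symmetrize q l = \sum_l q l.
Proof.
rewrite -mulr_sumr exchange_big/= (eq_bigr (fun=> \sum_l q l)).
  by rewrite sum_perm_cst mulKf.
by move=> s _; rewrite [RHS](reindex (permute_index s))//; exact/onW_bij/permute_index_bij.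
Qed.

Lemma marginal_symmetrize q (m : K -> R) :
  (forall i b, \sum_(l : index | l i == b) q l = m b) ->
  forall i b, \sum_(l : index | l i == b) symmetrize q l = m b.
Proof.
move=> qm i b; rewrite -mulr_sumr exchange_big/= (eq_bigr (fun=> m b)).
  by rewrite sum_perm_cst mulKf.
move=> s _; rewrite -(qm (s^-1 i)%g b).
rewrite [RHS](reindex (permute_index s))/=; last exact/onW_bij/permute_index_bij.
by apply: eq_bigl => l; rewrite ffunE permKV.
Qed.

(** The energy is invariant under permutations, so averaging [q] and [E] together keeps the bound
    and the total of [E]. The marginals survive because they are the same for every coordinate. *)
Lemma symmetrized_wave (q E : index -> R) :
  (forall l, 0 <= q l) -> (forall l, 0 <= E l) ->
  (forall i b, \sum_(l : index | l i == b) q l = cell_mass rho th b) ->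
  (forall l x, tensor_th th l x != 0 -> (energy x * (q l)%:E <= (E l)%:E)%E) ->
  exists psi : wave_function R d n.+1,
    [/\ bosonic psi, has_wave_density psi rho & (V_ee psi <= (\sum_l E l)%:E)%E].
Proof.
move=> q0 E0 qm qE.
have sq0 l := symmetrize_ge0 l q0; have sE0 l := symmetrize_ge0 l E0.
have sqm := marginal_symmetrize qm.
have sqs := symmetrize_permute q.
exists (plan_wave rho th (symmetrize q)); split.
- exact: plan_wave_bosonic.
- exact: plan_wave_density.
rewrite -sum_symmetrize; apply: plan_wave_energy => // l x lx.
have energy_ge0 := energy_ge0 x.
rewrite /symmetrize !EFinM -!sumEFin muleCA lee_wpmul2l ?lee_fin ?invr_ge0//.
rewrite ge0_sume_distrr; last by move=> s _; rewrite lee_fin.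
apply: lee_sum => s _; rewrite -(energy_row_perm s); apply: qE.
rewrite /tensor_th (reindex_perm s^-1%g)/=.
move: lx; congr (_ != 0); apply: eq_bigr => i _.
rewrite ffunE permKV; congr th; apply/rowP => j; rewrite !mxE permKV//.
Qed.

End symmetrized.

(** * Discretising a coupling: weights and costs of products of cells *)

Section cell_weight.
Context (R : realType) (d n : nat) (rho : 'rV[R]_d -> R) (hrho : in_H rho)
  (K : finType) (th : K -> 'rV[R]_d -> R)
  (tame_th : forall N i b, tame (fun x : 'M[R]_(N, d) => th b (row i x)))
  (sum_th : forall v, \sum_b th b v ^+ 2 = 1)
  (P : probability 'M[R]_(n.+1, d) R) (cP : couplings rho P).
Notation index := {ffun 'I_n.+1 -> K}.
Local Open Scope ereal_scope.

Let sqr_tensor (l : index) x : R := (tensor_th th l x ^+ 2)%R.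

Let sqr_tensor_ge0 l x : (0 <= sqr_tensor l x)%R.
Proof. exact: sqr_ge0. Qed.

Let measurable_sqr_tensor l : measurable_fun setT (sqr_tensor l).
Proof.
apply: measurable_funX; apply: continuous_measurable_mx.
by apply: smooth_continuous; exact: (tame_tensor_th tame_th l).1.
Qed.

Let sqr_tensor_le1 (Q : pred index) x : (\sum_(l | Q l) sqr_tensor l x <= 1)%R.
Proof.
rewrite -(sum_sqr_tensor_th sum_th x) [leRHS](bigID Q)/= lerDl.
by apply: sumr_ge0 => l _; exact: sqr_ge0.
Qed.

Let measurable_sum_sqr (Q : pred index) :
  measurable_fun setT (fun x => (\sum_(l | Q l) sqr_tensor l x)%:E).
Proof.
apply/measurable_EFinP; under eq_fun do rewrite big_mkcond/=.
by apply: measurable_sum => l; case: (Q l).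
Qed.

Definition cell_weight (l : index) : R := fine (\int[P]_x (tensor_th th l x ^+ 2)%:E).

Lemma cell_weightE l : \int[P]_x (tensor_th th l x ^+ 2)%:E = (cell_weight l)%:E.
Proof.
rewrite fineK// ge0_fin_numE; last by apply: integral_ge0 => x _; rewrite lee_fin sqr_ge0.
apply: (@le_lt_trans _ _ (\int[P]_x 1)); last by rewrite integral_cst// mul1e (le_lt_trans (probability_le1 P measurableT)) ?ltry.
apply: ge0_le_integral => //.
- by move=> x _; rewrite lee_fin sqr_ge0.
- by apply/measurable_EFinP; exact: measurable_sqr_tensor.
- move=> x _; rewrite lee_fin; have := sqr_tensor_le1 (pred1 l) x.
  by rewrite big_pred1_eq.
Qed.

Lemma cell_weight_ge0 l : (0 <= cell_weight l)%R.
Proof. by rewrite -lee_fin -cell_weightE integral_ge0// => x _; rewrite lee_fin sqr_ge0. Qed.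

Lemma sum_cell_weight (Q : pred index) :
  (\sum_(l | Q l) cell_weight l)%:E = \int[P]_x (\sum_(l | Q l) tensor_th th l x ^+ 2)%:E.
Proof.
under eq_integral do rewrite -sumEFin.
rewrite -sumEFin; under eq_bigr do rewrite -cell_weightE.
pose f l x := if Q l then (sqr_tensor l x)%:E else 0.
rewrite big_mkcond; under [RHS]eq_integral do rewrite big_mkcond/=.
have mf l : measurable_fun setT (f l).
  rewrite /f; case: (Q l) => //.
  by apply/measurable_EFinP; exact: measurable_sqr_tensor.
have f0 l x : setT x -> 0 <= f l x.
  by move=> _; rewrite /f; case: (Q l); rewrite ?lee_fin.
rewrite (ge0_integral_sum P measurableT mf f0)//.
apply: eq_bigr => l _; rewrite /f; case: (Q l) => //.
by rewrite integral0.
Qed.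

Lemma marginal_cell_weight i b :
  (\sum_(l : index | l i == b) cell_weight l)%R = cell_mass rho th b.
Proof.
apply: EFin_inj; rewrite sum_cell_weight.
transitivity (\int[P]_x (th b (row i x) ^+ 2)%:E).
  apply: eq_integral => x _; congr EFin; rewrite /tensor_th.
  under eq_bigr do rewrite -prodrXl.
  by rewrite (sum_prod_fixed (F := fun i c => (th c (row i x) ^+ 2)%R)).
have [rho0 _ _] := hrho.
have mthb : measurable_fun setT (fun v => th b v ^+ 2)%R.
  by apply: measurable_funX; exact: (measurable_th tame_th).
rewrite (coupling_integral cP (measurable_density hrho) rho0 i mthb).
- exact: (cell_massE hrho tame_th sum_th).
- by move=> v; exact: sqr_ge0.
Qed.

(** On [A] the indices outside [Q] contribute nothing, so the squares over [Q] alone add up to 1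
    there. The converse estimate [cell_weight_le] uses that the squares over [Q] vanish off [A]. *)
Lemma cell_weight_ge (A : set 'M[R]_(n.+1, d)) (Q : pred index) : measurable A ->
  (forall x l, A x -> tensor_th th l x != 0%R -> Q l) ->
  P A <= (\sum_(l | Q l) cell_weight l)%:E.
Proof.
move=> mA AQ; rewrite sum_cell_weight.
rewrite -[P A]mul1e -integral_cst// integral_mkcond.
apply: ge0_le_integral => //.
- by move=> x _; rewrite patchE; case: ifP.
- by apply/(measurable_restrictT _ _).1 => //.
move=> x _; rewrite patchE; case: ifPn => [/set_mem Ax|_]; last first.
  by rewrite lee_fin sumr_ge0// => l _; exact: sqr_ge0.
rewrite lee_fin -(sum_sqr_tensor_th sum_th x) [leLHS](bigID Q)/= gerDl.
rewrite le_eqVlt; apply/orP; left; rewrite big1// => l /negP Ql.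
by apply/eqP; rewrite sqrf_eq0; apply/negPn/negP => /(AQ _ _ Ax).
Qed.

Lemma cell_weight_le (A : set 'M[R]_(n.+1, d)) (Q : pred index) : measurable A ->
  (forall x l, Q l -> tensor_th th l x != 0%R -> A x) ->
  (\sum_(l | Q l) cell_weight l)%:E <= P A.
Proof.
move=> mA AQ; rewrite sum_cell_weight.
rewrite -[P A]mul1e -integral_cst// [leRHS]integral_mkcond.
apply: ge0_le_integral => //.
- by move=> x _; rewrite lee_fin sumr_ge0// => l _; exact: sqr_ge0.
- by apply/(measurable_restrictT _ _).1.
move=> x _; rewrite patchE; case: ifPn => [_|/negP Ax].
  by rewrite lee_fin sqr_tensor_le1.
rewrite lee_fin big1// => l Ql; apply/eqP; rewrite sqrf_eq0.
by apply/negPn/negP => /(AQ _ _ Ql) ?; apply: Ax; rewrite inE.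
Qed.

Hypothesis Poo : coulomb_cost P < +oo.

Definition cell_cost (l : index) : R :=
  fine (\int[P]_x (energy x * (tensor_th th l x ^+ 2)%:E)).

Let menergy l : measurable_fun setT (fun x => energy x * (sqr_tensor l x)%:E).
Proof.
apply: emeasurable_funM; first exact: measurable_energy.
exact/measurable_EFinP.
Qed.

Let energy_sqr_ge0 l x : 0 <= energy x * (sqr_tensor l x)%:E.
Proof. by rewrite mule_ge0 ?energy_ge0 ?lee_fin. Qed.

Lemma cell_costE l : \int[P]_x (energy x * (tensor_th th l x ^+ 2)%:E) = (cell_cost l)%:E.
Proof.
rewrite fineK// ge0_fin_numE; last by apply: integral_ge0 => x _; exact: energy_sqr_ge0.
apply: le_lt_trans Poo; rewrite -[coulomb_cost P]/(\int[P]_x energy x).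
apply: ge0_le_integral => //.
- by move=> x _; exact: energy_sqr_ge0.
- exact: menergy.
- exact: measurable_energy.
- move=> x _; rewrite -[leRHS]mule1 lee_wpmul2l ?energy_ge0// lee_fin.
  by have := sqr_tensor_le1 (pred1 l) x; rewrite big_pred1_eq.
Qed.

Lemma cell_cost_ge0 l : (0 <= cell_cost l)%R.
Proof. by rewrite -lee_fin -cell_costE integral_ge0// => x _; exact: energy_sqr_ge0. Qed.

Lemma sum_cell_cost : (\sum_l cell_cost l)%:E = coulomb_cost P.
Proof.
rewrite -sumEFin; under eq_bigr do rewrite -cell_costE.
rewrite -(ge0_integral_sum P measurableT menergy (fun l x _ => energy_sqr_ge0 l x)).
rewrite -[coulomb_cost P]/(\int[P]_x energy x); apply: eq_integral => x _.
rewrite -ge0_sume_distrr; last by move=> l _; rewrite lee_fin.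
by rewrite sumEFin sum_sqr_tensor_th// mule1.
Qed.

(** The comparison of [energy x] with [energy y] is integrated in [y] against [P] weighted by the
    cell [l]. *)
Lemma energy_cell_weight_le (c : R) (x : 'M[R]_(n.+1, d)) l : (0 <= c)%R ->
  (forall y : 'M[R]_(n.+1, d), tensor_th th l y != 0%R -> energy x <= c%:E * energy y) ->
  energy x * (cell_weight l)%:E <= (c * cell_cost l)%:E.
Proof.
move=> c0 xy; rewrite EFinM -cell_weightE -cell_costE.
have msqr : measurable_fun setT (fun y => (sqr_tensor l y)%:E).
  by apply/measurable_EFinP; exact: measurable_sqr_tensor.
have c0' : 0 <= c%:E by rewrite lee_fin.
have sqr0 y : setT y -> 0 <= (sqr_tensor l y)%:E by rewrite lee_fin.
rewrite -(ge0_integralZl P measurableT msqr sqr0 (energy_ge0 x)).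
rewrite -(ge0_integralZl P measurableT (menergy l) (fun y _ => energy_sqr_ge0 l y) c0').
apply: ge0_le_integral => //.
- by move=> y _; rewrite mule_ge0 ?energy_ge0 ?lee_fin.
- by apply: emeasurable_funM.
- by apply: emeasurable_funM.
move=> y _; have [ly|ly] := eqVneq (tensor_th th l y) 0%R.
  by rewrite /sqr_tensor ly expr0n/= !mule0.
by rewrite muleA lee_wpmul2r ?lee_fin//; exact: xy.
Qed.

End cell_weight.

(** * Distances between cells and reservoirs *)

Lemma row_dist_perturb (R : realType) (d n : nat) (c : R) (x u : 'M[R]_(n, d)) i j :
  (forall i, `|row i u - row i x| <= c) ->
  `|row i u - row j u| <= `|row i x - row j x| + 2 * c.
Proof.
move=> ux; rewrite (_ : row i u - row j u =
  (row i x - row j x) + ((row i u - row i x) - (row j u - row j x))).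
  rewrite (le_trans (ler_normD _ _))// lerD2l (le_trans (ler_normB _ _))//.
  by rewrite mulr_natl mulr2n lerD.
by apply/rowP => k; rewrite !mxE; ring.
Qed.

Lemma row_norm_le (R : realType) (d : nat) (v1 v2 : 'rV[R]_d) :
  `|v2| <= `|v1| + `|v1 - v2|.
Proof. by have := ler_normB v1 (v1 - v2); rewrite opprB addrCA subrr addr0. Qed.

Section geometry.
Context (R : realType) (d n : nat) (K : finType) (th : K -> 'rV[R]_d -> R) (ell w : R).
Hypothesis th_diam : forall b (u v : 'rV[R]_d), `|u| <= ell ->
  th b u != 0 -> th b v != 0 -> `|u - v| < 2 * w.
Notation N := n.+1.
Notation index := {ffun 'I_n.+1 -> K}.

Lemma tensor_th_neq0 (l : index) (x : 'M[R]_(N, d)) i :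
  tensor_th th l x != 0 -> th (l i) (row i x) != 0.
Proof. by move/prodf_neq0/(_ i isT). Qed.

Lemma energy_cell_perturb (k : index) (u x y : 'M[R]_(N, d)) (delta e : R) :
  0 <= w -> 0 < delta -> 0 <= e -> 8 * w <= delta -> 16 * (d%:R * w) <= e * delta ->
  (forall i, `|row i u| <= ell) ->
  (forall i j : 'I_N, i != j -> delta <= `|row i u - row j u|) ->
  tensor_th th k u != 0 -> tensor_th th k x != 0 -> tensor_th th k y != 0 ->
  (energy x <= (1 + e)%:E * energy y)%E.
Proof.
move=> w0 delta0 e0 wdelta we uell usep ku kx ky.
have ux z i : tensor_th th k z != 0 -> `|row i u - row i z| < 2 * w.
  by move=> kz; apply: (th_diam (b := k i)) => //; exact: tensor_th_neq0.
(* Both [x] and [y] lie within 2w of [u], the point known to be in the ball. So the rows of [x] stay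
   delta - 4w >= delta/2 apart, and [x] and [y] differ by at most 4w. *)
apply: (@energy_perturb _ _ _ (delta / 2) (4 * w)) => //; try lra.
  move=> i j ij; have := usep i j ij.
  have : forall i, `|row i u - row i x| <= 2 * w by move=> i'; exact/ltW/ux.
  by move=> /(@row_dist_perturb _ _ _ _ x u i j) h1 h2; lra.
move=> i j; have := ux x i kx; have := ux y i ky.
have : y i j - x i j = (row i y - row i x) 0 j by rewrite !mxE.
move=> -> h1 h2; apply: le_trans (ler_mx_coord _ _ _) _.
rewrite (_ : row i y - row i x = (row i u - row i x) - (row i u - row i y)).
  by rewrite (le_trans (ler_normB _ _))//; lra.
by apply/rowP => j'; rewrite !mxE; ring.
Qed.

Variables (y : 'I_(N + N) -> 'M[R]_(N, d)) (beta : R).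
Hypotheses (beta0 : 0 < beta) (wbeta : 2 * w <= beta)
  (y_ell : forall a i, `|row i (y a)| + 3 * beta <= ell)
  (y_sep : forall a a' i i', (a, i) != (a', i') -> 8 * beta <= `|row i (y a) - row i' (y a')|).

Let dist_triangle (v1 v2 v3 : 'rV[R]_d) : `|v1 - v3| <= `|v1 - v2| + `|v2 - v3|.
Proof. exact: ler_distD. Qed.

Definition reaches a (k : index) : Prop := exists2 u : 'M[R]_(N, d),
  tensor_th th k u != 0 & forall i, `|row i (y a) - row i u| < beta.

(** The margin 3 beta leaves distance beta after a reservoir row has moved by 2 beta, the bound of
    [reaches_near]. *)
Definition blocks (k : index) a : Prop := exists i i' v,
  th (k i) v != 0 /\ `|row i' (y a) - v| < 3 * beta.

Lemma reaches_near a r i v : reaches a r -> th (r i) v != 0 -> `|row i (y a) - v| < 2 * beta.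
Proof.
move=> [u ru yu] rv; have ui := yu i.
have : `|row i u - v| < 2 * w.
  apply: (th_diam _ (tensor_th_neq0 i ru) rv).
  have := y_ell a i; have := row_norm_le (row i (y a)) (row i u).
  by move: beta0 ui => h1 h2 h3 h4; lra.
have := dist_triangle (row i (y a)) (row i u) v.
by move: ui wbeta => h1 h2 h3 h4; lra.
Qed.

(** A cell near two reservoirs would put their rows within 3 beta + 2w + 3 beta <= 7 beta, against
    the separation 8 beta. *)
Lemma blocks_inj (k : index) a a' i j j' v v' :
  th (k i) v != 0 -> `|row j (y a) - v| < 3 * beta ->
  th (k i) v' != 0 -> `|row j' (y a') - v'| < 3 * beta -> a = a'.
Proof.
move=> kv yv kv' yv'; apply/eqP/negPn/negP => aa'.
have : `|v - v'| < 2 * w.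
  apply: (th_diam _ kv kv').
  have := y_ell a j; have := row_norm_le (row j (y a)) v.
  by move: yv beta0 => h1 h2 h3 h4; lra.
have : 8 * beta <= `|row j (y a) - row j' (y a')|.
  by apply: y_sep; rewrite xpair_eqE (negbTE aa').
have := dist_triangle (row j (y a)) v (row j' (y a')).
have := dist_triangle v v' (row j' (y a')).
rewrite (distrC v' (row j' _)).
by move: yv yv' wbeta beta0 => h1 h2 h3 h4 h5 h6 h7 h8; lra.
Qed.

(** Sending a blocked reservoir to a coordinate of [k] that blocks it is injective by [blocks_inj],
    so at most N of the 2N reservoirs are blocked. *)
Lemma unblocked_assignment : exists a : index -> 'I_N -> 'I_(N + N),
  forall k, injective (a k) /\ forall i, ~ blocks k (a k i).
Proof.
suff /choice[a ?] : forall k : index, exists a : 'I_N -> 'I_(N + N),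
  injective a /\ forall i, ~ blocks k (a i) by exists a.
move=> k.
have /choice[f fP] : forall a, exists i, blocks k a -> exists i' v,
    th (k i) v != 0 /\ `|row i' (y a) - v| < 3 * beta.
  move=> a; have [[i [i' [v h]]]|nb] := pselect (blocks k a).
    by exists i => _; exists i', v.
  by exists ord0 => /nb.
have finj : {in [pred a | `[< blocks k a >]] &, injective f}.
  move=> a a'; rewrite !inE => ba ba' ff.
  have [j [v [kv yv]]] := fP a ba; have [j' [v' [kv' yv']]] := fP a' ba'.
  by rewrite -ff in kv'; exact: blocks_inj kv yv kv' yv'.
have [a [ainj an]] := free_injection finj.
by exists a; split=> // i ab; have /negP := an i; apply; exact/asboolP.
Qed.

(** Exactly one coordinate comes from [k], the others from reservoirs. A row from a reservoir is
    within 2 beta of it: two such rows are at least 8 beta - 4 beta apart, and such a row is at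
    least 3 beta - 2 beta from the row coming from [k]. *)
Lemma swapped_rows_separated (a : index -> 'I_N -> 'I_(N + N)) (k l : index) (s : 'I_N) x :
  injective (a k) -> (forall i, ~ blocks k (a k i)) ->
  (forall i, if i + s == ord0 then l i = k i
             else exists2 r, reaches (a k (i + s)) r & r i = l i) ->
  tensor_th th l x != 0 ->
  forall i j : 'I_N, i != j -> beta <= `|row i x - row j x|.
Proof.
move=> ainj anb lP lx.
have near i : i + s != ord0 -> `|row i (y (a k (i + s))) - row i x| < 2 * beta.
  move=> /negbTE is0; have := lP i; rewrite is0 => -[r ar ri].
  by apply: reaches_near ar _; rewrite ri; exact: tensor_th_neq0.
have half i j : i + s = ord0 -> i != j -> beta <= `|row i x - row j x|.
  move=> is0 ij; have js0 : j + s != ord0.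
    by rewrite -is0 (inj_eq (addIr s)) eq_sym.
  have := near j js0; have : 3 * beta <= `|row j (y (a k (j + s))) - row i x|.
    rewrite leNgt; apply/negP => yx; apply: (anb (j + s)).
    exists i, j, (row i x); split => //.
    by have := lP i; rewrite is0 eqxx => <-; exact: tensor_th_neq0.
  have := dist_triangle (row j (y (a k (j + s)))) (row j x) (row i x).
  by rewrite (distrC (row j x) (row i x)) => h1 h2 h3; lra.
move=> i j ij; have [is0|is0] := eqVneq (i + s) ord0; first exact: half.
have [js0|js0] := eqVneq (j + s) ord0.
  by rewrite distrC; apply: half; rewrite // eq_sym.
have := near i is0; have := near j js0.
set yi := row i (y _); set yj := row j (y _).
have : 8 * beta <= `|yi - yj|.
  by apply: y_sep; rewrite xpair_eqE (negbTE ij) andbF.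
have := dist_triangle yi (row i x) yj; have := dist_triangle (row i x) (row j x) yj.
rewrite (distrC (row j x) yj).
by move: beta0 => h0 h1 h2 h3 h4 h5; lra.
Qed.

End geometry.

(** * Assembling a nearly optimal wave function *)

Lemma mx_norm_le (R : realType) m n (x : 'M[R]_(m, n)) e : 0 <= e ->
  (forall i j, `|x i j| <= e) -> `|x| <= e.
Proof.
by move=> e0 xe; rewrite [leLHS]/Num.norm/= mx_normrE; apply/bigmax_leP; split.
Qed.

Section swapped_wave.
Context (R : realType) (d n : nat) (rho : 'rV[R]_d -> R) (hrho : in_H rho)
  (P : probability 'M[R]_(n.+1, d) R) (cP : couplings rho P)
  (Poo : (coulomb_cost P < +oo)%E)
  (K : finType) (th : K -> 'rV[R]_d -> R)
  (tame_th : forall N i b, tame (fun x : 'M[R]_(N, d) => th b (row i x)))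
  (sum_th : forall v, \sum_b th b v ^+ 2 = 1).
Notation N := n.+1.
Notation index := {ffun 'I_n.+1 -> K}.
Variables (t : nat) (w beta eta kappa e : R) (y : 'I_(N + N) -> 'M[R]_(N, d)).
Hypotheses
  (th_diam : forall b (u v : 'rV[R]_d), `|u| <= t%:R ->
    th b u != 0 -> th b v != 0 -> `|u - v| < 2 * w)
  (w0 : 0 <= w) (wbeta : 2 * w <= beta) (wt : 8 * w <= t.+1%:R^-1)
  (e0 : 0 <= e) (wte : 16 * (d%:R * w) <= e * t.+1%:R^-1)
  (beta0 : 0 < beta) (tbeta : t.+1%:R^-1 <= beta)
  (y_t : forall a i, `|row i (y a)| + 3 * beta <= t%:R)
  (y_sep : forall a a' i i', (a, i) != (a', i') -> 8 * beta <= `|row i (y a) - row i' (y a')|)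
  (kappa0 : 0 < kappa)
  (y_kappa : forall a, (kappa%:E <= P [set x | forall i j, `|y a i j - x i j| < beta]%R)%E)
  (etakappa : N%:R * eta <= kappa)
  (t_eta : (P (~` spread t) <= eta%:E)%E).

Let p := cell_weight th P.

(** The bad indices. One spread point in a product of cells is enough to keep it, since the energy
    is then comparable on the whole product. *)
Let D : pred index := fun k => `[< forall u, tensor_th th k u != 0 -> ~ spread t u >].

Let S a : pred index := fun k => `[< reaches th y beta a k >].

Let reaches_spread a (u : 'M[R]_(N, d)) :
  (forall i, `|row i (y a) - row i u| < beta) -> spread t u.
Proof.
move=> yu; split=> [i j|i j ij].
  have ut : `|row i u| <= t%:R.
    have := row_norm_le (row i (y a)) (row i u).
    by move: (yu i) (y_t a i) beta0 => h1 h2 h3 h4; lra.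
  by have := ler_mx_coord (row i u) 0 j; rewrite mxE => /le_trans; apply.
have /(@row_dist_perturb _ _ _ _ u (y a) i j) : forall i, `|row i (y a) - row i u| <= beta.
  by move=> i'; exact/ltW/yu.
have : 8 * beta <= `|row i (y a) - row j (y a)|.
  by apply: y_sep; rewrite xpair_eqE (negbTE ij) andbF.
move: tbeta beta0; set z := t.+1%:R^-1 => h1 h2 h3 h4.
by have : z <= `|row i u - row j u| by lra.
Qed.

Let SD a k : S a k -> ~~ D k.
Proof.
move=> /asboolP[u ku yu]; apply/negP => /asboolP/(_ u ku); apply.
exact: reaches_spread yu.
Qed.

Let Skappa a : kappa <= \sum_(k | S a k) p k.
Proof.
rewrite -lee_fin (le_trans (y_kappa a))//.
apply: (cell_weight_ge tame_th sum_th); first exact: measurable_neighbourhood.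
move=> x l /= yx lx; apply/asboolP; exists x => // i.
apply: mx_norm_lt => // k j; rewrite !mxE; exact: yx.
Qed.

Let Deta : \sum_(k | D k) p k <= eta.
Proof.
rewrite -lee_fin (le_trans _ t_eta)//.
apply: (cell_weight_le tame_th sum_th); first by apply: measurableC; exact: measurable_spread.
by move=> x l /asboolP Dl lx; exact: Dl.
Qed.

(** Kept mass costs at most 1 + e times what it costs under [P]; new mass is at most N eta in total,
    at energy at most N^2 / beta. *)
Lemma swapped_wave : exists psi : wave_function R d N,
  [/\ bosonic psi, has_wave_density psi rho &
  (V_ee psi <= (1 + e)%:E * coulomb_cost P + (N%:R * (N%:R * beta^-1) * (N%:R * eta))%:E)%E].
Proof.
have [a aP] := unblocked_assignment th_diam beta0 wbeta y_t y_sep.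
have p0 k : 0 <= p k by exact: (cell_weight_ge0 tame_th sum_th).
have [kept [new [kept0 new0 sum_new newP q_marg]]] :=
  swap_plan a p0 SD kappa0 Skappa Deta etakappa.
pose B : R := N%:R * (N%:R * beta^-1).
have B0 : 0 <= B by rewrite !mulr_ge0// invr_ge0 ltW.
have cost0 l : 0 <= cell_cost th P l by exact: (cell_cost_ge0 tame_th sum_th Poo).
have e1 : 0 <= 1 + e by rewrite addr_ge0.
pose E l := (1 + e) * cell_cost th P l + B * new l.
have kept_ge0 l : 0 <= kept l by have /andP[] := kept0 l.
have [psi [bpsi dpsi psiE]] : exists psi : wave_function R d N,
    [/\ bosonic psi, has_wave_density psi rho & (V_ee psi <= (\sum_l E l)%:E)%E].
  apply: (symmetrized_wave hrho tame_th sum_th (q := fun l => kept l + new l)).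
  - by move=> l; rewrite addr_ge0.
  - by move=> l; rewrite addr_ge0// mulr_ge0.
  - move=> i b; rewrite q_marg.
    exact: (marginal_cell_weight hrho tame_th sum_th cP).
  move=> l x lx; rewrite !EFinD ge0_muleDr ?lee_fin//; apply: leeD.
    have [->|kl] := eqVneq (kept l) 0; first by rewrite mule0 lee_fin mulr_ge0.
    have /andP[_ kp] := kept0 l.
    have Dl : ~~ D l.
      apply: contraNN kl => Dl; rewrite Dl in kp.
      by rewrite eq_le kp kept_ge0.
    rewrite (negbTE Dl) in kp.
    (* A kept index is not bad; its spread point is the reference for comparing energies on the
       cell. *)
    have [u lu [ut usep]] : exists2 u, tensor_th th l u != 0 & spread t u.
      by move: Dl => /asboolPn/existsNP[u /not_implyP[lu /contrapT us]]; exists u.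
    rewrite (@le_trans _ _ (energy x * (p l)%:E)%E)//.
      by rewrite lee_wpmul2l ?energy_ge0// lee_fin.
    apply: (energy_cell_weight_le tame_th sum_th Poo e1) => z lz.
    apply: (energy_cell_perturb th_diam (u := u) (k := l) (delta := t.+1%:R^-1)) => //.
    by move=> i; apply: mx_norm_le => // i' j; rewrite mxE; exact: ut.
  have [->|nl] := eqVneq (new l) 0; first by rewrite mule0 mulr0.
  have [k [s [Dk lk]]] := newP l nl; have [ainj anb] := aP k.
  rewrite EFinM lee_wpmul2r ?lee_fin//; apply: energy_le => // i j ij.
  apply: (swapped_rows_separated th_diam beta0 wbeta y_t y_sep ainj anb (l := l) (s := s)) => //.
  move=> i'; have := lk i'; case: (_ == _) => // -[r /asboolP ? ?].
  by exists r.
exists psi; split => //; apply: (le_trans psiE).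
rewrite -(sum_cell_cost tame_th sum_th Poo) -EFinM -EFinD lee_fin big_split/=.
by rewrite -!mulr_sumr lerD2l ler_wpM2l.
Qed.

End swapped_wave.

(** * Choice of the parameters *)

Lemma finite_lower_bound (R : realFieldType) (I : finType) (Q : pred I) (f : I -> R) :
  (forall i, Q i -> 0 < f i) -> exists2 c, 0 < c & forall i, Q i -> c <= f i.
Proof.
move=> f0; exists (\big[Order.min/1]_(i | Q i) f i).
  by apply/bigmin_gtP; split.
by move=> i Qi; exact: bigmin_le_cond.
Qed.

Lemma finite_upper_bound (R : realType) (I : finType) (f : I -> R) :
  exists t : nat, forall i, f i <= t%:R.
Proof.
exists (\sum_i (Num.truncn (f i)).+1)%N => i.
by rewrite (le_trans (ltW (truncnS_gt _)))// ler_nat (bigD1 i)//= leq_addr.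
Qed.

(** The order of the choices matters: the reservoirs fix [beta], their neighbourhoods fix [kappa],
    both fix the admissible bad mass [eta], which fixes the scale [t], which fixes the cell size
    [w]. *)
Lemma near_optimal_wave (R : realType) (d n : nat) (rho : 'rV[R]_d -> R)
    (P : probability 'M[R]_(n.+1, d) R) (e : R) :
  (0 < d)%N -> in_H rho -> couplings rho P -> (coulomb_cost P < +oo)%E -> 0 < e ->
  exists psi : wave_function R d n.+1,
    [/\ bosonic psi, has_wave_density psi rho &
        (V_ee psi <= coulomb_cost P + e%:E)%E].
Proof.
move=> d0 hrho cP Poo e0; set N := n.+1.
have [y0 [sy0 dy0]] := reservoirs cP (measurable_density hrho) (N + N)%N d0 Poo.
pose y (a : 'I_(N + N)) := y0 a.
have N0 : 0 < N%:R :> R by rewrite ltr0n.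
have dR0 : 0 < d%:R :> R by rewrite ltr0n.
have [beta8 beta80 y_sep] : exists2 beta8 : R, 0 < beta8 & forall a a' i i',
    (a, i) != (a', i') -> beta8 <= `|row i (y a) - row i' (y a')|.
  have [|b b0 bP] := @finite_lower_bound R (('I_(N + N) * 'I_N) * ('I_(N + N) * 'I_N))%type
    (fun q => q.1 != q.2) (fun q => `|row q.1.2 (y q.1.1) - row q.2.2 (y q.2.1)|).
    move=> [[a i] [a' i']] /= ne; rewrite normr_gt0 subr_eq0.
    apply: contraNneq ne => /(dy0 _ _ _ _ (ltn_ord a) (ltn_ord a'))[/val_inj -> ->].
    by [].
  by exists b => // a a' i i' ne; exact: (bP ((a, i), (a', i')) ne).
pose beta := beta8 / 8.
have beta0 : 0 < beta by rewrite divr_gt0.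
have beta8E : 8 * beta = beta8 by rewrite /beta mulrC divfK.
rewrite -beta8E in y_sep.
have [kappa kappa0 y_kappa] : exists2 kappa : R, 0 < kappa & forall a,
    (kappa%:E <= P [set x | forall i j, `|y a i j - x i j| < beta]%R)%E.
  have Pfin a : P [set x | forall i j, `|y a i j - x i j| < beta]%R \is a fin_num.
    by apply: fin_num_measure; exact: measurable_neighbourhood.
  have [|k k0 kP] := @finite_lower_bound R 'I_(N + N) predT
    (fun a => fine (P [set x | forall i j, `|y a i j - x i j| < beta]%R)).
    by move=> a _; rewrite -lte_fin fineK//; apply: sy0.
  by exists k => // a; rewrite -[leRHS]fineK// lee_fin; exact: kP.
pose B : R := N%:R * (N%:R * beta^-1).
have B0 : 0 < B by rewrite !mulr_gt0// invr_gt0.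
(* The first bound lets the reservoirs pay for the exchange; the second keeps the energy of the new
   mass below e/2. *)
pose eta := Num.min (kappa / N%:R) (e / 2 / (B * N%:R)).
have eta0 : 0 < eta by rewrite lt_min !divr_gt0// mulr_gt0.
have etakappa : N%:R * eta <= kappa.
  by rewrite mulrC -ler_pdivlMr// /eta ge_min lexx.
have Beta : B * (N%:R * eta) <= e / 2.
  have h : eta <= e / 2 / (B * N%:R) by rewrite /eta ge_min lexx orbT.
  rewrite ler_pdivlMr in h; last exact: mulr_gt0.
  by rewrite (_ : B * _ = eta * (B * N%:R)); last by ring.
have cost0 : (0 <= coulomb_cost P)%E by apply: integral_ge0 => x _; exact: energy_ge0.
have costE : coulomb_cost P = (fine (coulomb_cost P))%:E.
  by rewrite fineK// ge0_fin_numE.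
set cost := fine (coulomb_cost P) in costE.
have c0 : 0 <= cost by rewrite -lee_fin -costE.
(* The relative error on kept cells then costs at most e/2; adding 1 keeps the denominator positive
   when the cost is 0. *)
pose eps := e / 2 / (cost + 1).
have eps0 : 0 < eps by rewrite !divr_gt0// ltr_wpDl.
have epscost : eps * cost <= e / 2.
  by rewrite /eps mulrAC ler_pdivrMr ?ltr_wpDl// ler_wpM2l ?lerDl ?divr_ge0// ltW.
have [t0 t0P] := spread_lt Poo eta0.
have [t1 t1P] := @finite_upper_bound R ('I_(N + N) * 'I_N)%type
  (fun q => `|row q.2 (y q.1)| + 3 * beta).
have [t2 t2P] := @finite_upper_bound R unit (fun=> beta^-1).
(* [t0] makes the bad mass at most [eta], [t1] puts the reservoirs well inside the ball, and [t2]
   gives 1/(t+1) <= beta. *)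
pose t := (t0 + t1 + t2)%N.
have t_eta : (P (~` spread t) <= eta%:E)%E.
  by apply: t0P; rewrite /t -addnA leq_addr.
have y_t a i : `|row i (y a)| + 3 * beta <= t%:R.
  by rewrite (le_trans (t1P (a, i)))// ler_nat /t addnAC leq_addl.
have tbeta : t.+1%:R^-1 <= beta.
  by rewrite invf_ple ?posrE// (le_trans (t2P tt))// ler_nat leqW// leq_addl.
pose delta : R := t.+1%:R^-1.
have delta0 : 0 < delta by rewrite invr_gt0.
pose w := Num.min (beta / 2) (Num.min (delta / 8) (eps * delta / (16 * d%:R))).
have w0 : 0 < w by rewrite !lt_min; apply/and3P; split; rewrite divr_gt0// mulr_gt0.
have wbeta : 2 * w <= beta by rewrite mulrC -ler_pdivlMr// /w ge_min lexx.
have wt : 8 * w <= delta by rewrite mulrC -ler_pdivlMr// /w !ge_min lexx orbT.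
have wte : 16 * (d%:R * w) <= eps * delta.
  have h : w <= eps * delta / (16 * d%:R) by rewrite /w !ge_min lexx !orbT.
  rewrite ler_pdivlMr ?mulr_gt0// in h.
  by rewrite (_ : 16 * _ = w * (16 * d%:R)); last by ring.
(* [L] and [T] are chosen to meet the two conditions of [theta_diam] for the ball of radius [t]. *)
pose L := t%:R + w.
pose T := (Num.truncn ((t%:R + L + w) / w)).+1.
have LT : t%:R + L + w < w * T%:R.
  by rewrite mulrC -ltr_pdivrMr// truncnS_gt.
have th_diam (b : {ffun 'I_d * 'I_T -> bool}) (u v : 'rV[R]_d) : `|u| <= t%:R ->
    theta L w b u != 0 -> theta L w b v != 0 -> `|u - v| < 2 * w.
  move=> ut bu bv; apply: mx_norm_lt => [|i j]; first by rewrite mulr_gt0.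
  rewrite (ord1 i) !mxE; apply: (theta_diam w0 (lexx L) LT _ bu bv) => j'.
  exact: le_trans (ler_mx_coord _ _ _) ut.
have [psi [bpsi dpsi psiV]] := swapped_wave hrho cP Poo (@tame_theta R d T L w)
  (@sum_sqr_theta R d T L w) th_diam (ltW w0) wbeta wt (ltW eps0) wte beta0 tbeta
  y_t y_sep kappa0 y_kappa etakappa t_eta.
exists psi; split => //; apply: (le_trans psiV).
rewrite costE -EFinM -!EFinD lee_fin mulrDl mul1r -addrA lerD2l.
by rewrite [leRHS]splitr; apply: lerD.
Qed.

(** * The two bounds and the limit *)

Section classical_limit.
Context (R : realType) (d n : nat) (mass : R) (mass0 : 0 < mass)
  (rho : 'rV[R]_d -> R) (hrho : in_H rho).
Local Open Scope ereal_scope.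

Lemma kinetic_ge0 hbar (psi : wave_function R d n.+1) : 0 <= kinetic mass hbar psi.
Proof.
apply: mule_ge0; first by rewrite lee_fin divr_ge0 ?sqr_ge0// mulr_ge0// ltW.
apply: sume_ge0 => alpha _; apply: integral_ge0 => x _; rewrite lee_fin.
by apply: sumr_ge0 => ij _; rewrite addr_ge0 ?sqr_ge0.
Qed.

Lemma C_opt_le_F_S hbar : C_opt n.+1 rho <= F_S n mass hbar rho.
Proof.
apply: le_ereal_inf_tmp => _ [psi [bpsi dpsi] <-].
have [rho0 _ _] := hrho.
have [P cP PE] := coupling_of_wave bpsi dpsi (measurable_density hrho) rho0.
apply: (@le_trans _ _ (V_ee psi)).
  by rewrite -PE; apply: ereal_inf_lbound; exists P.
by rewrite leeDr// kinetic_ge0.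
Qed.

Lemma C_opt_ge0 : 0 <= C_opt n.+1 rho.
Proof.
apply: le_ereal_inf_tmp => _ [P _ <-].
by apply: integral_ge0 => x _; exact: energy_ge0.
Qed.

(** The error is split in three: a nearly optimal coupling, a nearly optimal wave function for it,
    and the kinetic energy of that fixed wave function. *)
Lemma near_F_S_le (e : R) : (0 < d)%N -> C_opt n.+1 rho < +oo -> (0 < e)%R ->
  \forall hbar \near 0%R^'+, F_S n mass hbar rho <= C_opt n.+1 rho + e%:E.
Proof.
move=> d0 Coo e0.
have Cfin : C_opt n.+1 rho \is a fin_num by rewrite ge0_fin_numE ?C_opt_ge0.
have e3 : (0 < e / 3)%R by rewrite divr_gt0.
have [_ [P cP <-]] := lb_ereal_inf_adherent e3 Cfin.
rewrite -/(C_opt n.+1 rho) => Plt.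
have Poo : coulomb_cost P < +oo.
  by apply: lt_trans Plt _; rewrite -(fineK Cfin) -EFinD ltry.
have [psi [bpsi dpsi psiV]] := near_optimal_wave d0 hrho cP Poo e3.
have [H1 _ _] := bpsi; have Koo := kinetic_lty H1.
set K := (X in X < +oo) in Koo.
have K0 : 0 <= K.
  apply: sume_ge0 => alpha _; apply: integral_ge0 => x _; rewrite lee_fin.
  by apply: sumr_ge0 => ij _; rewrite addr_ge0 ?sqr_ge0.
have KE : K = (fine K)%:E by rewrite fineK// ge0_fin_numE.
have k0 : (0 <= fine K)%R by exact: fine_ge0.
(* For hbar <= 1 the square of hbar is at most hbar, so hbar <= [h0] brings the kinetic energy below
   e/3. *)
pose h0 : R := (e / 3 * (2 * mass) / (fine K + 1))%R.
have k1 : (0 < fine K + 1)%R by rewrite ltr_wpDl.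
have m2 : (0 < 2 * mass)%R by rewrite mulr_gt0.
have h00 : (0 < h0)%R by rewrite divr_gt0// mulr_gt0.
near=> hbar.
have hbar0 : (0 < hbar)%R by near: hbar; exact: nbhs_right_gt.
have hbar1 : (hbar <= 1)%R by near: hbar; exact: nbhs_right_le.
have hbarh : (hbar <= h0)%R by near: hbar; exact: nbhs_right_le.
apply: (@le_trans _ _ (kinetic mass hbar psi + V_ee psi)).
  by apply: ereal_inf_lbound; exists psi.
have kin : kinetic mass hbar psi <= (e / 3)%:E.
  rewrite /kinetic -/K KE -EFinM lee_fin mulrAC ler_pdivrMr//.
  apply: (@le_trans _ _ (h0 * fine K)%R).
    rewrite ler_wpM2r// (le_trans _ hbarh)// expr2 ler_piMr// ltW//.
  rewrite /h0 mulrAC ler_pdivrMr// ler_wpM2l ?lerDl//.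
  by rewrite mulr_ge0 ?ltW.
rewrite (@le_trans _ _ ((e / 3)%:E + ((C_opt n.+1 rho + (e / 3)%:E) + (e / 3)%:E)))//.
  apply: leeD => //; apply: (le_trans psiV); apply: leeD => //.
  exact: ltW.
by rewrite -(fineK Cfin) -!EFinD lee_fin; lra.
Unshelve. all: by end_near.
Qed.

End classical_limit.

(* N = n.+1 is the number of particles. *)
Theorem theorem1p1 (R : realType) (d n : nat) (hd : (0 < d)%N)
    (mass : R) (hmass : 0 < mass) (rho : 'rV[R]_d -> R) (hrho : in_H rho) :
  F_S n mass hbar rho @[hbar --> 0^'+] --> C_opt n.+1 rho.
Proof.
have [Coo|] := ltP (C_opt n.+1 rho) +oo%E; last first.
  (* Infinite optimal cost: the lower bound makes the energy infinite for every hbar. *)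
  rewrite leye_eq => /eqP Coo; rewrite (_ : (fun hbar => _) = cst (C_opt n.+1 rho)).
    exact: cvg_cst.
  apply/funext => hbar; rewrite Coo; apply/eqP; rewrite -leye_eq -Coo.
  exact: C_opt_le_F_S.
have CE : C_opt n.+1 rho = (fine (C_opt n.+1 rho))%:E.
  by rewrite fineK// ge0_fin_numE ?C_opt_ge0.
(* Finite optimal cost: the two bounds force the energy to be real and within e/2 of the limit, so a
   real ball inside the neighbourhood suffices. *)
move=> A; rewrite CE => nA.
have /nbhs_ballP[e /= e0 eA] : nbhs (fine (C_opt n.+1 rho)) (fun r => A r%:E) by exact: nA.
have e20 : 0 < e / 2 by rewrite divr_gt0.
have := near_F_S_le hmass hrho hd Coo e20; apply: filterS => hbar Fle.
have := C_opt_le_F_S n hmass hrho hbar.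
move: Fle; rewrite CE /=; case: (F_S _ _ _ _) => [f| |]//.
rewrite -EFinD !lee_fin => fle fge; apply: (eA f).
rewrite /ball /=; rewrite ltr_distlC; lra.
Qed.
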